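(* Let $\Phi\in L^\infty(\mathbb{M}_{n,n})$ satisfy $\|H_\Phi\|_{\mathrm e}<1$. Then $\Phi$ has a unitary interpolant $U$ satisfying $\|H_{U^*}\|_{\mathrm e}<1$ if and only if $\|H_\Phi\|\le 1$.
   Context: $\mathbb{T}$ is the unit circle, $\mathbb{M}_{m,n}$ the space of complex $m\times n$ matrices. $H^2(\mathbb{C}^n)$ is the vector-valued Hardy space, $H^2_-(\mathbb{C}^m)=L^2(\mathbb{C}^m)\ominus H^2(\mathbb{C}^m)$, and $\mathbb{P}_-$ is the orthogonal projection onto $H^2_-$. For $\Phi\in L^\infty(\mathbb{M}_{m,n})$ the Hankel operator $H_\Phi:H^2(\mathbb{C}^n)\to H^2_-(\mathbb{C}^m)$ is $H_\Phi f=\mathbb{P}_-\Phi f$; $\|\cdot\|_{\mathrm e}$ denotes the essential norm (distance to the compact operators). A unitary interpolant of $\Phi\in L^\infty(\mathbb{M}_{n,n})$ is a function $U\in L^\infty(\mathbb{M}_{n,n})$ whose values are unitary matrices a.e. on $\mathbb{T}$ and such that $\hat U(j)=\hat\Phi(j)$ for all $j<0$ (equivalently $\Phi-U\in H^\infty(\mathbb{M}_{n,n})$). *)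

(* Defs.v *)
From HB Require Import structures.
From mathcomp Require Import all_boot all_order all_algebra.
From mathcomp Require Import all_classical all_reals all_analysis.
From mathcomp Require Import complex.
Set Implicit Arguments. Unset Strict Implicit. Unset Printing Implicit Defensive.
Import Order.TTheory GRing.Theory Num.Theory.
Import numFieldNormedType.Exports.
Local Open Scope classical_set_scope.
Local Open Scope ring_scope.

(* The unit circle T is parametrised by t in [0,1] via t |-> exp(2 pi i t);
   normalised Lebesgue measure on T becomes Lebesgue measure on [0,1]. *)
Section Hankel.
Variable R : realType.
Local Notation C := (R[i]).
Local Notation mu := (@lebesgue_measure R).

Definition Tdom : set R := `[0%R, 1%R].

Definition cabs2 (z : C) : R := (@complex.Re R z) ^+ 2 + (@complex.Im R z) ^+ 2.

Definition cint (g : R -> C) : C :=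
  Complex (Rintegral mu Tdom (fun t => (@complex.Re R) (g t)))
          (Rintegral mu Tdom (fun t => (@complex.Im R) (g t))).

Definition cexpm (j : int) (t : R) : C :=
  Complex (cos (2 * pi * j%:~R * t)) (- sin (2 * pi * j%:~R * t)).

Definition mx_measurable m n (F : R -> 'M[C]_(m, n)) : Prop :=
  forall i j, measurable_fun Tdom (fun t => (@complex.Re R) (F t i j)) /\
              measurable_fun Tdom (fun t => (@complex.Im R) (F t i j)).

Definition vnorm2 n (v : 'cV[C]_n) : R := \sum_i cabs2 (v i 0).

Definition L2 n (f : R -> 'cV[C]_n) : Prop :=
  mx_measurable f /\ mu.-integrable Tdom (fun t => (vnorm2 (f t))%:E).

Definition l2norm n (f : R -> 'cV[C]_n) : R :=
  Num.sqrt (Rintegral mu Tdom (fun t => vnorm2 (f t))).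

Definition Linf m n (F : R -> 'M[C]_(m, n)) : Prop :=
  mx_measurable F /\
  exists M : R, {ae mu, forall t, Tdom t -> forall i j, cabs2 (F t i j) <= M}.

Definition fourier m n (F : R -> 'M[C]_(m, n)) (j : int) : 'M[C]_(m, n) :=
  \matrix_(a, b) cint (fun t => F t a b * cexpm j t).

Definition H2 n (f : R -> 'cV[C]_n) : Prop :=
  L2 f /\ forall j : int, (j < 0)%R -> fourier f j = 0.
Definition H2minus n (f : R -> 'cV[C]_n) : Prop :=
  L2 f /\ forall j : int, (0 <= j)%R -> fourier f j = 0.

(* h = P_- g  (orthogonal projection of L^2 onto H^2_-) *)
Definition Pminus n (g h : R -> 'cV[C]_n) : Prop :=
  H2minus h /\ H2 (fun t => g t - h t).

Definition hankel m n (Phi : R -> 'M[C]_(m, n)) (f : R -> 'cV[C]_n)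
  (h : R -> 'cV[C]_m) : Prop := Pminus (fun t => Phi t *m f t) h.

(* compact operators H^2(C^n) -> H^2_-(C^m): linear maps sending the unit
   ball of H^2(C^n) into a totally bounded subset of H^2_-(C^m) *)
Definition compact_op m n (K : (R -> 'cV[C]_n) -> (R -> 'cV[C]_m)) : Prop :=
  (forall f, H2 f -> H2minus (K f)) /\
  (forall (a : C) f g, H2 f -> H2 g ->
     K (fun t => a *: f t + g t) = (fun t => a *: K f t + K g t)) /\
  (forall e : R, 0 < e -> exists s : seq (R -> 'cV[C]_m),
     (forall g, g \in s -> L2 g) /\
     forall f, H2 f -> l2norm f <= 1 ->
       exists2 g, g \in s & l2norm (fun t => K f t - g t) < e).

Definition hankel_minus_norm m n (Phi : R -> 'M[C]_(m, n))
  (K : (R -> 'cV[C]_n) -> (R -> 'cV[C]_m)) : \bar R :=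
  ereal_sup [set x | exists f h, [/\ H2 f, l2norm f <= 1, hankel Phi f h &
                       x = (l2norm (fun t => h t - K f t))%:E]].

Definition hankel_norm m n (Phi : R -> 'M[C]_(m, n)) : \bar R :=
  hankel_minus_norm Phi (fun _ _ => 0).

Definition hankel_ess_norm m n (Phi : R -> 'M[C]_(m, n)) : \bar R :=
  ereal_inf [set x | exists K, compact_op K /\ x = hankel_minus_norm Phi K].

Definition adjmx m n (A : 'M[C]_(m, n)) : 'M[C]_(n, m) := (map_mx conjc A)^T.

Definition adjfun m n (U : R -> 'M[C]_(m, n)) : R -> 'M[C]_(n, m) :=
  fun t => adjmx (U t).

Definition unitary_interpolant n (Phi U : R -> 'M[C]_n) : Prop :=
  [/\ Linf U,
      {ae mu, forall t, Tdom t -> adjmx (U t) *m U t = 1%:M} &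
      forall j : int, (j < 0)%R -> fourier U j = fourier Phi j].

End Hankel.

(* Main.v *)
(** The Hankel operator [Gamma f = P_- (Phi f)] is a contraction iff the form of
    [1 + Gamma + Gamma^*] on [L^2 = H^2_- + H^2] is positive; call it [a].  Since the
    essential norm of [Gamma] is less than 1, [a] is coercive on a subspace of finite
    codimension, so [a] is complete on closed subspaces although it may degenerate.
    Multiplication by [z], restricted to the functions whose coefficient of index [-1]
    vanishes, is [a]-isometric.  Both its domain and its range have codimension [n], and a
    rank count on the null space of [a] shows that it extends to an [a]-isometric bijection
    [W].  The map [z^m e_i |-> W^(m+1) (z^(-1) e_i)] then identifies [L^2] with the
    completion of [a], fixing [H^2_-] and intertwining [z] with [W].  The preimages [u_i] of
    the constant vectors [e_i] are the columns of the interpolant [U]: on the nonnegative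
    side [a] is the inner product, so the [u_i] are pointwise orthonormal by uniqueness of
    Fourier coefficients, and their negative coefficients are those of [Phi].  Coercivity
    modulo the null space bounds [P_+ (U^* f)] below for [f] in [H^2], whence the
    norm of the Hankel operator of [U^*] is less than 1.

    Conversely, if [Phi - U] is analytic, then [P_- (Phi f) = P_- (U f)] for [f] in [H^2]. *)

Require Import Defs.
From HB Require Import structures.
From mathcomp Require Import all_boot all_order all_fingroup all_algebra.
From mathcomp Require Import all_classical all_reals all_analysis.
From mathcomp Require Import measurable_realfun complex.
From mathcomp Require Import ring lra zify.
Set Implicit Arguments. Unset Strict Implicit. Unset Printing Implicit Defensive.
Import Order.TTheory GRing.Theory Num.Theory.
Import numFieldNormedType.Exports.
Local Open Scope ring_scope.

(** * Semi-inner products and projections *)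

Section Geometric.
Variable R : realType.

(** Almost everywhere equality is never quotiented out and the completion of [a] is never formed.
    Both forms therefore stay semidefinite: identities hold modulo null vectors, completeness is a
    property of a form on a subspace, and the identification of the two spaces is a relation.

    The difficulty is the borderline norm 1, where [a] has null vectors that are not null functions.
    A small essential norm makes them finite-dimensional modulo null functions and lets every vector
    be replaced, up to an [a]-null one, by a representative whose L^2 norm is controlled by [a].
    This keeps [a] complete, and it is also why the translates of H^2_- under [W] span a dense
    subspace. For [W] itself equal codimensions do not suffice: the complements must agree modulo
    null vectors. They do because z matches the null vectors of its domain with those of its range,
    so that the Gram matrices of the two complements have equal rank. *)

Definition quarter (k : nat) : R := 4^-1 ^+ k.

Lemma quarter_gt0 k : 0 < quarter k.
Proof. by rewrite exprn_gt0// invr_gt0. Qed.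

Lemma quarterS k : quarter k.+1 = quarter k / 4.
Proof. by rewrite /quarter exprS mulrC. Qed.

Lemma quarter_small (C e : R) : 0 < e -> exists k, C * quarter k <= e.
Proof.
move=> e0.
(* [k 4^-k <= 1] replaces logarithms: any [k > C / e] will do. *)
have kq (k : nat) : k%:R * quarter k <= 1.
  elim: k => [|k IH]; first by rewrite mul0r.
  rewrite quarterS -natr1; have := quarter_gt0 k.
  have : quarter k <= 1 by rewrite exprn_ile1// ?invr_ge0// invf_le1// ler1n.
  by move: IH; set t := _%:R * _ => IH; rewrite mulrDl mul1r mulrA -/t => ? ?; lra.
have [k Ck] : exists k : nat, C / e < k%:R.
  exists (Num.truncn (`|C / e|)).+1; apply: le_lt_trans (ler_norm _) _.
  by rewrite truncnS_gt.
exists k; have := kq k; rewrite ltr_pdivrMr// in Ck.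
move: Ck; have := quarter_gt0 k; set q := quarter k; set n := k%:R; nra.
Qed.

Lemma quarter_squeeze (C x : R) : (forall k, x <= C * quarter k) -> x <= 0.
Proof.
move=> H; case: (leP x 0) => // x0.
have [k Hk] := @quarter_small C (x / 2) ltac:(lra).
by have := H k; lra.
Qed.

End Geometric.

Section SemiInner.
Variables (R : realType) (V : lmodType R[i]).
Local Notation C := (R[i]).
Local Open Scope complex_scope.

(** Only the real part of a Hermitian form is kept; invariance under ['i] lets [cform] recover the
    rest. Null vectors are allowed. *)
Record semi_inner (b : V -> V -> R) : Prop := SemiInner {
  siDl : forall x y z, b (x + y) z = b x z + b y z;
  siC : forall x y, b x y = b y x;
  siZl : forall (r : R) x y, b (r%:C *: x) y = r * b x y;
  siJ : forall x y, b ('i *: x) ('i *: y) = b x y;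
  si_ge0 : forall x, 0 <= b x x }.

(** For a form linear in its first argument, Im <x, y> = Re <x, i y>. *)
Definition cform (b : V -> V -> R) (x y : V) : C := Complex (b x y) (b x ('i *: y)).

Definition real_subspace (G : V -> Prop) :=
  G 0 /\ forall (r : R) x y, G x -> G y -> G (r%:C *: x + y).

(* Completeness is only tested on sequences with geometrically decaying steps. *)
Definition complete_for (b : V -> V -> R) (G : V -> Prop) :=
  forall (u : nat -> V) (K : R), (forall k, G (u k)) ->
    (forall k, b (u k.+1 - u k) (u k.+1 - u k) <= K * quarter R k) ->
  exists x K', G x /\ forall k, b (x - u k) (x - u k) <= K' * quarter R k.

Section OneForm.
Variable b : V -> V -> R.
Hypothesis bP : semi_inner b.

Lemma siDr x y z : b x (y + z) = b x y + b x z.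
Proof. by rewrite siC// siDl// !(siC bP x). Qed.

Lemma siZr (r : R) x y : b x (r%:C *: y) = r * b x y.
Proof. by rewrite siC// siZl// (siC bP x). Qed.

Lemma si0l x : b 0 x = 0.
Proof. by have := siZl bP 0 0 x; rewrite mul0r scaler0. Qed.

Lemma si0r x : b x 0 = 0. Proof. by rewrite siC// si0l. Qed.

Lemma siNl x y : b (- x) y = - b x y.
Proof. by apply/eqP; rewrite -addr_eq0 -siDl// addNr si0l. Qed.

Lemma siNr x y : b x (- y) = - b x y.
Proof. by rewrite siC// siNl siC. Qed.

Lemma siBl x y z : b (x - y) z = b x z - b y z.
Proof. by rewrite siDl// siNl. Qed.

Lemma siBr x y z : b x (y - z) = b x y - b x z.
Proof. by rewrite siDr siNr. Qed.

Lemma siJr x y : b x ('i *: y) = - b ('i *: x) y.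
Proof.
by rewrite -[in LHS](siJ bP) scalerA -expr2 sqr_i scaleN1r siNr.
Qed.

Lemma cauchy_schwarz x y : b x y ^+ 2 <= b x x * b y y.
Proof.
have y0 := si_ge0 bP y; have x0 := si_ge0 bP x.
have H t : 0 <= b x x + 2 * t * b x y + t ^+ 2 * b y y.
  have := si_ge0 bP (x + t%:C *: y).
  by rewrite !(siDl bP) !siDr !(siZl bP) !siZr (siC bP y x); lra.
have [y1|y1] := eqVneq (b y y) 0.
  rewrite y1 mulr0; have [->|n0] := eqVneq (b x y) 0; first by rewrite expr0n.
  (* The quadratic is affine here, and this [t] gives it the value -1. *)
  have := H (- (b x x + 1) / (2 * b x y)); rewrite y1.
  have -> : 2 * (- (b x x + 1) / (2 * b x y)) * b x y = - (b x x + 1) by field.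
  by lra.
have yp : 0 < b y y by rewrite lt_def y1.
have := H (- b x y / b y y).
have -> : b x x + 2 * (- b x y / b y y) * b x y + (- b x y / b y y) ^+ 2 * b y y
   = (b x x * b y y - b x y ^+ 2) / b y y by field.
by rewrite pmulr_lge0 ?invr_gt0// subr_ge0.
Qed.

Lemma si_sqD x y : b (x + y) (x + y) <= 2 * b x x + 2 * b y y.
Proof.
have := si_ge0 bP (x - y).
by rewrite !(siDl bP) !siDr !siNl !siNr (siC bP y x); lra.
Qed.

Lemma si_sqB x y : b (x - y) (x - y) <= 2 * b x x + 2 * b y y.
Proof. by have := si_sqD x (- y); rewrite siNl siNr opprK. Qed.

Lemma si_sqBC x y : b (x - y) (x - y) = b (y - x) (y - x).
Proof. by rewrite -[x - y]opprB siNl siNr opprK. Qed.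

Lemma si_sq_trans y x z :
  b (x - z) (x - z) <= 2 * b (x - y) (x - y) + 2 * b (y - z) (y - z).
Proof. by have := si_sqD (x - y) (y - z); rewrite addrA subrK. Qed.

Lemma si_null x y : b x x = 0 -> b x y = 0.
Proof.
move=> x0; apply/eqP; rewrite -sqrf_eq0; apply/eqP/le_anti.
by rewrite sqr_ge0 andbT; have := cauchy_schwarz x y; rewrite x0 mul0r.
Qed.

Lemma si_null_congr x x' y : b (x - x') (x - x') = 0 -> b x y = b x' y.
Proof. by move=> h; apply/eqP; rewrite -subr_eq0 -siBl si_null. Qed.

Lemma si_null_congr2 x x' : b (x - x') (x - x') = 0 -> b x x = b x' x'.
Proof.
by move=> h; rewrite (si_null_congr _ h) (siC bP) (si_null_congr _ h).
Qed.

Lemma si_orthD u v u' v' : b v u' = 0 -> b v' u = 0 ->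
  b (u + v) (u' + v') = b u u' + b v v'.
Proof.
by move=> h1 h2; rewrite (siDl bP) !siDr h1 (siC bP u v') h2 addr0 add0r.
Qed.

Lemma cform_eq0 x y : cform b x y = 0 <-> b x y = 0 /\ b x ('i *: y) = 0.
Proof. by rewrite /cform; split=> [[-> ->]|[-> ->]]. Qed.

Lemma cformDl x y z : cform b (x + y) z = cform b x z + cform b y z.
Proof. by rewrite /cform !(siDl bP). Qed.

Lemma cformZl (c : C) x y : cform b (c *: x) y = c * cform b x y.
Proof.
case: c => r s; have E : r +i* s = r%:C + s%:C * 'i by simpc.
have -> : (r +i* s) *: x = r%:C *: x + s%:C *: ('i *: x).
  by rewrite scalerA -scalerDl E.
rewrite /cform !(siDl bP) !(siZl bP) (siJ bP) -[b ('i *: x) y]opprK -siJr.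
by apply/eqP; rewrite eq_complex /=; apply/andP; split; apply/eqP; ring.
Qed.

Lemma cformC x y : cform b y x = (cform b x y)^*.
Proof. rewrite /cform /=; congr Complex; first exact: siC. by rewrite siJr siC. Qed.

Lemma cformDr x y z : cform b x (y + z) = cform b x y + cform b x z.
Proof. by rewrite /cform scalerDr !siDr. Qed.

Lemma cformZr (c : C) x y : cform b x (c *: y) = c^* * cform b x y.
Proof. by rewrite (cformC (c *: y)) cformZl (cformC y) [LHS]rmorphM. Qed.

Lemma cformxx x : cform b x x = (b x x)%:C.
Proof.
have := cformC x x; rewrite /cform => -[]; set t := b x ('i *: x) => h.
by congr Complex; lra.
Qed.

Lemma cform_sumr (I : Type) (r : seq I) (P : pred I) (c : I -> C) (v : I -> V) x :
  cform b x (\sum_(i <- r | P i) c i *: v i)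
  = \sum_(i <- r | P i) (c i)^* * cform b x (v i).
Proof.
elim/big_rec2: _ => [|i y1 y2 _ IH]; first by rewrite /cform scaler0 !si0r.
by rewrite cformDr cformZr IH.
Qed.

Lemma cform_suml (I : Type) (r : seq I) (P : pred I) (c : I -> C) (v : I -> V) x :
  cform b (\sum_(i <- r | P i) c i *: v i) x
  = \sum_(i <- r | P i) c i * cform b (v i) x.
Proof.
elim/big_rec2: _ => [|i y1 y2 _ IH]; first by rewrite /cform !si0l.
by rewrite cformDl cformZl IH.
Qed.

(** Moving [x] by the best multiple of [g], namely [b x g / b g g], gains [b x g ^+ 2 / b g g], and
    at most [e] is left to gain. *)
Lemma almost_minimal_almost_orthogonal x (d e : R) g :
  (forall t : R, d <= b (x - t%:C *: g) (x - t%:C *: g)) ->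
  b x x <= d + e -> b x g ^+ 2 <= e * b g g.
Proof.
move=> H xe; have e0 : 0 <= e.
  by have := H 0; rewrite scale0r subr0; lra.
have g0 := si_ge0 bP g.
have [z|nz] := eqVneq (b g g) 0.
  by rewrite (siC bP) (si_null x z) z mulr0 expr0n.
have gp : 0 < b g g by rewrite lt_def nz.
have := H (b x g / b g g).
rewrite !siBl !siBr !(siZl bP) !siZr (siC bP g x).
have -> : b x x - b x g / b g g * b x g
  - (b x g / b g g * b x g - b x g / b g g * (b x g / b g g * b g g))
  = b x x - b x g ^+ 2 / b g g by field.
move=> h; have : b x g ^+ 2 / b g g <= e by lra.
by rewrite ler_pdivrMr.
Qed.

(** The classical minimizing sequence, run at the geometric rate that [complete_for] tests. The
    result is an existence statement because the projection is unique only up to null vectors. *)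
Theorem projection (G : V -> Prop) x : real_subspace G -> complete_for b G ->
  exists2 g, G g & forall g', G g' -> b (x - g) g' = 0.
Proof.
move=> [G0 GS] Gc.
pose S : set R := [set r | exists2 g, G g & r = b (x - g) (x - g)]%classic.
have hS : has_inf S.
  split; first by exists (b (x - 0) (x - 0)), 0.
  by exists 0 => _ [g _ ->]; exact: si_ge0.
pose d := inf S.
have dle g : G g -> d <= b (x - g) (x - g).
  by move=> Gg; apply: ge_inf; [case: hS | exists g].
have [u uP] : exists u : nat -> V, forall k,
    G (u k) /\ b (x - u k) (x - u k) <= d + quarter R k.
  have H k : exists v, G v /\ b (x - v) (x - v) <= d + quarter R k.
    have [_ [g Gg ->] /ltW] := inf_adherent (quarter_gt0 R k) hS.
    by exists g.
  have [u uP] := choice H; by exists u.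
(* Parallelogram law: the midpoint of two consecutive terms lies in [G], so its squared distance to
   [x] is at least [d]. *)
have stepu k : b (u k.+1 - u k) (u k.+1 - u k) <= 4 * quarter R k.
  have [G1 H1] := uP k; have [G2 H2] := uP k.+1.
  have Gm : G ((2^-1)%:C *: (u k.+1 + u k)).
    rewrite -[_ *: _]addr0; apply: (GS _ _ _ _ G0).
    by have := GS 1 _ _ G2 G1; rewrite scale1r.
  have := dle _ Gm; move: H1 H2; rewrite quarterS.
  rewrite !(siBl, siBr) !(siZl bP, siZr) !(siDl bP, siDr).
  rewrite !(siC bP (u k.+1)) (siC bP (u k) x); have := quarter_gt0 R k.
  by lra.
have [g [K' [Gg gP]]] := Gc u 4 (fun k => (uP k).1) stepu.
exists g => // g' Gg'.
apply/eqP; rewrite -sqrf_eq0; apply/eqP/le_anti; rewrite sqr_ge0 andbT.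
apply: (@quarter_squeeze _ (2 * (1 + K') * b g' g')) => k.
have [Gu Hu] := uP k.
have h1 : b (x - u k) g' ^+ 2 <= quarter R k * b g' g'.
  apply: (@almost_minimal_almost_orthogonal _ d) => // t.
  rewrite -addrA -opprD; apply: dle; rewrite addrC; exact: GS.
have h2 := cauchy_schwarz (g - u k) g'.
have -> : b (x - g) g' = b (x - u k) g' - b (g - u k) g'.
  by rewrite !siBl; ring.
have g0 := si_ge0 bP g'; have := gP k.
move: h1 h2 (quarter_gt0 R k) g0; set p := b (x - u k) g'; set q := b (g - u k) g'.
set t := b (g - u k) _; set r := b g' g'; set z := quarter R k => h1 h2 z0 r0 h3.
have h4 : q ^+ 2 <= K' * z * r by apply: le_trans h2 _; exact: ler_wpM2r.
have := sqr_ge0 (p + q); rewrite !expr2 in h1 h4 *; lra.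
Qed.

(** Projection onto the closure [G] of [S], which is complete because the whole space is: the
    residual is orthogonal to [S], hence null. *)
Lemma dense_of_orthogonal (S : V -> Prop) : real_subspace S ->
  complete_for b (fun _ => True) ->
  (forall x, (forall s, S s -> b x s = 0) -> b x x = 0) ->
  forall x (e : R), 0 < e -> exists2 s, S s & b (x - s) (x - s) < e.
Proof.
move=> [S0 SS] bc H x.
pose G y := forall e : R, 0 < e -> exists2 s, S s & b (y - s) (y - s) < e.
have SG s : S s -> G s by move=> Ss e e0; exists s; rewrite // subrr si0l.
have GG : real_subspace G.
  split=> [|r y z Gy Gz e e0]; first exact: SG.
  have r1 : 0 < r ^+ 2 + 1 by have := sqr_ge0 r; lra.
  have [|s Ss ys] := Gy (e / 4 / (r ^+ 2 + 1)); first by rewrite !divr_gt0.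
  have [|s' Ss' zs] := Gz (e / 4); first by rewrite divr_gt0.
  exists (r%:C *: s + s'); first exact: SS.
  have -> : r%:C *: y + z - (r%:C *: s + s') = r%:C *: (y - s) + (z - s').
    by rewrite scalerBr opprD addrACA.
  apply: le_lt_trans (si_sqD _ _) _; rewrite (siZl bP) siZr.
  have y0 := si_ge0 bP (y - s).
  have h : r ^+ 2 * b (y - s) (y - s) < e / 4.
    move: ys; rewrite ltr_pdivlMr//; nra.
  by move: h; rewrite expr2 -mulrA; lra.
have Gc : complete_for b G.
  move=> u K Gu uK; have [y [K' [_ yP]]] := bc u K (fun _ => I) uK.
  exists y, K'; split=> // e e0.
  have [k Hk] := @quarter_small R K' (e / 8) ltac:(lra).
  have [|s Ss us] := Gu k (e / 8); first by lra.
  exists s => //; apply: le_lt_trans (si_sq_trans (u k) _ _) _.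
  by have := yP k; lra.
have [g Gg gP] := projection x GG Gc.
have xg0 : b (x - g) (x - g) = 0 by apply: H => s Ss; apply: gP; exact: SG.
move=> e e0; have [|s Ss gs] := Gg (e / 2); first by lra.
exists s => //; have := si_sq_trans g x s; rewrite xg0; lra.
Qed.

End OneForm.
End SemiInner.

(** * Pairs of forms, finite codimension *)

Section TwoForms.
Variables (R : realType) (V : lmodType R[i]).
Local Notation C := (R[i]).
Local Open Scope complex_scope.

Section Tame.
Variables (b a : V -> V -> R) (M : R).
Hypotheses (bP : semi_inner b) (aP : semi_inner a).
Hypothesis ab : forall x, a x x <= M * b x x.

(* Modulo null vectors of [a], the form [b] is controlled by [a] on [H]. *)
Definition tame (H : V -> Prop) := exists K : R, 0 <= K /\
  forall x, H x -> exists x', [/\ H x', a (x - x') (x - x') = 0 & b x' x' <= K * a x x].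

Lemma si_null_add x y : a x x = 0 -> a y y = 0 -> a (x + y) (x + y) = 0.
Proof.
move=> x0 y0; apply/le_anti; rewrite (si_ge0 aP) andbT.
by apply: le_trans (si_sqD aP _ _) _; rewrite x0 y0; lra.
Qed.

(** Each [a]-small step is replaced by a [b]-small vector that differs from it by an [a]-null one.
    The partial sums of these converge for [b], hence for [a], and stay at [a]-distance 0 from the
    given sequence. *)
Lemma tame_complete H : real_subspace H -> complete_for b H -> tame H ->
  complete_for a H.
Proof.
move=> [H0 HS] Hc [K [K0 KP]] u L Hu uL.
have HD x y : H x -> H y -> H (x + y).
  by move=> Hx Hy; have := HS 1 x y Hx Hy; rewrite scale1r.
have HB x y : H x -> H y -> H (x - y).
  by move=> Hx Hy; have := HS (-1) y x Hy Hx; rewrite rmorphN1 scaleN1r addrC.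
have [y yP] := choice (fun k => KP _ (HB _ _ (Hu k.+1) (Hu k))).
pose v k := u 0%N + \sum_(i < k) y i.
have vS k : v k.+1 = v k + y k by rewrite /v big_ord_recr /= addrA.
have Hv k : H (v k).
  elim: k => [|k IH]; first by rewrite /v big_ord0 addr0.
  by rewrite vS; apply: HD => //; case: (yP k).
have vb k : b (v k.+1 - v k) (v k.+1 - v k) <= (K * L) * quarter R k.
  rewrite vS addrC addKr; case: (yP k) => _ _ h; apply: le_trans h _.
  by rewrite -mulrA; exact: ler_wpM2l.
have [x [K' [Hx xP]]] := Hc v _ Hv vb.
have vu k : a (v k - u k) (v k - u k) = 0.
  elim: k => [|k IH]; first by rewrite /v big_ord0 addr0 subrr (si0l aP).
  have -> : v k.+1 - u k.+1 = (v k - u k) + (y k - (u k.+1 - u k)).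
    by rewrite vS [RHS]addrACA -opprD [u k + _]addrC subrK.
  by apply: si_null_add => //; rewrite (si_sqBC aP); case: (yP k).
exists x, (Num.max M 0 * K'); split=> // k.
have -> : a (x - u k) (x - u k) = a (x - v k) (x - v k).
  apply: (si_null_congr2 aP).
  have -> : x - u k - (x - v k) = v k - u k by rewrite opprB addrC addrA subrK.
  exact: vu.
apply: le_trans (ab _) _; rewrite -mulrA.
have h1 := si_ge0 bP (x - v k); have h2 := xP k.
apply: (@le_trans _ _ (Num.max M 0 * b (x - v k) (x - v k))).
  by apply: ler_wpM2r => //; rewrite le_max lexx.
by apply: ler_wpM2l => //; rewrite le_max lexx orbT.
Qed.

Definition bounded_functional (phi : V -> R) :=
  (forall (r : R) x y, phi (r%:C *: x + y) = r * phi x + phi y) /\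
  exists L, forall x, phi x ^+ 2 <= L * b x x.

Lemma complete_kernel H phi : complete_for b H -> bounded_functional phi ->
  complete_for b (fun x => H x /\ phi x = 0).
Proof.
move=> Hc [phiL [L phiB]] u K Hu uK.
have [x [K' [Hx xP]]] := Hc u K (fun k => (Hu k).1) uK.
exists x, K'; split=> //; split=> //.
have phB y z : phi (y - z) = phi y - phi z.
  by have := phiL (-1) z y; rewrite rmorphN1 scaleN1r addrC => ->; ring.
apply/eqP; rewrite -sqrf_eq0; apply/eqP/le_anti; rewrite sqr_ge0 andbT.
apply: (@quarter_squeeze _ (Num.max L 0 * K')) => k.
have -> : phi x = phi (x - u k) by rewrite phB (Hu k).2 subr0.
apply: le_trans (phiB _) _; rewrite -mulrA.
have h1 := si_ge0 bP (x - u k); have h2 := xP k.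
apply: (@le_trans _ _ (Num.max L 0 * b (x - u k) (x - u k))).
  by apply: ler_wpM2r => //; rewrite le_max lexx.
by apply: ler_wpM2l => //; rewrite le_max lexx orbT.
Qed.

Lemma subspace_kernel H phi : real_subspace H -> bounded_functional phi ->
  real_subspace (fun x => H x /\ phi x = 0).
Proof.
move=> [H0 HS] [phiL _]; split=> [|r x y [Hx px] [Hy py]]; split=> //.
- by have := phiL 0 0 0; rewrite scaler0 addr0 mul0r add0r => h; have := phiL 1 0 0; rewrite scaler0 addr0; lra.
- exact: HS.
- by rewrite phiL px py mulr0 addr0.
Qed.

(** The kernel is already [a]-complete, so a vector [w] outside it can be taken [a]-orthogonal to
    it. If [w] is [a]-null it is simply discarded; otherwise [a] splits along [w], and [b w w] is a
    finite multiple of [a w w]. *)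
Lemma tame_step H phi : real_subspace H -> complete_for b H ->
  bounded_functional phi -> tame (fun x => H x /\ phi x = 0) -> tame H.
Proof.
move=> Hs Hc phiP Kt.
have Ks := subspace_kernel Hs phiP; have Kc := complete_kernel Hc phiP.
have Kca := tame_complete Ks Kc Kt.
have [phiL _] := phiP; have [K [K0 KP]] := Kt; have [H0 HS] := Hs.
have phB y z : phi (y - z) = phi y - phi z.
  by have := phiL (-1) z y; rewrite rmorphN1 scaleN1r addrC => ->; ring.
case: (pselect (exists2 v, H v & phi v != 0)) => [[v Hv phv]|nv]; last first.
  exists K; split=> // x Hx.
  have [|x' [[Hx' _] ? ?]] := KP x; last by exists x'.
  by split=> //; apply/eqP/negPn/negP => h; apply: nv; exists x.
have [w [Hw phw wP]] : exists w, [/\ H w, phi w != 0 &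
    forall y, H y /\ phi y = 0 -> a w y = 0].
  have [g [Hg phg] gP] := projection aP v Ks Kca.
  exists (v - g); split=> //; last by rewrite phB phg subr0.
  by have := HS (-1) g v Hg Hv; rewrite rmorphN1 scaleN1r addrC.
(* Division by 0 makes [B] vanish when [w] is null; there only [0 <= B] is used. *)
pose B := b w w / a w w; have B0 : 0 <= B.
  by rewrite divr_ge0 // ?(si_ge0 bP) ?(si_ge0 aP).
exists (2 * K + 2 * B); split; first by lra.
move=> x Hx; pose c := phi x / phi w.
have [y [Hy py xE]] : exists y, [/\ H y, phi y = 0 & x = y + c%:C *: w].
  exists (x - c%:C *: w); rewrite subrK; split=> //; rewrite addrC -scaleNr -rmorphN.
    exact: HS.
  by rewrite phiL /c; field; exact: phw.
have [y' [[Hy' py'] yy' by']] := KP y (conj Hy py).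
have x0 := si_ge0 aP x.
have [w0|w0] := eqVneq (a w w) 0.
  have xy : a (x - y) (x - y) = 0.
    by rewrite xE addrAC subrr add0r (siZl aP) (siZr aP) w0 !mulr0.
  exists y'; split=> //.
    have -> : x - y' = (x - y) + (y - y') by rewrite addrA subrK.
    exact: si_null_add.
  rewrite (si_null_congr2 aP xy); apply: le_trans by' _.
  by apply: ler_wpM2r; rewrite ?(si_ge0 aP)//; lra.
exists (y' + c%:C *: w); split.
- by rewrite addrC; exact: HS.
- by rewrite xE opprD addrACA subrr addr0.
have wp : 0 < a w w by rewrite lt_def w0 (si_ge0 aP).
have yw : a w y = 0 by exact: wP.
have -> : a x x = a y y + c ^+ 2 * a w w.
  rewrite xE !(siDl aP) !(siDr aP) !(siZl aP) !(siZr aP).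
  by rewrite (siC aP y w) yw; ring.
apply: le_trans (si_sqD bP _ _) _; rewrite (siZl bP) (siZr bP).
have -> : b w w = B * a w w by rewrite /B divfK.
have h1 : 0 <= B * a y y by rewrite mulr_ge0// (si_ge0 aP).
have h2 : 0 <= K * (c ^+ 2 * a w w) 
  by apply: mulr_ge0 => //; apply: mulr_ge0; [exact: sqr_ge0 | exact: ltW].
rewrite expr2 in h2 *; lra.
Qed.

(** Induction on [N] for all [H] at once, since each step passes to the kernel of the last
    functional. *)
Lemma tame_finite_codim N (phi : nat -> V -> R) H :
  (forall i, (i < N)%N -> bounded_functional (phi i)) ->
  real_subspace H -> complete_for b H ->
  tame (fun x => H x /\ forall i, (i < N)%N -> phi i x = 0) -> tame H.
Proof.
elim: N H => [|N IH] H phiP Hs Hc Ht.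
  case: Ht => K [K0 KP]; exists K; split=> // x Hx.
  by have [|x' [[? _] ? ?]] := KP x; [|exists x'].
have pN := phiP N (ltnSn N).
apply: (tame_step Hs Hc pN); apply: IH.
- by move=> i iN; apply: phiP; exact: leqW.
- exact: subspace_kernel.
- exact: complete_kernel.
case: Ht => K [K0 KP]; exists K; split=> // x [[Hx px] pix].
have [|x' [[Hx' px'] ? ?]] := KP x.
  split=> // i; rewrite ltnS leq_eqVlt => /orP[/eqP->//|]; exact: pix.
exists x'; split=> //; split=> [|i iN]; last by apply: px'; exact: leqW.
by split=> //; exact: px'.
Qed.

End Tame.

(** Positivity of the form at x + e y and at x - e y: the arithmetic-geometric inequality without
    square roots. *)
Lemma si_amgm (b : V -> V -> R) x y (e : R) : semi_inner b -> 0 < e ->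
  b x x <= e ^+ 2 -> 2 * `|b x y| <= e * (1 + b y y).
Proof.
move=> bP e0 xe.
have h1 := si_ge0 bP (x + e%:C *: y); have h2 := si_ge0 bP (x - e%:C *: y).
move: h1 h2; rewrite !(siDl bP, siDr bP, siNl bP, siNr bP, siZl bP, siZr bP) (siC bP y x).
move=> h1 h2.
suff: e * (2 * `|b x y|) <= e * (e * (1 + b y y)) by rewrite ler_pM2l.
by rewrite expr2 in xe; case: (ger0P (b x y)) => _; lra.
Qed.

(** * Extending an isometric relation to closures *)

Section Transfer.
Variables (b1 b2 : V -> V -> R) (T : V -> V -> Prop).
Hypotheses (b1P : semi_inner b1) (b2P : semi_inner b2).
Hypothesis TS : forall (r : R) x y x' y', T x y -> T x' y' ->
  T (r%:C *: x + x') (r%:C *: y + y').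
Hypothesis Tiso : forall x y x' y', T x y -> T x' y' -> b1 x x' = b2 y y'.

(** A relation, since partners are determined only up to null vectors on either side. *)
Definition closure_rel x y := forall e : R, 0 < e ->
  exists s t, [/\ T s t, b1 (x - s) (x - s) < e & b2 (y - t) (y - t) < e].

Lemma closure_rel_incl x y : T x y -> closure_rel x y.
Proof. by move=> Txy e e0; exists x, y; rewrite !subrr (si0l b1P) (si0l b2P). Qed.

(** Approximants of [x] at rate [4^-k] have partners whose steps are equally small, by isometry, so
    completeness gives the partner of [x]. *)
Lemma closure_rel_total : complete_for b2 (fun _ => True) ->
  (forall x (e : R), 0 < e -> exists s t, T s t /\ b1 (x - s) (x - s) < e) ->
  forall x, exists y, closure_rel x y.
Proof.
move=> c2 D x.
have H k : exists p : V * V, T p.1 p.2 /\ b1 (x - p.1) (x - p.1) < quarter R k.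
  by have [s [t ?]] := D x _ (quarter_gt0 R k); exists (s, t).
have [st stP] := choice H.
have step k : b2 ((st k.+1).2 - (st k).2) ((st k.+1).2 - (st k).2) <= 4 * quarter R k.
  have [Tk bk] := stP k; have [Tk1 bk1] := stP k.+1.
  have Td : T ((st k.+1).1 - (st k).1) ((st k.+1).2 - (st k).2).
    by have := TS (-1) Tk Tk1; rewrite rmorphN1 !scaleN1r ![- _ + _]addrC.
  rewrite -(Tiso Td Td); apply: le_trans (si_sq_trans b1P x _ _) _.
  rewrite (si_sqBC b1P _ x); move: bk bk1; rewrite quarterS.
  by have := quarter_gt0 R k; lra.
have [y [K [_ yP]]] := c2 (fun k => (st k).2) 4 (fun _ => I) step.
exists y => e e0; have [k Hk] := @quarter_small R (Num.max 1 K) (e / 2) ltac:(lra).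
have q0 := quarter_gt0 R k.
exists (st k).1, (st k).2; split; first by case: (stP k).
  have [_ /lt_le_trans] := stP k; apply; apply: le_trans (le_trans Hk _); last by lra.
  by apply: ler_peMl; [exact: ltW | rewrite le_max lexx].
apply: (le_lt_trans (yP k)); apply: (@le_lt_trans _ _ (e / 2)); last by lra.
apply: le_trans Hk; apply: ler_wpM2r; [exact: ltW | by rewrite le_max lexx orbT].
Qed.

Lemma closure_rel_iso x y x' y' :
  closure_rel x y -> closure_rel x' y' -> b1 x x' = b2 y y'.
Proof.
move=> xy x'y'.
(* The sum of the two constants that [appr] produces, one for each form. *)
pose K := b1 x x + b1 x' x' + b2 y y + b2 y' y' + 8.
have K0 : 0 < K.
  by rewrite /K; have := si_ge0 b1P x; have := si_ge0 b1P x'; have := si_ge0 b2P y;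
     have := si_ge0 b2P y'; lra.
(* Perturbing both arguments by [e] changes the value of the form by a multiple of [e]. *)
have appr (b : V -> V -> R) (e : R) u s u' s' : semi_inner b -> 0 < e -> e <= 1 ->
    b (u - s) (u - s) <= e ^+ 2 -> b (u' - s') (u' - s') <= e ^+ 2 ->
    2 * `|b u u' - b s s'| <= e * (b u u + b u' u' + 4).
  move=> bP e0 e1 us us'.
  have h1 := si_amgm u' bP e0 us; have h2 := si_amgm u bP e0 us'.
  have h3 := si_amgm (u' - s') bP e0 us.
  have -> : b u u' - b s s'
      = b (u - s) u' + b (u' - s') u - b (u - s) (u' - s').
    by rewrite !(siBl bP, siBr bP) (siC bP u' u) (siC bP s' u) ; ring.
  have h4 : e * b (u' - s') (u' - s') <= e by rewrite ger_pMr// (le_trans us')// exprn_ile1// ltW.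
  have := ler_normB (b (u - s) u' + b (u' - s') u) (b (u - s) (u' - s')).
  have := ler_normD (b (u - s) u') (b (u' - s') u).
  by lra.
apply/eqP; rewrite -subr_eq0 -normr_eq0; apply/eqP/le_anti; rewrite normr_ge0 andbT.
apply/ler_addgt0Pl => e e0; rewrite addr0.
pose d := Num.min 1 (e / K).
have d0 : 0 < d by rewrite lt_min ltr01 divr_gt0.
have d1 : d <= 1 by rewrite ge_min lexx.
have dK : d * K <= e by rewrite -ler_pdivlMr// ge_min lexx orbT.
have dd : 0 < d ^+ 2 by rewrite exprn_gt0.
have [s [t [Tst /ltW xs /ltW yt]]] := xy _ dd.
have [s' [t' [Tst' /ltW xs' /ltW yt']]] := x'y' _ dd.
have h1 := appr _ _ _ _ _ _ b1P d0 d1 xs xs'.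
have h2 := appr _ _ _ _ _ _ b2P d0 d1 yt yt'.
have -> : b1 x x' - b2 y y' = (b1 x x' - b1 s s') - (b2 y y' - b2 t t').
  by rewrite (Tiso Tst Tst'); ring.
apply: le_trans (ler_normB _ _) _; move: dK; rewrite /K; nra.
Qed.

End Transfer.
End TwoForms.

(** * Congruence of positive semidefinite matrices *)

Section PsdCongruence.
Local Open Scope sesquilinear_scope.
Variable C : numClosedFieldType.

(** [E] selects the nonzero diagonal entries: [diag_mx d] factors through it, and [F] inverts what
    it selects. *)
Lemma mxrank_diag n (d : 'rV[C]_n) :
  \rank (diag_mx d) = #|[pred i | d 0 i != 0]|.
Proof.
set S := [pred i | d 0 i != 0]; pose ev : 'I_#|S| -> 'I_n := enum_val.
pose E : 'M[C]_(#|S|, n) := \matrix_(k, i) (i == ev k)%:R.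
pose F : 'M[C]_(n, #|S|) := \matrix_(i, k) ((i == ev k)%:R / d 0 i).
apply/eqP; rewrite eqn_leq; apply/andP; split.
  have -> : diag_mx d = E^T *m (E *m diag_mx d).
    rewrite mulmxA; apply/matrixP => i j; rewrite mul_mx_diag !mxE.
    have [dj|dj] := eqVneq (d 0 j) 0.
      by have [->|_] := eqVneq i j; rewrite ?dj ?mulr0.
    have Sj : j \in S by [].
    rewrite (bigD1 (enum_rank_in Sj j)) //= big1 ?addr0 => [|k nk].
      rewrite !mxE /ev enum_rankK_in// eqxx mulr1.
      by have [->|_] := eqVneq i j; rewrite ?mul1r ?mul0r.
    rewrite !mxE [j == _]negbTE ?mulr0//; apply: contra nk => /eqP jk.
    by rewrite [X in enum_rank_in Sj X]jk /ev enum_valK_in.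
  apply: leq_trans (mxrankM_maxl _ _) _; exact: rank_leq_col.
have EdF : E *m diag_mx d *m F = 1%:M.
  apply/matrixP => k l; rewrite mul_mx_diag !mxE (bigD1 (ev k)) //= big1 ?addr0.
    rewrite !mxE eqxx mul1r (inj_eq enum_val_inj).
    have dk : d 0 (ev k) != 0 by have := enum_valP k; rewrite inE.
    by rewrite mulrCA divff// mulr1.
  by move=> i ik; rewrite !mxE (negbTE ik) !mul0r.
rewrite -[X in (X <= _)%N](mxrank1 C) -EdF.
by apply: leq_trans (mxrankM_maxl _ _) _; exact: mxrankM_maxr.
Qed.

Definition psdmx n (G : 'M[C]_n) :=
  G \is hermsymmx /\ forall c : 'rV[C]_n, 0 <= (c *m G *m c^t*) 0 0.

Lemma psd_diagonal n (G : 'M[C]_n) : psdmx G ->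
  exists A d, [/\ A \in unitmx, A *m G *m A^t* = diag_mx d &
    forall i, 0 <= d 0 i].
Proof.
move=> [Gh Gp]; exists (spectralmx G), (spectral_diag G).
set A := spectralmx G; set d := spectral_diag G.
have Au : A \is unitarymx := spectral_unitarymx G.
have E : A *m G *m A^t* = diag_mx d.
  have /orthomx_spectralP -> := hermitian_normalmx Gh.
  rewrite -/A -/d invmx_unitary// !mulmxA.
  by rewrite (unitarymxP Au) mul1mx -mulmxA (unitarymxP Au) mulmx1.
split=> //; first exact: spectral_unit.
move=> i; have := Gp (row i A).
have -> : row i A *m G *m (row i A)^t* = \matrix_(_, _) d 0 i.
  rewrite -row_mul; apply/matrixP => k l.
  have := congr1 (fun M : 'M[_]_n => M i i) E; rewrite /diag_mx !mxE eqxx mulr1n => <-.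
  by apply: eq_bigr => j _; rewrite !mxE.
by rewrite mxE.
Qed.

(** Both matrices are congruent to nonnegative diagonal ones with equally many nonzero entries; a
    permutation and a rescaling carry one to the other. *)
Lemma psd_congruent n (G G' : 'M[C]_n) : psdmx G -> psdmx G' ->
  \rank G = \rank G' -> exists2 X, X \in unitmx & X *m G' *m X^t* = G.
Proof.
move=> /psd_diagonal[A [d [Au AG d0]]] /psd_diagonal[A' [d' [Au' AG' d0']]] rk.
have tu (B : 'M[C]_n) : B \in unitmx -> B^t* \in unitmx.
  by move=> Bu; rewrite map_unitmx unitmx_tr.
have rkd (B H : 'M[C]_n) e : B \in unitmx -> B *m H *m B^t* = diag_mx e ->
    \rank H = #|[pred i | e 0 i != 0]|.
  move=> Bu BH; rewrite -mxrank_diag -BH mxrankMfree ?row_free_unit ?tu//.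
  by rewrite eqmxMfull// row_full_unit.
rewrite (rkd _ _ _ Au AG) (rkd _ _ _ Au' AG') in rk.
(* Boolean tuples with equal counts are permutations of each other. *)
have [s sP] : exists s : {perm 'I_n}, forall i, (d 0 i != 0) = (d' 0 (s i) != 0).
  pose t := [tuple d 0 i != 0 | i < n]; pose t' := [tuple d' 0 i != 0 | i < n].
  have cnt (e : 'rV[C]_n) x : count_mem x [tuple e 0 i != 0 | i < n] =
     if x then #|[pred i | e 0 i != 0]| else (n - #|[pred i | (e 0 i != 0)%R]|)%N.
    rewrite /= count_map; case: x.
      by rewrite cardE size_filter enumT; apply: eq_count => i /=; rewrite inE eqb_id.
    rewrite -[X in (X - _)%N]card_ord -(cardC [pred i | e 0 i != 0]) addKn.
    rewrite cardE size_filter enumT; apply: eq_count => i /=.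
    by rewrite !inE /=; case: (e 0 i == 0).
  have : perm_eq t t'.
    by apply/allP => x _ /=; rewrite (cnt d) (cnt d') rk.
  move=> /tuple_permP[s ts]; exists s => i.
  have := congr1 (fun q => nth false q i) ts.
  rewrite -!(tnth_nth false) !tnth_mktuple.
  by [].
(* The entry 1 at the zeros of [d] keeps the scaling invertible. *)
pose x := \row_i (if d 0 i == 0 then 1 else sqrtC (d 0 i / d' 0 (s i))).
have xu i : x 0 i != 0.
  rewrite mxE; case: ifP => [_|/negbT di]; first exact: oner_neq0.
  by rewrite sqrtC_eq0 mulf_neq0 ?invr_neq0 -?sP.
exists (invmx A *m (diag_mx x *m perm_mx s *m A')).
  rewrite !unitmx_mul unitmx_inv Au unitmx_perm Au' !andbT /=.
  by rewrite unitmxE det_diag unitfE prodf_seq_neq0; apply/allP => i _; rewrite xu.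
have At : A^t* \in unitmx by exact: tu.
have -> : G = invmx A *m diag_mx d *m invmx (A^t*).
  by rewrite -AG -!mulmxA mulKmx// mulmxV// mulmx1.
set Y := diag_mx x *m perm_mx s *m A'.
have Yd : Y *m G' *m Y^t* = diag_mx d.
  rewrite /Y !trmx_mul !map_mxM !mulmxA.
  have -> : diag_mx x *m perm_mx s *m A' *m G' *m A'^t* =
     diag_mx x *m (perm_mx s *m diag_mx d') by rewrite -AG' !mulmxA.
  rewrite -row_permE tr_perm_mx map_perm_mx -(mulmxA (diag_mx x)) -col_permE.
  apply/matrixP => i j.
  rewrite tr_diag_mx map_diag_mx mul_mx_diag mul_diag_mx !mxE (inj_eq perm_inj).
  have [<-|_] := eqVneq i j; last by rewrite !mulr0n mulr0 mul0r.
  rewrite !mulr1n; case: (eqVneq (d 0 i) 0) => [di|di].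
    have := sP i; rewrite di eqxx /= => /esym/negbFE/eqP ->.
    by rewrite mulr0 mul0r.
  have dsi : d' 0 (s i) != 0 by rewrite -sP.
  set q := sqrtC _; have q0 : 0 <= q by rewrite sqrtC_ge0 divr_ge0.
  transitivity (q * d' 0 (s i) * q).
    by congr (_ * _); exact: (geC0_conj q0).
  by rewrite mulrAC -expr2 sqrtCK divfK.
rewrite trmx_mul map_mxM !mulmxA -!(mulmxA (invmx A)) -[_ *m G' *m _]mulmxA.
rewrite -!mulmxA -/Y; congr (_ *m _).
rewrite !mulmxA Yd; congr (_ *m _).
by rewrite trmx_inv map_invmx.
Qed.
End PsdCongruence.

(** * Isometric extension *)

Section LinComb.
Variables (R : realType) (V : lmodType R[i]).
Local Notation C := (R[i]).

Definition lincomb n (v : 'I_n -> V) (c : 'rV[C]_n) : V := \sum_i c 0 i *: v i.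

Lemma lincomb_is_linear n (v : 'I_n -> V) : linear (lincomb v).
Proof.
move=> k c c'; rewrite /lincomb scaler_sumr -big_split /=; apply: eq_bigr => i _.
by rewrite !mxE scalerDl scalerA.
Qed.

HB.instance Definition _ n (v : 'I_n -> V) :=
  GRing.isLinear.Build C 'rV[C]_n V *:%R (lincomb v) (lincomb_is_linear v).

Lemma linear_lincomb (W : lmodType C) (f : {linear V -> W}) n (v : 'I_n -> V) c :
  f (lincomb v c) = \sum_i c 0 i *: f (v i).
Proof. by rewrite linear_sum; apply: eq_bigr => i _; rewrite linearZ. Qed.

Lemma linear_lincomb_mx m (f : {linear V -> 'rV[C]_m}) n (v : 'I_n -> V) c :
  f (lincomb v c) = c *m \matrix_i f (v i).
Proof.
rewrite linear_lincomb mulmx_sum_row; apply: eq_bigr => i _.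
by rewrite rowK.
Qed.

Section Gram.
Variable a : V -> V -> R.
Hypothesis aP : semi_inner a.
Local Open Scope sesquilinear_scope.

Definition gram n (v : 'I_n -> V) : 'M[C]_n := \matrix_(i, j) cform a (v i) (v j).

Lemma cform_null x y : a x x = 0 -> cform a x y = 0.
Proof. by move=> x0; rewrite /cform !(si_null aP _ x0). Qed.

Lemma cform_lincomb n (v : 'I_n -> V) c c' :
  cform a (lincomb v c) (lincomb v c') = (c *m gram v *m c'^t*) 0 0.
Proof.
rewrite (cform_suml aP) -mulmxA mxE; apply: eq_bigr => i _; congr (_ * _).
rewrite (cform_sumr aP) mxE; apply: eq_bigr => j _.
by rewrite !mxE mulrC.
Qed.

Lemma gram_psd n (v : 'I_n -> V) : psdmx (gram v).
Proof.
split=> [|c].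
  apply/is_hermitianmxP; rewrite expr0 scale1r; apply/matrixP => i j.
  by rewrite !mxE; exact: cformC.
by rewrite -cform_lincomb cformxx// ler0c si_ge0.
Qed.

Lemma gram_null n (v : 'I_n -> V) c :
  (c *m gram v == 0) = (a (lincomb v c) (lincomb v c) == 0).
Proof.
apply/eqP/eqP => [c0|c0].
  have := cform_lincomb v c c; rewrite c0 mul0mx mxE cformxx//.
  by move/(congr1 (@complex.Re R)).
apply/rowP => j; have := cform_lincomb v c (delta_mx 0 j).
by rewrite cform_null// trmx_delta map_delta_mx -colE !mxE => <-.
Qed.

(** Removing from [e i] its [a]-projection on the kernel of [L] makes it orthogonal to that kernel
    without changing its image under [L]. *)
Lemma orthogonal_section n (L : {linear V -> 'rV[C]_n}) (e : 'I_n -> V) :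
  complete_for a (fun x => L x = 0) -> (forall i, L (e i) = delta_mx 0 i) ->
  exists m : 'I_n -> V, (forall i, L (m i) = delta_mx 0 i) /\
    forall i y, L y = 0 -> a (m i) y = 0.
Proof.
move=> Lc eP.
have Ls : real_subspace (fun x => L x = 0).
  split=> [|r x y Lx Ly]; first exact: linear0.
  by rewrite linearP Lx Ly scaler0 addr0.
have H i : exists m, L m = delta_mx 0 i /\ forall y, L y = 0 -> a m y = 0.
  have [g Lg gP] := projection aP (e i) Ls Lc.
  by exists (e i - g); rewrite linearB Lg subr0.
have [m mP] := choice H; exists m; split=> i; first by case: (mP i).
by case: (mP i).
Qed.

Lemma lincomb_section n (L : {linear V -> 'rV[C]_n}) (m : 'I_n -> V) c :
  (forall i, L (m i) = delta_mx 0 i) -> L (lincomb m c) = c.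
Proof.
move=> mP; rewrite linear_lincomb_mx [X in c *m X](_ : _ = 1%:M) ?mulmx1//.
by apply/row_matrixP => i; rewrite rowK mP row1.
Qed.

Lemma lincomb_orth n (m : 'I_n -> V) c y :
  (forall i, cform a (m i) y = 0) -> a (lincomb m c) y = 0.
Proof.
move=> H; suff: cform a (lincomb m c) y = 0 by case.
by rewrite (cform_suml aP) big1 // => i _; rewrite H mulr0.
Qed.

Lemma section_orth n (L : {linear V -> 'rV[C]_n}) (m : 'I_n -> V) c y :
  (forall i y, L y = 0 -> a (m i) y = 0) -> L y = 0 -> a (lincomb m c) y = 0.
Proof.
move=> mP Ly; apply: lincomb_orth => i; rewrite /cform mP// mP//.
by rewrite linearZ /= Ly scaler0.
Qed.

(** An [a]-null [k] splits orthogonally into a kernel part and a combination of the [m i], both then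
    null. So the radical of the Gram matrix is the image under [L] of the null vectors. *)
Lemma section_null n (L : {linear V -> 'rV[C]_n}) (m : 'I_n -> V) c :
  (forall i, L (m i) = delta_mx 0 i) ->
  (forall i y, L y = 0 -> a (m i) y = 0) ->
  reflect (exists2 k, a k k = 0 & L k = c) (c *m gram m == 0).
Proof.
move=> mL mP; rewrite gram_null; apply: (iffP eqP) => [c0|[k k0 <-]].
  by exists (lincomb m c) => //; exact: lincomb_section.
have d0 : L (k - lincomb m (L k)) = 0 by rewrite linearB lincomb_section// subrr.
have o := section_orth (L k) mP d0.
have : a k k = a (k - lincomb m (L k)) (k - lincomb m (L k))
   + a (lincomb m (L k)) (lincomb m (L k)).
  by rewrite -[in LHS](subrK (lincomb m (L k)) k) [LHS](si_orthD aP).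
rewrite k0; have := si_ge0 aP (k - lincomb m (L k)).
have := si_ge0 aP (lincomb m (L k)); lra.
Qed.

End Gram.

(** Provides a basis for the span of [psi] over a mere predicate, as needed for the null vectors: a
    finite family of maximal rank. *)
Lemma linear_span_basis N (P : V -> Prop) (psi : {linear V -> 'rV[C]_N}) :
  exists r (k : 'I_r -> V), [/\ forall i, P (k i),
    row_free (\matrix_i psi (k i)) &
    forall x, P x -> (psi x <= \matrix_i psi (k i))%MS].
Proof.
pose Q j := `[< exists m (k : 'I_m -> V),
   (forall i, P (k i)) /\ \rank (\matrix_i psi (k i)) = j >].
have Q0 : exists j, Q j.
  exists 0%N; apply/asboolP; exists 0%N, (fun=> 0); split; first by case.
  by apply/eqP; rewrite -leqn0 rank_leq_row.
have Qb j : Q j -> (j <= N)%N by move=> /asboolP[m [k [_ <-]]]; exact: rank_leq_col.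
case: (ex_maxnP Q0 Qb) => j /asboolP[m [k [Pk rk]]] jmax.
pose A := \matrix_i psi (k i).
have span x : P x -> (psi x <= A)%MS.
  move=> Px; apply/negPn/negP => nx.
  pose k' (i : 'I_(m + 1)) := match fintype.split i with inl l => k l | inr _ => x end.
  have kA : \matrix_i psi (k' i) = col_mx A (psi x).
    apply/row_matrixP => i; rewrite rowK /k' -[in RHS](splitK i).
    by case: (fintype.split i) => l /=; rewrite ?col_mxEu ?rowKu ?rowKd ?rowK// row_id.
  have : Q (\rank (\matrix_i psi (k' i))).
    apply/asboolP; exists (m + 1)%N, k'; split=> // i.
    by rewrite /k'; case: (fintype.split i).
  move/jmax; rewrite -rk leqNgt => /negP; apply.
  rewrite kA -addsmxE; apply: rank_ltmx; rewrite /ltmx addsmxSl /=.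
  by apply: contra nx; rewrite addsmx_sub => /andP[].
have E : \matrix_i psi (k (maxrankfun A i)) = rowsub (maxrankfun A) A.
  by apply/row_matrixP => i; rewrite row_rowsub !rowK.
exists (\rank A), (k \o maxrankfun A); split=> [i||x Px]; first exact: Pk.
  by rewrite E maxrowsub_free.
by rewrite E eq_maxrowsub; exact: span.
Qed.

Section Extension.
Variables (n N : nat) (a b : V -> V -> R) (z zi : {linear V -> V}).
Variables (ct : {linear V -> 'rV[C]_n}) (psi : {linear V -> 'rV[C]_N}).
Variable (e : 'I_n -> V).
Hypothesis aP : semi_inner a.
Hypotheses (zK : cancel z zi) (ziK : cancel zi z).
Hypothesis bz : forall x, b (z x) (z x) = b x x.
Hypothesis ct_null : forall x, b x x = 0 -> ct x = 0.
Hypothesis psi_null : forall x, b x x = 0 -> psi x = 0.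
Hypothesis a_null : forall x, a x x = 0 -> psi x = 0 -> b x x = 0.
Hypothesis ct_e : forall i, ct (e i) = delta_mx 0 i.
Hypothesis a_iso : forall x y, ct (z x) = 0 -> ct (z y) = 0 -> a (z x) (z y) = a x y.
Hypothesis Dc : complete_for a (fun x => ct (z x) = 0).
Hypothesis Rc : complete_for a (fun x => ct x = 0).

Let bzi x : b (zi x) (zi x) = b x x.
Proof. by rewrite -bz ziK. Qed.

(** [psi] separates [a]-null vectors modulo [b]-null ones, so the coordinates of [psi x] determine
    such an [x] up to a [b]-null vector. *)
Lemma null_coordinates r (k : 'I_r -> V) x : (forall i, a (k i) (k i) = 0) ->
  (psi x <= \matrix_i psi (k i))%MS -> a x x = 0 ->
  let y := x - lincomb k (psi x *m pinvmx (\matrix_i psi (k i))) in b y y = 0.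
Proof.
move=> k0 xk x0 /=; apply: a_null; last first.
  by rewrite linearB linear_lincomb_mx mulmxKpV// subrr.
set w := lincomb _ _.
have w0 : a w w = 0.
  apply/eqP; rewrite -gram_null //; apply/eqP; rewrite [gram _ _](_ : _ = 0) ?mulmx0//.
  by apply/matrixP => i j; rewrite !mxE cform_null.
have := si_sqB aP x w; rewrite x0 w0 mulr0 addr0 => h.
by apply/le_anti; rewrite h si_ge0.
Qed.

(** In the coordinates given by [k], [f] becomes a matrix [T] from one kernel into the other, and
    [T'], coming from [g], undoes it. Applied with z and with its inverse as [f]. *)
Lemma rank_ker_le r (k : 'I_r -> V) (f g : {linear V -> V}) (P Q : {linear V -> 'rV[C]_n}) :
  (forall i, a (k i) (k i) = 0) -> row_free (\matrix_i psi (k i)) ->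
  (forall x, a x x = 0 -> (psi x <= \matrix_i psi (k i))%MS) ->
  cancel f g -> (forall x, b (g x) (g x) = b x x) ->
  (forall x, b x x = 0 -> Q x = 0) ->
  (forall x, a x x = 0 -> P x = 0 -> a (f x) (f x) = 0 /\ Q (f x) = 0) ->
  (\rank (kermx (\matrix_i P (k i))) <= \rank (kermx (\matrix_i Q (k i))))%N.
Proof.
move=> k0 kfree kspan fg bg Qnull fP.
set B := \matrix_i psi (k i).
pose T := (\matrix_i psi (f (k i))) *m pinvmx B.
pose T' := (\matrix_i psi (g (k i))) *m pinvmx B.
have key (c : 'rV[C]_r) : c *m \matrix_i P (k i) = 0 ->
    c *m T *m (\matrix_i Q (k i)) = 0 /\ c *m T *m T' = c.
  move=> cP; set y := lincomb k c.
  have Py : P y = 0 by rewrite linear_lincomb_mx.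
  have y0 : a y y = 0.
    apply/eqP; rewrite -gram_null //; apply/eqP; rewrite [gram _ _](_ : _ = 0) ?mulmx0//.
    by apply/matrixP => i j; rewrite !mxE cform_null.
  have [fy0 Qfy] := fP _ y0 Py.
  have cT : c *m T = psi (f y) *m pinvmx B.
    have E : psi (f y) = c *m \matrix_i psi (f (k i)).
      exact: (linear_lincomb_mx (psi \o f) k c).
    by rewrite E mulmxA.
  have d0 := null_coordinates k0 (kspan _ fy0) fy0; rewrite /= -/B -cT in d0.
  split.
    rewrite -linear_lincomb_mx; have := Qnull _ d0; rewrite linearB Qfy sub0r.
    by move/eqP; rewrite oppr_eq0 => /eqP.
  have E : psi (g (lincomb k (c *m T))) = (c *m T) *m \matrix_i psi (g (k i)).
    exact: (linear_lincomb_mx (psi \o g) k (c *m T)).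
  rewrite mulmxA -E.
  have gd : b (y - g (lincomb k (c *m T))) (y - g (lincomb k (c *m T))) = 0.
    by rewrite -[y in y - _]fg -linearB bg d0.
  have := psi_null gd; rewrite linearB => /eqP; rewrite subr_eq0 => /eqP <-.
  by rewrite linear_lincomb_mx mulmxKp.
have kk : kermx (\matrix_i P (k i)) *m \matrix_i P (k i) = 0 by exact: mulmx_ker.
have kr i : row i (kermx (\matrix_i P (k i))) *m \matrix_i P (k i) = 0.
  by rewrite -row_mul kk row0.
have E : kermx (\matrix_i P (k i)) *m T *m T' = kermx (\matrix_i P (k i)).
  by apply/row_matrixP => i; rewrite 2!row_mul; exact: (key _ (kr i)).2.
rewrite -[X in (\rank X <= _)%N]E; apply: leq_trans (mxrankM_maxl _ _) _.
apply: mxrankS; apply/row_subP => i; rewrite row_mul sub_kermx.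
by rewrite (key _ (kr i)).1.
Qed.

(** The radical of the Gram matrix is the image under [L] of the null space. That space has
    dimension [r] modulo [b]-null vectors, and the kernel in the formula counts the part that [L]
    kills. *)
Lemma rank_gram_section r (k : 'I_r -> V) (L : {linear V -> 'rV[C]_n}) (m : 'I_n -> V) :
  (forall i, a (k i) (k i) = 0) ->
  (forall x, a x x = 0 -> (psi x <= \matrix_i psi (k i))%MS) ->
  (forall x, b x x = 0 -> L x = 0) ->
  (forall i, L (m i) = delta_mx 0 i) ->
  (forall i y, L y = 0 -> a (m i) y = 0) ->
  \rank (gram a m) = (n - (r - \rank (kermx (\matrix_i L (k i)))))%N.
Proof.
move=> k0 kspan Lnull mL mP.
have E : (kermx (gram a m) == \matrix_i L (k i))%MS.
  apply/andP; split; apply/row_subP => i.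
    have : row i (kermx (gram a m)) *m gram a m == 0.
      by rewrite -row_mul mulmx_ker row0.
    move/(section_null aP _ mL mP) => [x x0 <-].
    have d0 := Lnull _ (null_coordinates k0 (kspan _ x0) x0).
    move/eqP: d0; rewrite linearB subr_eq0 linear_lincomb_mx => /eqP ->.
    exact: submxMl.
  rewrite rowK sub_kermx; apply/(section_null aP _ mL mP).
  by exists (k i).
have := mxrank_ker (gram a m); rewrite (eqmxP E).
have := mxrank_ker (\matrix_i L (k i)) => ->.
have h1 := rank_leq_row (\matrix_i L (k i)); have h2 := rank_leq_row (gram a m).
by rewrite subKn// => ->; rewrite subKn.
Qed.

(* [W] is [z] on the domain; the [a]-orthogonal complements of domain and range have Gram
   matrices of equal rank, hence congruent ones, and the congruence defines [W] there. *)
Theorem isometric_extension : exists W Wi : {linear V -> V},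
  [/\ cancel W Wi, cancel Wi W, forall x y, a (W x) (W y) = a x y &
      forall x, ct (z x) = 0 -> W x = z x].
Proof.
pose L : {linear V -> 'rV[C]_n} := ct \o z.
have Le i : L (zi (e i)) = delta_mx 0 i by rewrite /= ziK.
have [m [mL mP]] := @orthogonal_section _ aP _ L _ Dc Le.
have [m' [mL' mP']] := @orthogonal_section _ aP _ ct _ Rc ct_e.
have Lnull x : b x x = 0 -> L x = 0 by move=> x0; apply: ct_null; rewrite bz.
have [r [k [k0 kfree kspan]]] := linear_span_basis (fun x => a x x = 0) psi.
(* z and its inverse exchange the null vectors of the domain with those of the range, whence the two
   inequalities. *)
have rk : \rank (gram a m) = \rank (gram a m').
  rewrite (rank_gram_section k0 kspan Lnull mL mP).
  rewrite (rank_gram_section k0 kspan ct_null mL' mP'); congr (_ - (_ - _))%N.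
  apply/eqP; rewrite eqn_leq; apply/andP; split.
    apply: (rank_ker_le k0 kfree kspan zK bzi ct_null) => x x0 Lx.
    by rewrite a_iso.
  apply: (rank_ker_le k0 kfree kspan ziK bz Lnull) => x x0 Lx.
  by rewrite /= -a_iso /= ziK.
have [X Xu XG] := psd_congruent (gram_psd aP m) (gram_psd aP m') rk.
(* z acts on the component in the domain, [X] on the coordinates in the complement. *)
pose W : {linear V -> V} :=
  (z \o (idfun \- (lincomb m \o L))) \+ (lincomb m' \o (mulmxr X \o L)).
pose Wi : {linear V -> V} :=
  (zi \o (idfun \- (lincomb m' \o ct))) \+ (lincomb m \o (mulmxr (invmx X) \o ct)).
have WE x : W x = z (x - lincomb m (L x)) + lincomb m' (L x *m X) by [].
have WiE x : Wi x = zi (x - lincomb m' (ct x)) + lincomb m (ct x *m invmx X) by [].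
clearbody W Wi.
have LB x : L (x - lincomb m (L x)) = 0 by rewrite linearB lincomb_section// subrr.
have cB x : ct (x - lincomb m' (ct x)) = 0 by rewrite linearB lincomb_section// subrr.
exists W, Wi; split.
- move=> x; rewrite WiE WE.
  have -> : ct (z (x - lincomb m (L x)) + lincomb m' (L x *m X)) = L x *m X.
    by rewrite [LHS]linearD (lincomb_section _ mL') [X in X + _]LB add0r.
  by rewrite addrK zK mulmxK// subrK.
- move=> x; rewrite WE WiE.
  have -> : L (zi (x - lincomb m' (ct x)) + lincomb m (ct x *m invmx X)) = ct x *m invmx X.
    by rewrite [LHS]linearD (lincomb_section _ mL) /= ziK cB add0r.
  by rewrite addrK ziK mulmxKV// subrK.
- move=> x y; rewrite !WE.
  rewrite (si_orthD aP); last 2 first.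
  + exact: (section_orth aP _ mP' (LB y)).
  + exact: (section_orth aP _ mP' (LB x)).
  rewrite -[in RHS](subrK (lincomb m (L x)) x) -[in RHS](subrK (lincomb m (L y)) y).
  rewrite [RHS](si_orthD aP); last 2 first.
  + exact: (section_orth aP _ mP (LB y)).
  + exact: (section_orth aP _ mP (LB x)).
  congr (_ + _); first exact: (a_iso (LB x) (LB y)).
  suff : cform a (lincomb m' (L x *m X)) (lincomb m' (L y *m X))
       = cform a (lincomb m (L x)) (lincomb m (L y)) by case.
  rewrite !cform_lincomb// -XG trmx_mul map_mxM.
  by rewrite !mulmxA.
- by move=> x Lx; rewrite WE [L x]Lx mul0mx (linear0 (lincomb m)) (linear0 (lincomb m')) subr0 addr0.
Qed.

End Extension.
End LinComb.

(** * The scattering identification *)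

Section Scattering.
Variables (R : realType) (n : nat) (V : lmodType R[i]).
Local Notation C := (R[i]).
Local Open Scope complex_scope.
Variables (b a : V -> V -> R) (z : int -> {linear V -> V}) (eb : int -> 'I_n -> V).
Variables (Pm Pp : V -> V) (W Wi : {linear V -> V}).
Hypotheses (bP : semi_inner b) (aP : semi_inner a).
Hypothesis bc : complete_for b (fun=> True).
Hypothesis ac : complete_for a (fun=> True).
Hypothesis at_ : tame b a (fun=> True).
Hypothesis zD : forall (j k : int) x, z (j + k) x = z j (z k x).
Hypothesis z0 : forall x, z 0 x = x.
Hypothesis bz : forall j x y, b (z j x) (z j y) = b x y.
Hypothesis z_eb : forall k j i, z k (eb j i) = eb (k + j) i.
Local Notation coef x j i := (cform b x (eb j i)).
Hypothesis null_of_coef : forall x, (forall j i, coef x j i = 0) -> b x x = 0.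
Local Notation Hp x := (forall j : int, j < 0 -> forall i, coef x j i = 0).
Local Notation Hm x := (forall j : int, 0 <= j -> forall i, coef x j i = 0).
Hypothesis coef_eb : forall j i k l, coef (eb j i) k l = ((j == k) && (i == l))%:R.
Hypothesis PmP : forall x, Hm (Pm x).
Hypothesis PpP : forall x, Hp (Pp x).
Hypothesis PmPp : forall x, Pm x + Pp x = x.
Hypothesis orth : forall x y, Hp x -> Hm y -> b x y = 0.
Hypothesis aHm : forall y, exists w, forall h, Hm h -> a y h = b w h.
Hypothesis aHp : forall x, exists v, forall f, Hp f -> a x f = b v f.
Hypothesis aHmHm : forall g h, Hm g -> Hm h -> a g h = b g h.
Hypothesis aHpHp : forall g h, Hp g -> Hp h -> a g h = b g h.
Hypothesis WiK : cancel Wi W.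
Hypothesis aW : forall x y, a (W x) (W y) = a x y.
Hypothesis Wz : forall x, (forall i, coef x (-1) i = 0) -> W x = z 1 x.

Let Hp_eb (j : int) i : 0 <= j -> Hp (eb j i).
Proof.
move=> j0 k k0 l; rewrite coef_eb.
by case: eqVneq => // jk; move: k0; rewrite -jk ltNge j0.
Qed.

Let Hm_eb (j : int) i : j < 0 -> Hm (eb j i).
Proof.
move=> j0 k k0 l; rewrite coef_eb.
by case: eqVneq => // jk; move: k0; rewrite -jk leNgt j0.
Qed.

Let HmZ c x : Hm x -> Hm (c *: x).
Proof. by move=> h j j0 i; rewrite (cformZl bP) h// mulr0. Qed.

Let HpZ c x : Hp x -> Hp (c *: x).
Proof. by move=> h j j0 i; rewrite (cformZl bP) h// mulr0. Qed.

Let cz j x y : cform b (z j x) (z j y) = cform b x y.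
Proof. by rewrite /cform -linearZ /= !bz. Qed.

Let coef_z k x j i : coef (z k x) j i = coef x (j - k) i.
Proof.
have -> : eb j i = z k (eb (j - k) i) by rewrite z_eb addrC subrK.
exact: cz.
Qed.

Let caW x y : cform a (W x) (W y) = cform a x y.
Proof. by rewrite /cform -linearZ /= !aW. Qed.

(** z keeps H^2 inside the subspace on which [W] and z agree. *)
Lemma iterW_Hp k f : Hp f -> iter k W f = z k f.
Proof.
move=> hf; elim: k => [|k IH] /=; first by rewrite z0.
have -> : Posz k.+1 = 1 + Posz k by lia.
by rewrite IH zD Wz// => i; rewrite coef_z hf//; lia.
Qed.

Lemma a_iterW k x y : a (iter k W x) (iter k W y) = a x y.
Proof. by elim: k => //= k IH; rewrite aW. Qed.

(* [eps m i] is the image of [z^m e_i] under the identification of the two spaces that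
   fixes [H^2_-] and turns multiplication by [z] into [W]. *)
Definition eps (m : int) (i : 'I_n) : V :=
  match m with Negz _ => eb m i | Posz k => iter k.+1 W (eb (-1) i) end.

Lemma eps_neg m i : m < 0 -> eps m i = eb m i.
Proof. by case: m. Qed.

Lemma W_eps m i : W (eps m i) = eps (m + 1) i.
Proof.
case: m => [k|[|k]].
- by have -> : Posz k + 1 = Posz k.+1 by lia.
- by [].
(* An index of at most -2: the vector lies in the domain, where [W] is z. *)
- have -> : Negz k.+1 + 1 = Negz k by lia.
  rewrite /= Wz => [|l]; last by rewrite coef_eb.
  by rewrite z_eb; congr eb; lia.
Qed.

(** Shifting both indices changes neither side, so they can be moved below 0, where [eps] is [eb]
    and the two forms agree. *)
Lemma cform_eps m i l j : cform a (eps m i) (eps l j) = cform b (eb m i) (eb l j).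
Proof.
have shift (k : nat) (p q : int) : cform a (eps (p + k) i) (eps (q + k) j) = cform a (eps p i) (eps q j).
  elim: k => [|k IH]; first by rewrite !addr0.
  have E (r : int) : r + k.+1 = r + k + 1 by lia.
  by rewrite (E p) (E q) -!W_eps caW.
have [M [hm hl]] : exists M : nat, m - M%:Z < 0 /\ l - M%:Z < 0.
  by exists (`|m| + `|l| + 1)%N; lia.
rewrite -[m](subrK M%:Z) -[l](subrK M%:Z); move: (m - _) (l - _) hm hl => p q hp hq.
rewrite shift !eps_neg//.
have -> : cform a (eb p i) (eb q j) = cform b (eb p i) (eb q j).
  have h1 : Hm (eb p i) by exact: Hm_eb.
  have h2 : Hm (eb q j) by exact: Hm_eb.
  by rewrite /cform !aHmHm//; exact: HmZ.
by rewrite ![_ + M%:Z]addrC -!z_eb cz.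
Qed.

(** Trigonometric polynomials paired with their images. A relation demands no proof that the image
    is independent of how the polynomial is written. *)
Inductive trig : V -> V -> Prop :=
| trig0 : trig 0 0
| trigS c m i x y : trig x y -> trig (c *: eb m i + x) (c *: eps m i + y).

Lemma trig_lin c x y x' y' : trig x y -> trig x' y' -> trig (c *: x + x') (c *: y + y').
Proof.
move=> H H'; elim: H => [|d m i u v _ IH]; first by rewrite !scaler0 !add0r.
by rewrite !scalerDr !scalerA -!addrA; exact: trigS.
Qed.

Lemma trig_basis c m i : trig (c *: eb m i) (c *: eps m i).
Proof. by have := trigS c m i trig0; rewrite !addr0. Qed.

Lemma trig_shift x y : trig x y -> trig (z 1 x) (W y).
Proof.
elim=> [|c m i u v _ IH]; first by rewrite !linear0; exact: trig0.
by rewrite !linearP /= z_eb W_eps (addrC 1 m); exact: trigS.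
Qed.

Lemma trig_cform x y x' y' : trig x y -> trig x' y' -> cform b x x' = cform a y y'.
Proof.
have base m i u v : trig u v -> cform b (eb m i) u = cform a (eps m i) v.
  elim=> [|c l j u' v' _ IH].
    by rewrite /cform !scaler0 !(si0r bP) !(si0r aP).
  by rewrite (cformDr bP) (cformDr aP) (cformZr bP) (cformZr aP) IH cform_eps.
move=> H H'; elim: H => [|c m i u v _ IH].
  by rewrite /cform !(si0l bP) !(si0l aP).
by rewrite (cformDl bP) (cformDl aP) (cformZl bP) (cformZl aP) IH (base _ _ _ _ H').
Qed.

Lemma trig_bounded_degree x y : trig x y ->
  exists k : nat, forall j : int, k%:Z <= j -> forall i, coef x j i = 0.
Proof.
elim=> [|c m i u v _ [k kP]]; first by exists 0%N => j _ i; rewrite /cform !(si0l bP).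
exists (maxn k `|m|.+1) => j kj l.
rewrite (cformDl bP) (cformZl bP) coef_eb kP ?addr0; last by lia.
by case: eqVneq => [mj|_]; [lia|rewrite mulr0].
Qed.

Lemma trig_dense x (e : R) : 0 < e -> exists s t, trig s t /\ b (x - s) (x - s) < e.
Proof.
move=> e0.
have Ss : real_subspace (fun s => exists t, trig s t).
  split=> [|r u v [t Ht] [t' Ht']]; first by exists 0; exact: trig0.
  by exists (r%:C *: t + t'); exact: trig_lin.
have [|s [t st] xs] := dense_of_orthogonal bP Ss bc _ x e0; last by exists s, t.
move=> {}x H; apply: null_of_coef => j i; apply/cform_eq0; split; apply: H.
  by exists (1 *: eps j i); rewrite -[eb j i]scale1r; exact: trig_basis.
by exists ('i *: eps j i); exact: trig_basis.
Qed.

(** A trigonometric polynomial near [v] is orthogonal to [z^k g] once [k] exceeds its degree. *)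
Lemma tail_small v (e : R) : 0 < e -> exists k : nat, forall g, Hp g ->
  b v (z k g) ^+ 2 <= e * b g g.
Proof.
move=> e0; have [s [t [st vs]]] := trig_dense v e0.
have [k kP] := trig_bounded_degree st; exists k => g hg.
have s0 : b s (z k g) = 0.
  rewrite -(bz (- k%:Z)) -zD addNr z0 (siC bP); apply: orth => // j j0 i.
  by rewrite coef_z kP//; lia.
have -> : b v (z k g) = b (v - s) (z k g) by rewrite (siBl bP) s0 subr0.
apply: le_trans (cauchy_schwarz bP _ _) _; rewrite bz.
by apply: ler_wpM2r; [exact: si_ge0|exact: ltW].
Qed.

(** On H^2_- the functional is represented for [b] by some [w], whose negative coefficients then
    vanish. *)
Lemma a_orth_Hm y : (forall m i, m < 0 -> cform a y (eb m i) = 0) ->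
  forall h, Hm h -> a y h = 0.
Proof.
move=> H h hh; have [w wP] := aHm y; rewrite wP//; apply: orth => // m m0 i.
have h1 := @Hm_eb m i m0.
transitivity (cform a y (eb m i)); last exact: H.
by rewrite /cform (wP _ h1) (wP _ (HmZ 'i h1)).
Qed.

Lemma a_split y : (forall m i, m < 0 -> cform a y (eb m i) = 0) -> a y y = a y (Pp y).
Proof.
by move=> H; rewrite -[X in a y X = _]PmPp (siDr aP) (a_orth_Hm H (PmP y)) add0r.
Qed.

Lemma bPp x : b (Pp x) (Pp x) <= b x x.
Proof.
have o : b (Pp x) (Pm x) = 0 by apply: orth; [exact: PpP|exact: PmP].
rewrite -[X in _ <= b X X]PmPp (si_orthD bP o o).
by rewrite lerDr si_ge0.
Qed.

Lemma cform_a_congr x x' y : a (x - x') (x - x') = 0 -> cform a x y = cform a x' y.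
Proof. by move=> h; rewrite /cform !(si_null_congr aP _ h). Qed.

(* Writing [x = W^k y] and replacing [y] by a [b]-bounded representative, [a x x] becomes the
   pairing of a fixed vector with [z^k P_+ y], which tends to 0 as [k] grows. *)
Lemma eps_total x : (forall m i, cform a x (eps m i) = 0) -> a x x = 0.
Proof.
move=> H; have [K [K0 KP]] := at_.
have a0 := si_ge0 aP x.
have [v vP] := aHp x.
have key (e : R) : 0 < e -> a x x ^+ 2 <= e * (K * a x x).
  move=> e0; have [k kP] := tail_small v e0.
  pose y := iter k Wi x.
  have Wy : iter k W y = x.
    by rewrite /y; elim: (k) => //= m IH; rewrite -iterS iterSr WiK.
  have Hy m i : cform a y (eps m i) = 0.
    rewrite /y; elim: (k) m => [|k' IH] m /=; first exact: H.
    by rewrite -caW WiK W_eps IH.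
  have yy : a y y = a x x by rewrite -(a_iterW k) Wy.
  have [y' [_ yy' by']] := KP y I.
  have Hy' m i : m < 0 -> cform a y' (eb m i) = 0.
    by move=> m0; rewrite -(cform_a_congr _ yy') -eps_neg.
  have E : a x x = b v (z k (Pp y')).
    rewrite -yy (si_null_congr2 aP yy') (a_split Hy') -(si_null_congr aP _ yy').
    rewrite -(a_iterW k) Wy iterW_Hp; last exact: PpP.
    by apply: vP => j j0 i; rewrite coef_z PpP//; lia.
  rewrite {1}E; apply: le_trans (kP _ (PpP _)) _; apply: ler_wpM2l; first exact: ltW.
  by apply: le_trans (bPp _) _; rewrite -yy.
have [//|nz] := eqVneq (a x x) 0.
have ap : 0 < a x x by rewrite lt_def nz.
(* With this [e] the estimate reads [t ^+ 2 <= t ^+ 2 * K / (2 * (K + 1))] for [t = a x x], absurd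
   when [t > 0]. *)
have e0 : 0 < a x x / (2 * (K + 1)) by rewrite divr_gt0//; lra.
have := key _ e0; rewrite expr2 mulrA ler_pM2r// mulrAC ler_pdivlMr; last by lra.
have : 0 <= a x x * K by rewrite mulr_ge0.
by nra.
Qed.

Local Notation rel := (closure_rel b a trig).

Lemma trig_si x y x' y' : trig x y -> trig x' y' -> b x x' = a y y'.
Proof. by move=> H H'; have := trig_cform H H' => -[]. Qed.

Lemma rel_total x : exists y, rel x y.
Proof.
apply: (closure_rel_total bP _ _ ac trig_dense).
- by move=> r *; exact: trig_lin.
- exact: trig_si.
Qed.

(** The closure is taken for the transposed relation, whose domain is dense by [eps_total]. *)
Lemma rel_onto y : exists x, rel x y.
Proof.
have dense (x : V) (e : R) : 0 < e ->
    exists s t, (fun v u => trig u v) s t /\ a (x - s) (x - s) < e.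
  move=> e0.
  have Ss : real_subspace (fun s => exists t, trig t s).
    split=> [|r u v [t Ht] [t' Ht']]; first by exists 0; exact: trig0.
    by exists (r%:C *: t + t'); exact: trig_lin.
  have [|s [t st] xs] := dense_of_orthogonal aP Ss ac _ x e0; last by exists s, t.
  move=> {}x H; apply: eps_total => j i; apply/cform_eq0; split; apply: H.
    by exists (1 *: eb j i); rewrite -[eps j i]scale1r; exact: trig_basis.
  by exists ('i *: eb j i); exact: trig_basis.
have [x xP] : exists x, closure_rel a b (fun v u => trig u v) y x.
  apply: (closure_rel_total aP _ _ bc dense).
  - by move=> r *; exact: trig_lin.
  - by move=> u v u' v' H H'; rewrite (trig_si H H').
exists x => e e0; have [s [t [Hst h1 h2]]] := xP e e0.
by exists t, s.
Qed.

Lemma rel_iso x y x' y' : rel x y -> rel x' y' -> b x x' = a y y'.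
Proof. exact: (closure_rel_iso bP aP trig_si). Qed.

Lemma rel_J x y : rel x y -> rel ('i *: x) ('i *: y).
Proof.
move=> H e e0; have [s [t [Hst h1 h2]]] := H e e0.
exists ('i *: s), ('i *: t); rewrite -!scalerBr (siJ bP) (siJ aP); split=> //.
by have := trig_lin 'i Hst trig0; rewrite !addr0.
Qed.

Lemma rel_cform x y x' y' : rel x y -> rel x' y' -> cform b x x' = cform a y y'.
Proof.
move=> H H'; rewrite /cform (rel_iso H H'); congr Complex.
by apply: rel_iso => //; exact: rel_J.
Qed.

Lemma rel_shift (k : nat) x y : rel x y -> rel (z k x) (iter k W y).
Proof.
move=> H; elim: k => [|k IH] /=; first by rewrite z0.
have -> : Posz k.+1 = 1 + Posz k by lia.
rewrite zD => e e0; have [s [t [Hst h1 h2]]] := IH e e0.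
by exists (z 1 s), (W t); rewrite -!linearB bz aW; split=> //; exact: trig_shift.
Qed.

Lemma rel_basis m i : rel (eb m i) (eps m i).
Proof.
apply: (closure_rel_incl bP aP).
by rewrite -[eb m i]scale1r -[eps m i]scale1r; exact: trig_basis.
Qed.

(** The third clause prepares the bound for U^*: if the [u i] are the columns of U, then [v] and U^*
    f have the same nonnegative coefficients, so [b f f = b v g] pairs P_+ U^* f with a bounded [g].
    With [x] the image of [f], [v] represents [a x] on H^2, and [g] is P_+ of a controlled
    representative of [x]. *)
Theorem scattering : exists u : 'I_n -> V,
  [/\ forall (k : nat) i l, cform b (z k (u i)) (u l) = cform b (eb k i) (eb 0 l),
      forall (j : int) i l, j < 0 -> coef (u i) j l = cform a (eb 0 i) (eb j l) &
      exists K : R, 0 <= K /\ forall f, Hp f -> exists v g,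
        [/\ Hp g, b g g <= K * b f f, b f f = b v g &
            forall (k : nat) i, coef v k i = cform b f (z k (u i))]].
Proof.
have [u uP] := choice (fun i => rel_onto (eb 0 i)).
have Wk (k : nat) i : iter k W (eb 0 i) = eb k i.
  by rewrite iterW_Hp ?z_eb ?addr0//; exact: Hp_eb.
have HpI (m : int) i : 0 <= m -> Hp (eb m i) /\ Hp ('i *: eb m i).
  by move=> m0; split; [|apply: HpZ]; exact: Hp_eb.
exists u; split.
- move=> k i l; rewrite (rel_cform (rel_shift k (uP i)) (uP l)) Wk.
  have [h1 _] := HpI k%:Z i isT; have [h2 h3] := HpI 0 l (lexx 0).
  by rewrite /cform !aHpHp.
- by move=> j i l j0; rewrite (rel_cform (uP i) (rel_basis j l)) eps_neg.
have [K [K0 KP]] := at_; exists K; split=> // f hf.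
have [x fx] := rel_total f; have [x' [_ xx' bx']] := KP x I.
have Hx' m i : m < 0 -> cform a x' (eb m i) = 0.
  by move=> m0; rewrite -(cform_a_congr _ xx') -eps_neg// -(rel_cform fx (rel_basis m i)) hf.
have [v vP] := aHp x; have fxx := rel_iso fx fx.
exists v, (Pp x'); split.
- exact: PpP.
- by rewrite fxx; apply: le_trans (bPp _) bx'.
- rewrite fxx (si_null_congr2 aP xx') (a_split Hx') -(si_null_congr aP _ xx').
  by apply: vP; exact: PpP.
- move=> k i; rewrite (rel_cform fx (rel_shift k (uP i))) Wk.
  by have [h1 h2] := HpI k%:Z i isT; rewrite /cform !vP.
Qed.

End Scattering.

(** * Essential norm and finite codimension *)

Section EssentialNorm.
Variables (R : realType) (V : lmodType R[i]).
Local Notation C := (R[i]).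
Local Open Scope complex_scope.
Variables (b a : V -> V -> R) (Pp Gam Kop : V -> V) (Hp : V -> Prop) (q : R).
Hypotheses (bP : semi_inner b) (aP : semi_inner a).
Hypothesis ab : forall x, a x x <= 2 * b x x.
Hypothesis HpL : forall c f g, Hp f -> Hp g -> Hp (c *: f + g).
Hypothesis PpH : forall x, Hp (Pp x).
Hypothesis PpL : forall c x y, let d := Pp (c *: x + y) - (c *: Pp x + Pp y) in b d d = 0.
Hypothesis bPp : forall x, b (Pp x) (Pp x) <= b x x.
Hypothesis contr : forall f, Hp f -> b (Gam f) (Gam f) <= b f f.
Hypothesis coer : forall q' x, 0 <= q' <= 1 ->
  b (Gam (Pp x)) (Gam (Pp x)) <= q' * b (Pp x) (Pp x) -> (1 - q') / 2 * b x x <= a x x.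
Hypothesis q01 : 0 <= q < 1.
Hypothesis KL : forall c f g, Hp f -> Hp g -> Kop (c *: f + g) = c *: Kop f + Kop g.
Hypothesis KP : forall f, Hp f -> b (Gam f - Kop f) (Gam f - Kop f) <= q * b f f.
Hypothesis Knet : forall e : R, 0 < e -> exists N (g : nat -> V), forall f, Hp f ->
  b f f <= 1 -> exists2 i, (i < N)%N & b (Kop f - g i) (Kop f - g i) < e.

Lemma K_bound f : Hp f -> b (Kop f) (Kop f) <= 4 * b f f.
Proof.
move=> hf; have := si_sqB bP (Gam f) (Gam f - Kop f); rewrite subKr.
have f0 := si_ge0 bP f; have /andP[q0 q1] := q01.
have : q * b f f <= b f f by apply: ler_piMl => //; exact: ltW.
by have := contr hf; have := KP hf; lra.
Qed.

(** [Pp] is linear only up to null vectors; boundedness of [Kop] absorbs the defect. *)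
Lemma K_PpL c x y : let d := Kop (Pp (c *: x + y)) - (c *: Kop (Pp x) + Kop (Pp y)) in
  b d d = 0.
Proof.
rewrite /=; have hd := HpL c (PpH x) (PpH y).
have := K_bound (HpL (-1) hd (PpH (c *: x + y))).
rewrite KL// KL// !scaleN1r [- _ + Pp _]addrC [- _ + Kop _]addrC PpL mulr0 => h.
by apply/le_anti; rewrite h si_ge0.
Qed.

Section Net.
Variables (e : R) (N : nat) (g : nat -> V).
Hypothesis e0 : 0 < e.
Hypothesis gP : forall f, Hp f -> b f f <= 1 ->
  exists2 i, (i < N)%N & b (Kop f - g i) (Kop f - g i) < e.

(* A vector orthogonal to an [e]-net of a set containing it has norm at most [e]. *)
Lemma K_small f : Hp f -> (forall i, (i < N)%N -> b (Kop f) (g i) = 0) ->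
  b (Kop f) (Kop f) <= e * b f f.
Proof.
move=> hf fg; have [f0|fn] := eqVneq (b f f) 0.
  by have := K_bound hf; rewrite f0 !mulr0.
have fp : 0 < b f f by rewrite lt_def fn si_ge0.
pose r := (Num.sqrt (b f f))^-1.
have rr : r * r * b f f = 1.
  by rewrite -expr2 exprVn sqr_sqrtr ?ltW// mulVf.
have HpZ : forall f' (c : C), Hp f' -> Hp (c *: f').
  move=> f' c h; have h0 : Hp 0 by have := HpL (-1) h h; rewrite scaleN1r addNr.
  by have := HpL c h h0; rewrite addr0.
have KZ (c : C) : Kop (c *: f) = c *: Kop f.
  have K0 : Kop 0 = 0 by have := KL (-1) hf hf; rewrite !scaleN1r !addNr.
  have h0 : Hp 0 by have := HpL (-1) hf hf; rewrite scaleN1r addNr.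
  by have := KL c hf h0; rewrite K0 !addr0.
have [|i iN] := gP (HpZ _ r%:C hf); first by rewrite (siZl bP) (siZr bP) mulrA rr.
rewrite KZ !(siBl bP) !(siBr bP) !(siZl bP) !(siZr bP) (siC bP (g i)) fg// => h.
have := si_ge0 bP (g i); rewrite -ler_pdivrMr// => gi.
have -> : b (Kop f) (Kop f) / b f f = r * (r * b (Kop f) (Kop f)).
  by rewrite mulrA -[r * r](mulfK fn) rr mul1r mulrC.
by lra.
Qed.

Lemma K_functional i : bounded_functional b (fun x => b (Kop (Pp x)) (g i)).
Proof.
split=> [r x y|].
  by rewrite (si_null_congr bP _ (K_PpL _ _ _)) (siDl bP) (siZl bP).
exists (4 * b (g i) (g i)) => x; apply: le_trans (cauchy_schwarz bP _ _) _.
have := K_bound (PpH x); have := bPp x; have := si_ge0 bP (g i).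
have := si_ge0 bP (Kop (Pp x)); nra.
Qed.

Definition net_coef (x : V) : 'rV[C]_N := \row_i cform b (Kop (Pp x)) (g i).

Lemma net_coef_linear : linear net_coef.
Proof.
move=> c x y; apply/rowP => i; rewrite !mxE -(cformZl bP) -(cformDl bP).
by rewrite /cform !(si_null_congr bP _ (K_PpL _ _ _)).
Qed.

Hypothesis e_small : e = (1 - q) ^+ 2 / (4 * (1 + q)).

(** On the common kernel of the net functionals [Kop] is small, and [Gam - Kop] is controlled by
    [q]. The chosen [e] makes [2 q / (1 + q) + 2 e / (1 - q)] equal to [(1 + 3 q) / (2 (1 + q))],
    which is below 1. *)
Lemma net_coercive x : (forall i, (i < N)%N -> b (Kop (Pp x)) (g i) = 0) ->
  (1 - (1 + 3 * q) / (2 * (1 + q))) / 2 * b x x <= a x x.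
Proof.
move=> H; have /andP[q_ge0 q_lt1] := q01; have q1 : 0 < 1 + q by lra.
have qn : 1 + q != 0 by lra.
apply: coer.
  apply/andP; split; first by rewrite divr_ge0//; lra.
  by rewrite ler_pdivrMr; lra.
have hK := K_small (PpH x) H; have hG := KP (PpH x).
rewrite -[Gam (Pp x)](subrK (Kop (Pp x))).
move: (Pp x) hK hG => f hK hG; move: (Kop f) (Gam f - Kop f) hK hG => v u hK hG.
(* [N(u + v) <= N u / th + N v / (1 - th)] with [th = (1 + q) / 2]. *)
have h : b (u + v) (u + v) <= 2 / (1 + q) * b u u + 2 / (1 - q) * b v v.
  pose s := (1 - q) / (1 + q); have s0 : 0 < s by rewrite divr_gt0//; lra.
  have q1n : 1 - q != 0 by lra.
  have := si_ge0 bP (s%:C *: u - v).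
  rewrite !(siBl bP) !(siBr bP) !(siZl bP) !(siZr bP) !(siDl bP) !(siDr bP) (siC bP v u).
  move=> hs; have : 0 <= s^-1 * (s * (s * b u u) - s * b u v - (s * b u v - b v v)).
    by rewrite mulr_ge0// invr_ge0 ltW.
  have -> : s^-1 * (s * (s * b u u) - s * b u v - (s * b u v - b v v)) =
     2 / (1 + q) * b u u + 2 / (1 - q) * b v v - (b u u + b u v + (b u v + b v v)).
    by rewrite /s; field; rewrite q1n qn.
  by rewrite subr_ge0.
apply: (le_trans h).
have h1 : 2 / (1 + q) * b u u <= 2 / (1 + q) * (q * b f f).
  by apply: ler_wpM2l => //; rewrite divr_ge0//; lra.
have h2 : 2 / (1 - q) * b v v <= 2 / (1 - q) * (e * b f f).
  by apply: ler_wpM2l => //; rewrite divr_ge0//; lra.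
apply: le_trans (lerD h1 h2) _; rewrite e_small le_eqVlt; apply/orP; left; apply/eqP.
by field; apply/andP; split; lra.
Qed.

End Net.

(** [psi] collects the net functionals. On its kernel [a] is coercive, which gives the second clause
    at once and the third by removing the functionals one at a time. *)
Lemma essential_tame : exists N (psi : {linear V -> 'rV[C]_N}),
  [/\ forall x, b x x = 0 -> psi x = 0,
      forall x, a x x = 0 -> psi x = 0 -> b x x = 0 &
      forall H, real_subspace H -> complete_for b H -> tame b a H].
Proof.
have /andP[q_ge0 q_lt1] := q01; have q1 : 0 < 1 + q by lra.
pose e := (1 - q) ^+ 2 / (4 * (1 + q)).
have e0 : 0 < e by rewrite divr_gt0 ?exprn_gt0//; lra.
have [N [g gP]] := Knet e0.
pose psi : {linear V -> 'rV[C]_N} :=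
  HB.pack (net_coef N g) (GRing.isLinear.Build C V 'rV[C]_N *:%R (net_coef N g) (net_coef_linear N g)).
pose d := (1 - (1 + 3 * q) / (2 * (1 + q))) / 2.
have d0 : 0 < d.
  by rewrite divr_gt0// subr_gt0 ltr_pdivrMr; lra.
have co x : (forall i, (i < N)%N -> b (Kop (Pp x)) (g i) = 0) -> d * b x x <= a x x.
  by move=> H; apply: (net_coercive gP _ H).
exists N, psi; split.
- move=> x x0; apply/rowP => i; rewrite /= !mxE.
  have k0 : b (Kop (Pp x)) (Kop (Pp x)) = 0.
    apply/le_anti; rewrite si_ge0// andbT; apply: le_trans (K_bound (PpH x)) _.
    by have := bPp x; rewrite x0; lra.
  by apply/cform_eq0; rewrite !(si_null bP _ k0).
- move=> x x0 px.
  have : d * b x x <= a x x.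
    apply: co => i iN; have /rowP/(_ (Ordinal iN)) := px; rewrite /= !mxE.
    by move=> /cform_eq0[].
  by rewrite x0 pmulr_rle0// => h; apply/le_anti; rewrite h si_ge0.
move=> H Hs Hc; apply: (tame_finite_codim bP aP ab (phi := fun i x => b (Kop (Pp x)) (g i)) (N := N)) => //.
  by move=> i _; exact: K_functional.
exists d^-1; split=> [|x [Hx xP]]; first by rewrite invr_ge0 ltW.
exists x; split=> //; first by rewrite subrr (si0l aP).
by rewrite ler_pdivlMl//; exact: co.
Qed.

End EssentialNorm.

Local Open Scope classical_set_scope.
Local Open Scope ring_scope.

(** * Integration on the circle *)

Section CircleIntegral.
Variable R : realType.
Local Notation mu := (@lebesgue_measure R).
Local Notation D := (@Tdom R).

Definition integ (f : R -> R) := mu.-integrable D (EFin \o f).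
Definition circ (f : R -> R) : R := Rintegral mu D f.
(* Lebesgue measure lives on [measurableTypeR R], whose display differs from that of [R]. *)
Definition meas (f : R -> R) := measurable_fun (D : set (measurableTypeR R)) f.

Lemma mD : measurable (D : set (measurableTypeR R)). Proof. exact: measurable_itv. Qed.
Hint Resolve mD : core.

Lemma muD : mu D = 1%:E.
Proof. by rewrite /Tdom lebesgue_measure_itv /= lte_fin ltr01 oppr0 adde0. Qed.

Lemma aeS (P Q : R -> Prop) : (forall t, P t -> Q t) ->
  {ae mu, forall t, P t} -> {ae mu, forall t, Q t}.
Proof. by move=> PQ; apply: filterS; first exact: (ae_filter_ringOfSetsType mu). Qed.

Lemma aeI (P Q : R -> Prop) : {ae mu, forall t, P t} -> {ae mu, forall t, Q t} ->
  {ae mu, forall t, P t /\ Q t}.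
Proof. by apply: filterI; exact: (ae_filter_ringOfSetsType mu). Qed.

Lemma integ_meas f : integ f -> meas f.
Proof. by move=> /integrableP[/measurable_EFinP]. Qed.

Lemma eq_integ f g : (forall t, D t -> f t = g t) -> integ f -> integ g.
Proof.
by move=> fg; apply: eq_integrable => // t; rewrite inE => Dt /=; rewrite fg.
Qed.

Lemma eq_circ f g : (forall t, D t -> f t = g t) -> circ f = circ g.
Proof. by move=> fg; apply: eq_Rintegral => t; rewrite inE; exact: fg. Qed.

Lemma integD f g : integ f -> integ g -> integ (fun t => f t + g t).
Proof.
by move=> fi gi; apply: (eq_integrable mD _ _ _ (integrableD mD fi gi)).
Qed.

Lemma circD f g : integ f -> integ g -> circ (fun t => f t + g t) = circ f + circ g.
Proof. by move=> fi gi; rewrite /circ RintegralD. Qed.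

Lemma integZ r f : integ f -> integ (fun t => r * f t).
Proof.
by move=> fi; apply: (eq_integrable mD _ _ _ (integrableZl mD r fi)).
Qed.

Lemma circZ r f : integ f -> circ (fun t => r * f t) = r * circ f.
Proof. by move=> fi; rewrite /circ RintegralZl. Qed.

Lemma integN f : integ f -> integ (fun t => - f t).
Proof. by move=> fi; apply: eq_integ (integZ (-1) fi) => t _; rewrite mulN1r. Qed.

Lemma circN f : integ f -> circ (fun t => - f t) = - circ f.
Proof.
move=> fi; rewrite -[RHS]mulN1r -circZ//; apply: eq_circ => t _.
by rewrite mulN1r.
Qed.

Lemma integB f g : integ f -> integ g -> integ (fun t => f t - g t).
Proof. by move=> fi gi; apply: integD => //; exact: integN. Qed.

Lemma circB f g : integ f -> integ g -> circ (fun t => f t - g t) = circ f - circ g.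
Proof. by move=> fi gi; rewrite circD ?circN//; exact: integN. Qed.

Lemma circ0 : circ (fun=> 0) = 0.
Proof. by rewrite /circ Rintegral_cst// mul0r. Qed.

Lemma integ_cst r : integ (fun=> r).
Proof.
apply: measurable_bounded_integrable; first exact: mD.
- by have := muD; rewrite /= => ->; rewrite ltry.
- exact: measurable_cst.
- exact: bounded_cst.
Qed.

Lemma circ_cst r : circ (fun=> r) = r.
Proof.
transitivity (r * fine (mu D)); first exact: Rintegral_cst.
by rewrite muD mulr1.
Qed.

Lemma integ_sum (I : Type) (s : seq I) (F : I -> R -> R) :
  (forall i, integ (F i)) -> integ (fun t => \sum_(i <- s) F i t).
Proof.
move=> Fi; elim: s => [|i s IH].
  by apply: eq_integ (integ_cst 0) => t _; rewrite big_nil.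
by apply: eq_integ (integD (Fi i) IH) => t _; rewrite big_cons.
Qed.

Lemma circ_sum (I : Type) (s : seq I) (F : I -> R -> R) :
  (forall i, integ (F i)) ->
  circ (fun t => \sum_(i <- s) F i t) = \sum_(i <- s) circ (F i).
Proof.
move=> Fi; elim: s => [|i s IH].
  by rewrite big_nil -[RHS]circ0; apply: eq_circ => t _; rewrite big_nil.
rewrite big_cons -IH -circD//; last exact: integ_sum.
by apply: eq_circ => t _; rewrite big_cons.
Qed.

Lemma le_circ f g : integ f -> integ g -> (forall t, D t -> f t <= g t) ->
  circ f <= circ g.
Proof. by move=> fi gi fg; apply: le_Rintegral. Qed.

Lemma circ_ge0 f : (forall t, D t -> 0 <= f t) -> 0 <= circ f.
Proof. by move=> f0; apply: Rintegral_ge0. Qed.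

Lemma le_integ f g : meas f -> (forall t, D t -> `|f t| <= g t) -> integ g -> integ f.
Proof.
move=> mf fg gi; apply: (le_integrable mD _ _ gi); first exact/measurable_EFinP.
move=> t Dt /=; rewrite lee_fin; apply: le_trans (fg _ Dt) _; exact: ler_norm.
Qed.

Lemma integM f g M : integ f -> meas g -> (forall t, D t -> `|g t| <= M) ->
  integ (fun t => f t * g t).
Proof.
move=> fi mg gM.
apply: (@le_integ _ (fun t => M * `|f t|)).
- apply: measurable_funM => //; exact: integ_meas.
- move=> t Dt; rewrite normrM mulrC ler_wpM2r//; exact: gM.
- apply: integZ; exact: (integrable_norm fi).
Qed.

Lemma ae_le_integ f g : meas f -> {ae mu, forall t, D t -> `|f t| <= g t} -> integ g ->
  integ f.
Proof.
move=> mf fg gi; apply/integrableP; split; first exact/measurable_EFinP.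
have /integrableP[mg gfin] := gi; apply: le_lt_trans gfin.
apply: ae_ge0_le_integral => //.
- by do 2 apply: measurableT_comp => //.
- exact: measurableT_comp.
apply: aeS fg => t fg Dt /=; rewrite lee_fin.
by apply: le_trans (fg Dt) _; exact: ler_norm.
Qed.

Lemma ae_eq_circ f g : meas f -> meas g -> {ae mu, forall t, D t -> f t = g t} ->
  circ f = circ g.
Proof.
move=> mf mg fg; rewrite /circ /Rintegral; congr fine.
apply: ae_eq_integral => //; [exact/measurable_EFinP|exact/measurable_EFinP|].
by apply: aeS fg => t fg Dt /=; rewrite fg.
Qed.

End CircleIntegral.

(** * Uniqueness of Fourier coefficients *)

Section StepPolynomials.
Variable R : realType.
Implicit Types x y : R.

Lemma bernoulli_lower y N : 0 <= y <= 1 -> 1 - N%:R * y <= (1 - y) ^+ N.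
Proof.
move=> /andP[y0 y1]; elim: N => [|N IH]; first by rewrite mul0r subr0 expr0.
rewrite exprS; apply: le_trans (ler_wpM2l _ IH); last by rewrite subr_ge0.
by rewrite -natr1; have : 0 <= N%:R :> R by []; nra.
Qed.

Lemma bernoulli_upper y N : 0 <= y <= 1 -> (1 - y) ^+ N * (1 + N%:R * y) <= 1.
Proof.
move=> /andP[y0 y1]; elim: N => [|N IH]; first by rewrite mul0r addr0 expr0 mulr1.
apply: le_trans IH; rewrite exprSr -mulrA; apply: ler_wpM2l.
  by rewrite exprn_ge0// subr_ge0.
by rewrite -natr1; have : 0 <= N%:R :> R by []; nra.
Qed.

(* These polynomials in [x] tend boundedly to the indicator function of [x < 1/2]. *)
Definition stepf x k : R := (1 - x ^+ k) ^+ (2 ^ k).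

Lemma stepf_range x k : 0 <= x <= 1 -> 0 <= stepf x k <= 1.
Proof.
move=> /andP[x0 x1].
have h0 : 0 <= x ^+ k by rewrite exprn_ge0.
have h1 : x ^+ k <= 1 by rewrite exprn_ile1.
by rewrite exprn_ge0 ?subr_ge0// exprn_ile1 ?subr_ge0// lerBlDr lerDl.
Qed.

(** Bernoulli's inequality gives [stepf x k >= 1 - (2 x)^k]. *)
Lemma stepf_cvg1 x : 0 <= x < 2^-1 -> stepf x @ \oo --> (1 : R).
Proof.
move=> /andP[x0 x1].
apply: (@squeeze_cvgr _ _ _ _ (fun k => 1 - (2 * x) ^+ k) (cst 1)); last 2 first.
- rewrite -[X in _ --> X]subr0; apply: cvgB; first exact: cvg_cst.
  by apply: cvg_expr; rewrite ger0_norm; lra.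
- exact: cvg_cst.
apply: nearW => k; have xr : 0 <= x <= 1 by lra.
have /andP[_ ->] := stepf_range k xr; rewrite andbT exprMn -natrX.
by apply: bernoulli_lower; rewrite exprn_ge0// exprn_ile1//; lra.
Qed.

(** The upper Bernoulli bound gives [stepf x k <= (2 x)^-k]. *)
Lemma stepf_cvg0 x : 2^-1 < x <= 1 -> stepf x @ \oo --> (0 : R).
Proof.
move=> /andP[x0 x1]; have xp : 0 < x by lra.
apply: (@squeeze_cvgr _ _ _ _ (cst 0) (fun k => (2 * x)^-1 ^+ k)); last 2 first.
- exact: cvg_cst.
- apply: cvg_expr; rewrite ger0_norm ?invr_ge0; last by lra.
  by rewrite invf_lt1; lra.
apply: nearW => k; have xr : 0 <= x <= 1 by lra.
have /andP[-> _] := stepf_range k xr; rewrite /= /stepf.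
have yr : 0 <= x ^+ k <= 1 by rewrite exprn_ge0 ?exprn_ile1//; lra.
have := @bernoulli_upper _ (2 ^ k) yr.
have e0 : 0 < (2 * x) ^+ k by rewrite exprn_gt0//; lra.
have -> : (2 ^ k)%:R * x ^+ k = (2 * x) ^+ k by rewrite natrX exprMn.
set q := (1 - _) ^+ _; have q0 : 0 <= q by rewrite exprn_ge0// subr_ge0; case/andP: yr.
move=> h; rewrite exprVn -[X in _ <= X]mul1r ler_pdivlMr//; lra.
Qed.

End StepPolynomials.

Section Uniqueness.
Variable R : realType.
Local Notation mu := (@lebesgue_measure R).
Local Notation D := (@Tdom R).

Definition cs (j : int) (t : R) : R := cos (2 * pi * j%:~R * t).
Definition sn (j : int) (t : R) : R := sin (2 * pi * j%:~R * t).

Lemma meas_cs j : meas (cs j).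
Proof.
apply: (@measurable_funS _ _ _ _ setT) => //.
apply: continuous_measurable_fun => t; apply: continuous_comp.
  by apply: continuousM => //; exact: cvg_cst.
exact: continuous_cos.
Qed.

Lemma meas_sn j : meas (sn j).
Proof.
apply: (@measurable_funS _ _ _ _ setT) => //.
apply: continuous_measurable_fun => t; apply: continuous_comp.
  by apply: continuousM => //; exact: cvg_cst.
exact: continuous_sin.
Qed.

Lemma cs_bound j t : `|cs j t| <= 1. Proof. exact: cos_max. Qed.
Lemma sn_bound j t : `|sn j t| <= 1. Proof. exact: sin_max. Qed.

Let angle (j k : int) t :
  2 * pi * (j + k)%:~R * t = 2 * pi * j%:~R * t + 2 * pi * k%:~R * t :> R.
Proof. by rewrite intrD; ring. Qed.

Lemma csD j k t : cs (j + k) t = cs j t * cs k t - sn j t * sn k t.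
Proof. by rewrite /cs /sn angle cosD. Qed.

Lemma snD j k t : sn (j + k) t = sn j t * cs k t + cs j t * sn k t.
Proof. by rewrite /cs /sn angle sinD. Qed.

Lemma csN k t : cs (- k) t = cs k t.
Proof. by rewrite /cs rmorphN !(mulrN, mulNr) cosN. Qed.

Lemma snN k t : sn (- k) t = - sn k t.
Proof. by rewrite /sn rmorphN !(mulrN, mulNr) sinN. Qed.

Lemma cs0 t : cs 0 t = 1. Proof. by rewrite /cs mulr0 mul0r cos0. Qed.
Lemma sn0 t : sn 0 t = 0. Proof. by rewrite /sn mulr0 mul0r sin0. Qed.

Section OneFunction.
Variable g : R -> R.
Hypothesis gi : integ g.

Definition annihilates (phi : R -> R) := exists M : R, [/\ meas phi,
  forall t, `|phi t| <= M &
  forall j, circ (fun t => g t * phi t * cs j t) = 0 /\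
            circ (fun t => g t * phi t * sn j t) = 0].

Let gphi_integ phi (M : R) psi : meas phi -> (forall t, `|phi t| <= M) -> meas psi ->
  (forall t, `|psi t| <= 1) -> integ (fun t => g t * phi t * psi t).
Proof.
move=> mp pM mq q1; apply: (@integM _ _ _ 1) => //.
by apply: (@integM _ _ _ M).
Qed.

Lemma annihilatesD phi psi : annihilates phi -> annihilates psi ->
  annihilates (fun t => phi t + psi t).
Proof.
move=> [M [mp pM pj]] [N [mq qN qj]]; exists (M + N); split.
- exact: measurable_funD.
- by move=> t; apply: le_trans (ler_normD _ _) _; exact: lerD.
move=> j; have [p1 p2] := pj j; have [q1 q2] := qj j; split.
  rewrite -[RHS]addr0 -{1}p1 -q1 -circD; last 2 first.
  - exact: gphi_integ (meas_cs j) (cs_bound j).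
  - exact: gphi_integ (meas_cs j) (cs_bound j).
  by apply: eq_circ => t _; ring.
rewrite -[RHS]addr0 -{1}p2 -q2 -circD; last 2 first.
- exact: gphi_integ (meas_sn j) (sn_bound j).
- exact: gphi_integ (meas_sn j) (sn_bound j).
by apply: eq_circ => t _; ring.
Qed.

Lemma annihilatesZ r phi : annihilates phi -> annihilates (fun t => r * phi t).
Proof.
move=> [M [mp pM pj]]; exists (`|r| * M); split.
- by apply: measurable_funM => //; exact: measurable_cst.
- by move=> t; rewrite normrM ler_wpM2l.
move=> j; have [p1 p2] := pj j; split.
  rewrite -[RHS](mulr0 r) -p1 -circZ; last exact: gphi_integ (meas_cs j) (cs_bound j).
  by apply: eq_circ => t _; ring.
rewrite -[RHS](mulr0 r) -p2 -circZ; last exact: gphi_integ (meas_sn j) (sn_bound j).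
by apply: eq_circ => t _; ring.
Qed.

(** Product-to-sum formulas turn the factor [cs 1] into shifts of [j] by 1 in both directions. *)
Lemma annihilates_cs phi : annihilates phi -> annihilates (fun t => phi t * cs 1 t).
Proof.
move=> [M [mp pM pj]]; exists M; split.
- by apply: measurable_funM => //; exact: meas_cs.
- move=> t; rewrite normrM; apply: le_trans (pM t); rewrite ler_piMr//; exact: cs_bound.
move=> j; have [p1 p2] := pj (j + 1); have [q1 q2] := pj (j - 1); split.
  transitivity (2^-1 * (circ (fun t => g t * phi t * cs (j + 1) t) +
                        circ (fun t => g t * phi t * cs (j - 1) t))).
    rewrite -circD; [|exact: gphi_integ (meas_cs _) (cs_bound _)..].
    rewrite -circZ; last by apply: integD; exact: gphi_integ (meas_cs _) (cs_bound _).
    by apply: eq_circ => t _; rewrite !csD csN snN; field.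
  by rewrite p1 q1 addr0 mulr0.
transitivity (2^-1 * (circ (fun t => g t * phi t * sn (j + 1) t) +
                      circ (fun t => g t * phi t * sn (j - 1) t))).
  rewrite -circD; [|exact: gphi_integ (meas_sn _) (sn_bound _)..].
  rewrite -circZ; last by apply: integD; exact: gphi_integ (meas_sn _) (sn_bound _).
  by apply: eq_circ => t _; rewrite !snD csN snN; field.
by rewrite p2 q2 addr0 mulr0.
Qed.

Lemma annihilates_sn phi : annihilates phi -> annihilates (fun t => phi t * sn 1 t).
Proof.
move=> [M [mp pM pj]]; exists M; split.
- by apply: measurable_funM => //; exact: meas_sn.
- move=> t; rewrite normrM; apply: le_trans (pM t); rewrite ler_piMr//; exact: sn_bound.
move=> j; have [p1 p2] := pj (j + 1); have [q1 q2] := pj (j - 1); split.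
  transitivity (2^-1 * (circ (fun t => g t * phi t * sn (j + 1) t) -
                        circ (fun t => g t * phi t * sn (j - 1) t))).
    rewrite -circB; [|exact: gphi_integ (meas_sn _) (sn_bound _)..].
    rewrite -circZ; last by apply: integB; exact: gphi_integ (meas_sn _) (sn_bound _).
    by apply: eq_circ => t _; rewrite !snD csN snN; field.
  by rewrite p2 q2 subr0 mulr0.
transitivity (2^-1 * (circ (fun t => g t * phi t * cs (j - 1) t) -
                      circ (fun t => g t * phi t * cs (j + 1) t))).
  rewrite -circB; [|exact: gphi_integ (meas_cs _) (cs_bound _)..].
  rewrite -circZ; last by apply: integB; exact: gphi_integ (meas_cs _) (cs_bound _).
  by apply: eq_circ => t _; rewrite !csD csN snN; field.
by rewrite p1 q1 subr0 mulr0.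
Qed.

Hypothesis g_cs : forall j, circ (fun t => g t * cs j t) = 0.
Hypothesis g_sn : forall j, circ (fun t => g t * sn j t) = 0.

Lemma annihilates_cst r : annihilates (fun=> r).
Proof.
have h : annihilates (fun=> 1).
  exists 1; split=> [|t|j]; [exact: measurable_cst|by rewrite normr1|].
  split; first by rewrite -[RHS](g_cs j); apply: eq_circ => t _; rewrite mulr1.
  by rewrite -[RHS](g_sn j); apply: eq_circ => t _; rewrite mulr1.
have -> : (fun=> r) = (fun t : R => r * (fun=> 1) t).
  by apply/funext => t; rewrite mulr1.
exact: annihilatesZ.
Qed.

(** A cosine centred at the midpoint of [[0, x]]: for [0 < x < 1] and [0 < t < 1],
    [c x t > cos (pi * x)] exactly when [t < x]. *)
Let c x t : R := cos (2 * pi * t - pi * x).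

Lemma annihilates_poly x (p : {poly R}) : annihilates (fun t => p.[c x t]).
Proof.
elim/poly_ind: p => [|p r IH].
  suff -> : (fun t => (0 : {poly R}).[c x t]) = fun=> 0 by exact: annihilates_cst.
  by apply/funext => t; rewrite horner0.
suff -> : (fun t => (p * 'X + r%:P).[c x t]) =
   fun t => (cos (pi * x) * (p.[c x t] * cs 1 t) + sin (pi * x) * (p.[c x t] * sn 1 t)) + r.
  apply: annihilatesD; last exact: annihilates_cst.
  by apply: annihilatesD; apply: annihilatesZ; [exact: annihilates_cs|exact: annihilates_sn].
apply/funext => t; rewrite hornerMXaddC /c cosB /cs /sn !mulr1; ring.
Qed.

(** [stepf] of an affine function of [c] is a trigonometric polynomial, so [g] integrates to 0
    against it, and it tends boundedly to the indicator of [[0, x]]. Dominated convergence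
    concludes. *)
Lemma integral_initial_eq0 (x : R) : 0 < x < 1 -> Rintegral mu `[0, x] g = 0.
Proof.
move=> /andP[x0 x1].
pose c0 := cos (pi * x); pose h t := if t <= x then 1 else 0 : R.
(* Rescaled to have values in [[0, 1]], with [y t < 1 / 2] meaning [c x t > c0]. *)
pose y t := 2^-1 + (c0 - c x t) / 4.
pose q k t := stepf (y t) k.
have yr t : 0 <= y t <= 1.
  have := cos_max (pi * x); have := cos_max (2 * pi * t - pi * x).
  rewrite -/c0 -/(c x t) !ler_norml /y => /andP[? ?] /andP[? ?]; lra.
have qk k : annihilates (q k).
  pose l : {poly R} := (2^-1 + c0 / 4)%:P - (4^-1) *: 'X.
  have := annihilates_poly x ((1 - l ^+ k) ^+ (2 ^ k)).
  suff -> : (fun t => ((1 - l ^+ k) ^+ (2 ^ k)).[c x t]) = q k by [].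
  apply/funext => t; rewrite /q /stepf /l !(horner_exp, hornerE).
  by congr ((1 - _ ^+ _) ^+ _); rewrite /y; field.
have q0 k : circ (fun t => g t * q k t) = 0.
  have [M [_ _ /(_ 0)[+ _]]] := qk k.
  by move=> <-; apply: eq_circ => t _; rewrite cs0 mulr1.
have p0 : 0 < pi :> R := pi_gt0 R.
have px : 0 < pi * x < pi by rewrite mulr_gt0//= gtr_pMr.
(* At the excluded points 0, [x] and 1 the value of [y] is 1/2, the threshold between the two limits
   of [stepf]. *)
have qcvg t : D t -> t != 0 -> t != x -> t != 1 -> q ^~ t @ \oo --> h t.
  rewrite /Tdom /= in_itv /= => /andP[t0 t1] nt0 ntx nt1.
  have tp : 0 < t by rewrite lt_def nt0.
  have tl : t < 1 by rewrite lt_neqAle nt1.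
  have cosl a b : 0 <= a -> a < b -> b <= pi -> cos b < cos a.
    move=> a0 ab bp; rewrite ltr_cos// in_itv /=; lra.
  rewrite /h /q; case: (leP t x) => tx.
    have {}tx : t < x by rewrite lt_neqAle ntx.
    apply: stepf_cvg1; rewrite (andP (yr t)).1 /=.
    have : c0 < c x t.
      rewrite /c0 /c -(cos_norm (2 * pi * t - pi * x)); apply: cosl => //; last lra.
      by rewrite ltr_norml; apply/andP; split; nra.
    by rewrite /y; lra.
  apply: stepf_cvg0; rewrite (andP (yr t)).2 andbT.
  have : c x t < c0.
    rewrite /c0 /c; case: (leP (2 * pi * t - pi * x) pi) => hp.
      by apply: cosl => //; [lra|nra].
    (* The angle has passed pi and is reflected back to where the cosine decreases. *)
    have -> : cos (2 * pi * t - pi * x) = cos (2 * pi - (2 * pi * t - pi * x)).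
      rewrite -cosN -[LHS]cosD2pi; congr cos; rewrite mulr2n; ring.
    by apply: cosl; [lra|nra|lra].
  by rewrite /y; lra.
have mh : meas h.
  have -> : h = \1_(`]-oo, x]).
    apply/funext => t; rewrite /h indicE; case: (leP t x) => tx.
      by rewrite mem_set//= in_itv.
    by rewrite memNset//= in_itv /= => /(lt_le_trans tx); rewrite ltxx.
  by apply: measurable_indic; exact: measurable_itv.
have mq k : meas (q k) by have [M []] := qk k.
have mg := integ_meas gi.
have mE (f : R -> R) : meas f -> measurable_fun (D : set (measurableTypeR R)) (EFin \o f).
  by move=> mf; exact/measurable_EFinP.
have aepts : {ae mu, forall t, D t -> [/\ t != 0, t != x & t != 1]}.
  have pt (a : R) : {ae mu, forall t, t != a}.
    exists [set a]; split; [exact: measurable_set1|exact: lebesgue_measure_set1|].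
    by move=> t /= /negP; rewrite negbK => /eqP.
  by apply: aeS (aeI (pt 0) (aeI (pt x) (pt 1))) => t [? [? ?]] _.
have f_f : {ae mu, forall t, D t ->
    (fun k => (EFin \o (fun t => g t * q k t)) t) @ \oo --> (EFin \o (fun t => g t * h t)) t}.
  apply: aeS aepts => t H Dt; have [t0 tx t1] := H Dt.
  apply: cvg_EFin; first exact: nearW.
  by apply: cvgM; [exact: cvg_cst|exact: qcvg].
have f_g : {ae mu, forall t k, D t ->
    (`|(EFin \o (fun t => (g t * q k t)%R)) t| <= (EFin \o (fun t => `|g t|%R)) t)%E}.
  apply: aeW => t k Dt /=; rewrite lee_fin normrM ler_piMr//.
  by have /andP[q0' q1] := stepf_range k (yr t); rewrite ger0_norm.
have [_ _] := dominated_convergence (@mD R)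
  (fun k => mE _ (measurable_funM mg (mq k))) (mE _ (measurable_funM mg mh))
  f_f (integrable_norm gi) f_g.
have -> : (fun k => (\int[mu]_(t in D) (EFin \o (fun t => (g t * q k t)%R)) t)%E) = fun=> 0%E.
  apply/funext => k; transitivity ((circ (fun t => g t * q k t))%:E); last by rewrite q0.
  rewrite /circ /Rintegral fineK//.
  apply: integrable_fin_num; first exact: mD.
  apply: (integM gi (mq k) (M := 1)) => t _.
  by have /andP[q0' q1] := stepf_range k (yr t); rewrite ger0_norm.
move=> /cvg_lim; rewrite lim_cst// => /(_ _)/esym H.
have : circ (fun t => g t * h t) = 0.
  by rewrite /circ /Rintegral H.
move=> H0; rewrite -[RHS]H0 /circ [RHS]Rintegral_mkcond [LHS]Rintegral_mkcond; congr Rintegral.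
apply/funext => t; rewrite !patchE /Tdom /h.
case: (leP t x) => tx.
  rewrite mulr1; congr (if _ then _ else _); apply/idP/idP; rewrite !inE /= !in_itv /=.
    by move=> /andP[-> _]; rewrite (le_trans tx)// ltW.
  by move=> /andP[-> _].
rewrite mulr0 if_same memNset//= in_itv /= => /andP[_ /(lt_le_trans tx)].
by rewrite ltxx.
Qed.

(** All integrals over initial intervals vanish, so Lebesgue differentiation applies to [g],
    extended by 0 to the line. *)
Theorem fourier_unique : {ae mu, forall t, D t -> g t = 0}.
Proof.
pose f := g \_ D.
have fl : locally_integrable [set: R] f by apply: integrable_locally => //; exact: mD.
have fT : mu.-integrable setT (EFin \o f).
  have -> : EFin \o f = (EFin \o g) \_ D by rewrite restrict_EFin.
  by apply/integrable_restrict; [exact: mD|exact: measurableT|rewrite setTI].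
have fi y : mu.-integrable [set` Interval (BLeft 0) (BRight y)] (EFin \o f).
  have mI : measurable ([set` Interval (BLeft 0) (BRight y)] : set (measurableTypeR R)).
    exact: measurable_itv.
  exact: (integrableS measurableT mI (@subsetT _ _) fT).
have := FTC1 fi fl; set F := (fun x => _) => H.
have pt (a : R) : {ae mu, forall t, t != a}.
  exists [set a]; split; [exact: measurable_set1|exact: lebesgue_measure_set1|].
  by move=> t /= /negP; rewrite negbK => /eqP.
apply: aeS (aeI H (aeI (pt 0) (pt 1))) => t [Ht [nt0 nt1]] Dt.
have /andP[t0 t1] : 0 < t < 1.
  move: Dt; rewrite /Tdom /= in_itv /= => /andP[t0 t1].
  by rewrite lt_def nt0 t0 lt_neqAle nt1.
have F0 y : 0 < y < 1 -> F y = 0.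
  move=> y01; rewrite -(integral_initial_eq0 y01); apply: eq_Rintegral => s.
  rewrite inE /= in_itv /= /f patchE => /andP[s0 sy].
  rewrite mem_set// /Tdom /= in_itv /= s0 /= (le_trans sy)// ltW//.
  by case/andP: y01.
have lt0t : (0%:E < t%:E)%E by rewrite lte_fin.
have [_ dF] := Ht lt0t.
have fg : f t = g t by rewrite /f patchE mem_set.
rewrite -fg -dF derive1E (@near_eq_derive _ _ _ _ (cst 0)) ?derive_cst//.
near=> y; apply: F0; apply/andP; split; near: y.
  exact: lt_nbhsr.
exact: lt_nbhsl.
Unshelve. all: by end_near. Qed.

End OneFunction.
End Uniqueness.

(** * Completeness of L2 *)

Section L2Complete.
Variable R : realType.
Local Notation mu := (@lebesgue_measure R).
Local Notation D := (@Tdom R).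

Definition sqinteg (f : R -> R) := meas f /\ integ (fun t => f t ^+ 2).

Lemma sqintegM f g : sqinteg f -> sqinteg g -> integ (fun t => f t * g t).
Proof.
move=> [mf fi] [mg gi]; apply: (le_integ (g := fun t => f t ^+ 2 + g t ^+ 2)).
- exact: measurable_funM.
- move=> t _; rewrite ler_norml; apply/andP; split.
    by have := sqr_ge0 (f t + g t); have := sqr_ge0 (f t - g t); nra.
  by have := sqr_ge0 (f t + g t); have := sqr_ge0 (f t - g t); nra.
- exact: integD.
Qed.

Lemma sqintegD f g : sqinteg f -> sqinteg g -> sqinteg (fun t => f t + g t).
Proof.
move=> fs gs; have fg := sqintegM fs gs; case: fs gs => [mf fi] [mg gi]; split.
  exact: measurable_funD.
apply: eq_integ (integD (integD fi gi) (integZ 2 fg)) => t _; ring.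
Qed.

Lemma sqintegZ r f : sqinteg f -> sqinteg (fun t => r * f t).
Proof.
move=> [mf fi]; split; first by apply: measurable_funM => //; exact: measurable_cst.
by apply: eq_integ (integZ (r ^+ 2) fi) => t _; ring.
Qed.

Lemma sqintegB f g : sqinteg f -> sqinteg g -> sqinteg (fun t => f t - g t).
Proof.
move=> fs gs; have [m i] := sqintegD fs (sqintegZ (-1) gs); split.
  by apply: eq_measurable_fun m => t _; rewrite mulN1r.
by apply: eq_integ i => t _; rewrite mulN1r.
Qed.

Lemma circ_sqD f g : sqinteg f -> sqinteg g ->
  circ (fun t => (f t + g t) ^+ 2)
  <= 2 * circ (fun t => f t ^+ 2) + 2 * circ (fun t => g t ^+ 2).
Proof.
move=> fs gs; have [_ h] := sqintegD fs gs; case: fs gs => [_ fi] [_ gi].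
rewrite -!circZ// -circD; [|exact: integZ..].
apply: le_circ => //; first by apply: integD; exact: integZ.
by move=> t _; have := sqr_ge0 (f t - g t); nra.
Qed.

(** The Riesz-Fischer argument: steps of squared norm of order [4^-k] have L^1 norms of order
    [2^-k], so their sum is finite almost everywhere. Fatou's lemma carries the quadratic bounds to
    the pointwise limit. *)
Lemma sqinteg_complete (u : nat -> R -> R) (K : R) :
  (forall k, sqinteg (u k)) ->
  (forall k, circ (fun t => (u k.+1 t - u k t) ^+ 2) <= K * quarter R k) ->
  exists v, sqinteg v /\
    forall k, circ (fun t => (v t - u k t) ^+ 2) <= 4 * K * quarter R k.
Proof.
move=> us uK.
pose d k t := u k.+1 t - u k t.
have ds k : sqinteg (d k) by exact: sqintegB.
have dabs k : integ (fun t => `|d k t|).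
  have [m i] := ds k; apply: (le_integ (g := fun t => 1 + d k t ^+ 2)).
  - exact: measurableT_comp.
  - move=> t _; rewrite normr_id; case: (ger0P (d k t)) => _.
      by have := sqr_ge0 (d k t - 1); nra.
    by have := sqr_ge0 (d k t + 1); nra.
  - by apply: integD => //; exact: integ_cst.
have dK k : circ (fun t => `|d k t|) <= (K + 1) / 2 * 2^-1 ^+ k.
  (* The weight [l = 2^k] balances the two terms of [2 |d| <= l d^2 + 1 / l]. *)
  have [m i] := ds k; pose l : R := 2 ^+ k.
  have l0 : 0 < l by rewrite exprn_gt0.
  have lV : l^-1 = 2^-1 ^+ k by rewrite exprVn.
  have qE : l * quarter R k = 2^-1 ^+ k.
    by rewrite /l /quarter -exprMn; congr (_ ^+ _); field.
  apply: (@le_trans _ _ (circ (fun t => l / 2 * d k t ^+ 2 + l^-1 / 2))).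
    apply: le_circ => //.
      by apply: integD; [exact: integZ|exact: integ_cst].
    move=> t _.
    suff : l * (2 * `|d k t|) <= l * (l * d k t ^+ 2 + l^-1).
      by rewrite ler_pM2l//; lra.
    rewrite mulrDr divff ?gt_eqF//; case: (ger0P (d k t)) => _.
      by have := sqr_ge0 (l * d k t - 1); nra.
    by have := sqr_ge0 (l * d k t + 1); nra.
  rewrite circD; [|exact: integZ|exact: integ_cst].
  rewrite circZ// circ_cst lV -[X in _ <= _ * X]qE.
  have := uK k; rewrite -/(d k) => h; rewrite -qE.
  have : l / 2 * circ (fun t => d k t ^+ 2) <= l / 2 * (K * quarter R k).
    by apply: ler_wpM2l => //; lra.
  by lra.
(* The constant 4 reproduces itself: [2 * (4 K / 4) + 2 K = 4 K]. *)
have uN k m : circ (fun t => (u (k + m)%N t - u k t) ^+ 2) <= 4 * K * quarter R k.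
  have K0 : 0 <= K.
    have := uK 0%N; rewrite /quarter expr0 mulr1; apply: le_trans.
    by apply: circ_ge0 => t _; exact: sqr_ge0.
  elim: m k => [|m IH] k.
    rewrite addn0 (eq_circ (g := fun=> 0)) => [|t _]; last by rewrite subrr expr0n.
    by rewrite circ0 !mulr_ge0// ltW// quarter_gt0.
  have := IH k.+1; rewrite quarterS => h.
  have := circ_sqD (sqintegB (us (k.+1 + m)%N) (us k.+1)) (ds k).
  rewrite (eq_circ (g := fun t => (u (k + m.+1)%N t - u k t) ^+ 2)); last first.
    by move=> t _; rewrite /d addrA subrK addSnnS.
  by have := uK k; rewrite -/(d k); lra.
pose S t := (\sum_(k <oo) (`|d k t|)%:E)%E.
have md k : measurable_fun (D : set (measurableTypeR R)) (fun t => (`|d k t|)%:E).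
  by apply/measurable_EFinP; exact: integ_meas (dabs k).
have S_ge0 t : (0 <= S t)%E by apply: nneseries_ge0 => k _ _; rewrite lee_fin.
have mS : measurable_fun (D : set (measurableTypeR R)) S.
  by apply: ge0_emeasurable_sum => // k t _ _; rewrite lee_fin.
have Sint : mu.-integrable D S.
  apply/integrableP; split => //.
  under eq_integral do rewrite gee0_abs//.
  have d0 k t : D t -> (0 <= (`|d k t|)%:E)%E by rewrite lee_fin.
  rewrite (integral_nneseries mu (@mD R) md d0).
  apply: (@le_lt_trans _ _ (K + 1)%:E); last by rewrite ltry.
  apply: lime_le.
    by apply: is_cvg_nneseries => k _ _; apply: integral_ge0 => t _; rewrite lee_fin.
  apply: nearW => m.
  have E k : (\int[mu]_(t in D) (`|d k t|)%:E)%E = (circ (fun t => `|d k t|))%:E.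
    rewrite /circ /Rintegral fineK//; apply: integrable_fin_num; [exact: mD|exact: dabs].
  under eq_bigr do rewrite E.
  rewrite sumEFin lee_fin.
  have K0 : 0 <= K + 1.
    have := le_trans (circ_ge0 (f := fun t => `|d 0%N t|) (fun t _ => normr_ge0 _)) (dK 0%N).
    by rewrite expr0 mulr1; lra.
  apply: (@le_trans _ _ ((K + 1) * (1 - 2^-1 ^+ m))).
    rewrite big_mkord; elim: m => [|m IH]; first by rewrite big_ord0 expr0 subrr mulr0.
    rewrite big_ord_recr /= exprS; have := dK m; lra.
  rewrite ler_piMr// lerBlDr lerDl exprn_ge0//.
(* An upper limit is measurable whether or not the sequence converges; [fine] sends infinite values
   to 0. *)
pose v t := fine (limn_esup (fun k => (u k t)%:E)).
have mv : meas v.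
  apply: (measurableT_comp (f := fine)); first exact: fine_measurable.
  by apply: measurable_fun_limn_esup => k; apply/measurable_EFinP; case: (us k).
have uv : {ae mu, forall t, D t -> u ^~ t @ \oo --> v t}.
  apply: aeS (integrable_ae (@mD R) Sint) => t Ht Dt.
  have Sfin := Ht Dt.
  have nc : cvgn [normed series (d ^~ t)].
    apply: nondecreasing_is_cvgn.
      by apply/nondecreasing_seqP => k; rewrite /= seriesSr lerDl.
    exists (fine (S t)) => _ [k _ <-].
    rewrite /= seriesEnat /= -lee_fin fineK// -sumEFin.
    by apply: nneseries_lim_ge => j _ _; rewrite lee_fin.
  have [l ul] : exists l : R, u ^~ t @ \oo --> l.
    have /cvg_ex[l sl] := normed_cvg nc.
    exists (u 0%N t + l).
    have -> : u ^~ t = (fun k => u 0%N t + series (d ^~ t) k).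
      by apply/funext => k; rewrite [LHS](eq_sum_telescope (u ^~ t)).
    by apply: cvgD => //; exact: cvg_cst.
  have uE : (fun k => (u k t)%:E) @ \oo --> l%:E.
    by apply: cvg_EFin => //; exact: nearW.
  by rewrite /v (cvg_limn_einf_sup uE).2.
have key k : integ (fun t => (v t - u k t) ^+ 2) /\
    circ (fun t => (v t - u k t) ^+ 2) <= 4 * K * quarter R k.
  have mk : meas (fun t => (v t - u k t) ^+ 2).
    by apply: measurable_funX; apply: measurable_funB => //; case: (us k).
  pose f m t := ((u (k + m)%N t - u k t) ^+ 2)%:E.
  have fs m := sqintegB (us (k + m)%N) (us k).
  have mf m : measurable_fun (D : set (measurableTypeR R)) (f m).
    by apply/measurable_EFinP; apply: integ_meas; case: (fs m).
  have le : (\int[mu]_(t in D) ((v t - u k t) ^+ 2)%:E <= (4 * K * quarter R k)%:E)%E.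
    have -> : (\int[mu]_(t in D) ((v t - u k t) ^+ 2)%:E =
               \int[mu]_(t in D) limn_einf (f ^~ t))%E.
      apply: ae_eq_integral; first exact: mD.
      - exact/measurable_EFinP.
      - rewrite /limn_einf; apply: measurableT_comp => //.
        apply: measurable_fun_limn_esup => m; exact: measurableT_comp.
      apply: aeS uv => t Ht Dt; have ut := Ht Dt.
      have : f ^~ t @ \oo --> ((v t - u k t) ^+ 2)%:E.
        apply: cvg_EFin; first exact: nearW.
        have h : (fun m => u (k + m)%N t) @ \oo --> v t.
          have -> : (fun m => u (k + m)%N t) = (fun m => u (m + k)%N t).
            by apply/funext => m; rewrite addnC.
          by have := ut; rewrite -(cvg_shiftn k).
        rewrite expr2; apply: cvgM; apply: cvgB => //; exact: cvg_cst.
      by move=> /cvg_limn_einf_sup[-> _].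
    apply: le_trans (fatou _ (@mD R) mf _) _.
      by move=> m t _; rewrite lee_fin sqr_ge0.
    apply: le_trans (limn_einf_sup _) _; rewrite limn_esup_lim.
    apply: lime_le; first exact: is_cvg_esups.
    apply: nearW => m; apply: ge_ereal_sup => _ [j _ <-].
    have [_ i] := fs j.
    have -> : (\int[mu]_(t in D) f j t)%E = (circ (fun t => (u (k + j)%N t - u k t) ^+ 2))%:E.
      rewrite /circ /Rintegral fineK//; apply: integrable_fin_num; [exact: mD|exact: i].
    by rewrite lee_fin.
  have i : integ (fun t => (v t - u k t) ^+ 2).
    apply/integrableP; split; first exact/measurable_EFinP.
    under eq_integral do rewrite /= ger0_norm ?sqr_ge0//.
    by apply: le_lt_trans le _; rewrite ltry.
  split => //; rewrite -lee_fin /circ /Rintegral fineK//.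
  by apply: integrable_fin_num; [exact: mD|exact: i].
exists v; split=> [|k]; last by case: (key k).
have [i0 _] := key 0%N; have s0 : sqinteg (fun t => v t - u 0%N t).
  by split=> //; apply: measurable_funB => //; case: (us 0%N).
have [m i] := sqintegD s0 (us 0%N); split=> //.
by apply: eq_integ i => t _; rewrite subrK.
Qed.

End L2Complete.

(** * The space of square integrable vector functions *)

Section ReIm.
Variable R : realType.
Local Notation C := (R[i]).
Local Notation Re := (@complex.Re R).
Local Notation Im := (@complex.Im R).
Local Open Scope complex_scope.

Lemma cReD (x y : C) : Re (x + y) = Re x + Re y. Proof. by case: x y => ? ? []. Qed.
Lemma cImD (x y : C) : Im (x + y) = Im x + Im y. Proof. by case: x y => ? ? []. Qed.
Lemma cReM (x y : C) : Re (x * y) = Re x * Re y - Im x * Im y.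
Proof. by case: x y => ? ? []. Qed.
Lemma cImM (x y : C) : Im (x * y) = Re x * Im y + Im x * Re y.
Proof. by case: x y => ? ? []. Qed.
Lemma cReN (x : C) : Re (- x) = - Re x. Proof. by case: x. Qed.
Lemma cImN (x : C) : Im (- x) = - Im x. Proof. by case: x. Qed.
Lemma cRe_conj (x : C) : Re x^* = Re x. Proof. by case: x. Qed.
Lemma cIm_conj (x : C) : Im x^* = - Im x. Proof. by case: x. Qed.

Lemma cRe_sum (I : Type) (s : seq I) (P : pred I) (F : I -> C) :
  Re (\sum_(i <- s | P i) F i) = \sum_(i <- s | P i) Re (F i).
Proof. by elim/big_rec2: _ => // i y1 y2 _ <-; rewrite cReD. Qed.

Lemma cIm_sum (I : Type) (s : seq I) (P : pred I) (F : I -> C) :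
  Im (\sum_(i <- s | P i) F i) = \sum_(i <- s | P i) Im (F i).
Proof. by elim/big_rec2: _ => // i y1 y2 _ <-; rewrite cImD. Qed.

Lemma complexP (x y : C) : Re x = Re y -> Im x = Im y -> x = y.
Proof. by case: x y => ? ? [? ?] /= -> ->. Qed.

Definition rdot n (v w : 'cV[C]_n) : R :=
  \sum_i (Re (v i 0) * Re (w i 0) + Im (v i 0) * Im (w i 0)).

Definition hdot n (v w : 'cV[C]_n) : C := \sum_i v i 0 * (w i 0)^*.

Lemma Re_hdot n (v w : 'cV[C]_n) : Re (hdot v w) = rdot v w.
Proof.
rewrite cRe_sum; apply: eq_bigr => i _.
by rewrite cReM cRe_conj cIm_conj; ring.
Qed.

Lemma Im_hdot n (v w : 'cV[C]_n) : Im (hdot v w) = rdot v ('i *: w).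
Proof.
rewrite cIm_sum; apply: eq_bigr => i _.
by rewrite mxE cImM !cReM !cImM cRe_conj cIm_conj /=; ring.
Qed.

Lemma rdotC n (v w : 'cV[C]_n) : rdot v w = rdot w v.
Proof. by apply: eq_bigr => i _; ring. Qed.

Lemma rdotDl n (u v w : 'cV[C]_n) : rdot (u + v) w = rdot u w + rdot v w.
Proof.
by rewrite -big_split; apply: eq_bigr => i _; rewrite mxE cReD cImD /=; ring.
Qed.

Lemma rdotZl n (r : R) (v w : 'cV[C]_n) : rdot (r%:C *: v) w = r * rdot v w.
Proof.
by rewrite mulr_sumr; apply: eq_bigr => i _; rewrite mxE cReM cImM /=; ring.
Qed.

Lemma rdot_unimod n (c : C) (v w : 'cV[C]_n) : cabs2 c = 1 ->
  rdot (c *: v) (c *: w) = rdot v w.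
Proof.
move=> c1; apply: eq_bigr => i _; rewrite !mxE !cReM !cImM.
rewrite -[RHS]mul1r -c1 /cabs2; ring.
Qed.

Lemma rdotxx n (v : 'cV[C]_n) : rdot v v = vnorm2 v.
Proof. by apply: eq_bigr => i _; rewrite /cabs2 !expr2. Qed.

Lemma cabs2_ge0 (c : C) : 0 <= cabs2 c.
Proof. by rewrite addr_ge0// sqr_ge0. Qed.

Lemma vnorm2_ge0 n (v : 'cV[C]_n) : 0 <= vnorm2 v.
Proof. by apply: sumr_ge0 => i _; exact: cabs2_ge0. Qed.

Lemma cabs2_le_vnorm2 n (v : 'cV[C]_n) i : cabs2 (v i 0) <= vnorm2 v.
Proof.
by rewrite /vnorm2 (bigD1 i) //= lerDl sumr_ge0// => j _; exact: cabs2_ge0.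
Qed.

Lemma hdot_delta n (v : 'cV[C]_n) (c : C) i :
  hdot v (c *: delta_mx i 0) = v i 0 * c^*.
Proof.
rewrite /hdot (bigD1 i) //= big1 ?addr0.
  by rewrite !mxE !eqxx mulr1.
move=> j ji; rewrite !mxE (negbTE ji) andFb mulr0 [X in _ * X](_ : _ = 0) ?mulr0//.
by apply: complexP; rewrite /= ?oppr0.
Qed.

End ReIm.

Section L2Space.
Variables (R : realType) (n : nat).
Local Notation C := (R[i]).
Local Notation Re := (@complex.Re R).
Local Notation Im := (@complex.Im R).
Local Notation mu := (@lebesgue_measure R).
Local Notation D := (@Tdom R).
Local Open Scope complex_scope.

Lemma L2P (f : R -> 'cV[C]_n) :
  L2 f <-> forall i, sqinteg (fun t => Re (f t i 0)) /\ sqinteg (fun t => Im (f t i 0)).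
Proof.
split=> [[mf fi] i|H].
  have [m1 m2] := mf i 0; split; split=> //.
    apply: (le_integ (g := fun t => vnorm2 (f t))) fi; first exact: measurable_funX.
    move=> t _; rewrite ger0_norm ?sqr_ge0//.
    by apply: le_trans (cabs2_le_vnorm2 (f t) i); rewrite lerDl sqr_ge0.
  apply: (le_integ (g := fun t => vnorm2 (f t))) fi; first exact: measurable_funX.
  move=> t _; rewrite ger0_norm ?sqr_ge0//.
  by apply: le_trans (cabs2_le_vnorm2 (f t) i); rewrite lerDr sqr_ge0.
split=> [i j|]; first by rewrite ord1; case: (H i) => -[? _] [? _].
apply: (@integ_sum R _ _ (fun i t => cabs2 (f t i 0))) => i.
by case: (H i) => -[_ i1] [_ i2]; apply: integD.
Qed.

Definition L2_pred : {pred (R -> 'cV[C]_n)} := fun f => `[< L2 f >].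

Lemma L2_submod_closed : submod_closed L2_pred.
Proof.
split=> [|c f g].
  have z : sqinteg (fun _ : R => 0 : R).
    split; first exact: measurable_cst.
    by apply: eq_integ (integ_cst 0) => t _; rewrite expr0n.
  apply/asboolP/L2P => i; split.
    by move: z; congr sqinteg; apply/funext => t; rewrite mxE.
  by move: z; congr sqinteg; apply/funext => t; rewrite mxE.
move=> /asboolP/L2P fP /asboolP/L2P gP; apply/asboolP/L2P => i.
have [f1 f2] := fP i; have [g1 g2] := gP i; split.
  have := sqintegD (sqintegB (sqintegZ (Re c) f1) (sqintegZ (Im c) f2)) g1.
  by congr sqinteg; apply/funext => t; rewrite !mxE cReD cReM.
have := sqintegD (sqintegD (sqintegZ (Re c) f2) (sqintegZ (Im c) f1)) g2.
by congr sqinteg; apply/funext => t; rewrite !mxE cImD cImM.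
Qed.

HB.instance Definition _ :=
  GRing.isSubmodClosed.Build C (R -> 'cV[C]_n) L2_pred L2_submod_closed.

(** Functions rather than classes: null functions stay distinct from 0, so [ip] is only
    semidefinite. *)
Record L2space := L2Space { L2fun :> R -> 'cV[C]_n; L2funP : L2fun \in L2_pred }.
HB.instance Definition _ := [isSub for L2fun].
HB.instance Definition _ := [Choice of L2space by <:].
HB.instance Definition _ := [SubChoice_isSubLmodule of L2space by <:].

Definition toL2 (f : R -> 'cV[C]_n) (Hf : L2 f) : L2space :=
  L2Space (introT (asboolP _) Hf : f \in L2_pred).

Lemma L2fun_L2 (f : L2space) : L2 f.
Proof. by case: f => f /= /asboolP. Qed.

Lemma L2funD (f g : L2space) t : (f + g) t = f t + g t. Proof. by []. Qed.
Lemma L2funB (f g : L2space) t : (f - g) t = f t - g t. Proof. by []. Qed.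
Lemma L2funZ c (f : L2space) t : (c *: f) t = c *: f t. Proof. by []. Qed.
Definition ip (f g : L2space) : R := circ (fun t => rdot (f t) (g t)).

Lemma integ_rdot (f g : L2space) : integ (fun t => rdot (f t) (g t)).
Proof.
apply: (@integ_sum R _ _ (fun i t => Re (f t i 0) * Re (g t i 0) + Im (f t i 0) * Im (g t i 0))).
move=> i; have [f1 f2] := (L2P f).1 (L2fun_L2 f) i.
have [g1 g2] := (L2P g).1 (L2fun_L2 g) i.
by apply: integD; exact: sqintegM.
Qed.

Lemma ip_semi_inner : semi_inner ip.
Proof.
split.
- move=> f g h; rewrite -circD; [|exact: integ_rdot..].
  by apply: eq_circ => t _; rewrite -rdotDl.
- by move=> f g; apply: eq_circ => t _; rewrite rdotC.
- move=> r f g; rewrite -circZ; last exact: integ_rdot.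
  by apply: eq_circ => t _; rewrite -rdotZl.
- move=> f g; apply: eq_circ => t _; apply: rdot_unimod.
  by rewrite /cabs2 /= expr0n expr1n add0r.
- by move=> f; apply: circ_ge0 => t _; rewrite rdotxx vnorm2_ge0.
Qed.

Lemma ipxx (f : L2space) : ip f f = circ (fun t => vnorm2 (f t)).
Proof. by apply: eq_circ => t _; exact: rdotxx. Qed.

Lemma l2normE (f : L2space) : l2norm f = Num.sqrt (ip f f).
Proof. by rewrite ipxx. Qed.

Lemma ipxx_sum (f : L2space) : ip f f =
  \sum_i (circ (fun t => Re (f t i 0) ^+ 2) + circ (fun t => Im (f t i 0) ^+ 2)).
Proof.
have fP := (L2P f).1 (L2fun_L2 f).
rewrite ipxx circ_sum => [|i]; last first.
  by case: (fP i) => -[_ i1] [_ i2]; apply: integD.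
by apply: eq_bigr => i _; case: (fP i) => -[_ i1] [_ i2]; rewrite -circD.
Qed.

Lemma circ_ReIm_le (f : L2space) i :
  circ (fun t => Re (f t i 0) ^+ 2) <= ip f f /\
  circ (fun t => Im (f t i 0) ^+ 2) <= ip f f.
Proof.
have h0 g : 0 <= circ (fun t : R => g t ^+ 2).
  by apply: circ_ge0 => t _; exact: sqr_ge0.
rewrite ipxx_sum (bigD1 i) //=; set s := \sum_(j < n | _) _.
have s0 : 0 <= s by apply: sumr_ge0 => j _; rewrite addr_ge0.
have := h0 (fun t => Re (f t i 0)); have := h0 (fun t => Im (f t i 0)).
by move=> h1 h2; split; lra.
Qed.

Lemma ip_complete : complete_for ip (fun=> True).
Proof.
move=> u K _ uK.
have uP k := (L2P (u k)).1 (L2fun_L2 (u k)).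
have comp k i : circ (fun t => (Re (u k.+1 t i 0) - Re (u k t i 0)) ^+ 2) <= K * quarter R k
  /\ circ (fun t => (Im (u k.+1 t i 0) - Im (u k t i 0)) ^+ 2) <= K * quarter R k.
  have [h1 h2] := circ_ReIm_le (u k.+1 - u k) i; split.
    apply: le_trans (le_trans h1 (uK k)); rewrite le_eqVlt; apply/orP; left; apply/eqP.
    by apply: eq_circ => t _; rewrite L2funB !mxE cReD cReN.
  apply: le_trans (le_trans h2 (uK k)); rewrite le_eqVlt; apply/orP; left; apply/eqP.
  by apply: eq_circ => t _; rewrite L2funB !mxE cImD cImN.
have Hr i := sqinteg_complete (fun k => (uP k i).1) (fun k => (comp k i).1).
have Hi i := sqinteg_complete (fun k => (uP k i).2) (fun k => (comp k i).2).
have [vr vrP] := choice Hr; have [vi viP] := choice Hi.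
pose v t : 'cV[C]_n := \col_i Complex (vr i t) (vi i t).
have vL : L2 v.
  apply/L2P => i; have [h1 _] := vrP i; have [h2 _] := viP i; split.
    by move: h1; congr sqinteg; apply/funext => t; rewrite mxE.
  by move: h2; congr sqinteg; apply/funext => t; rewrite mxE.
exists (toL2 vL), (\sum_(i < n) (4 * K + 4 * K)); split=> // k.
rewrite ipxx_sum mulr_suml; apply: ler_sum => i _; rewrite mulrDl; apply: lerD.
  have [_ h] := vrP i; apply: le_trans (h k); rewrite le_eqVlt; apply/orP; left; apply/eqP.
  by apply: eq_circ => t _; rewrite L2funB !mxE cReD cReN.
have [_ h] := viP i; apply: le_trans (h k); rewrite le_eqVlt; apply/orP; left; apply/eqP.
by apply: eq_circ => t _; rewrite L2funB !mxE cImD cImN.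
Qed.

Lemma cform_ip (f g : L2space) : cform ip f g = cint (fun t => hdot (f t) (g t)).
Proof.
apply: complexP => /=; apply: eq_circ => t _; first by rewrite Re_hdot.
by rewrite Im_hdot.
Qed.

End L2Space.

(** * Exponentials: orthogonality and uniqueness of coefficients *)

Section Exponentials.
Variable R : realType.
Local Notation C := (R[i]).
Local Notation Re := (@complex.Re R).
Local Notation Im := (@complex.Im R).
Local Notation mu := (@lebesgue_measure R).
Local Notation D := (@Tdom R).
Local Open Scope complex_scope.

Lemma cos_2pi_int (j : int) : cos (2 * pi * j%:~R) = 1 :> R.
Proof.
have cn (k : nat) : cos (2 * pi * k%:R) = 1 :> R.
  by rewrite -[RHS](@cos0 R) -[RHS](periodicn (@cosD2pi R) k) add0r;
     congr cos; rewrite -mulr_natr -mulr_natr; ring.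
case: j => k; first exact: cn.
by rewrite NegzE rmorphN mulrN cosN; exact: cn.
Qed.

Lemma sin_2pi_int (j : int) : sin (2 * pi * j%:~R) = 0 :> R.
Proof.
apply/eqP; rewrite -sqrf_eq0 sin2cos2 cos_2pi_int expr1n subrr//.
Qed.

Lemma circ_FTC (F f : R -> R) : (forall t : R, is_derive t (1 : R) F (f t)) -> continuous f ->
  circ f = F 1 - F 0.
Proof.
move=> dF cf; have dFx (t : R) : derivable F t 1 by case: (dF t).
have cF : continuous F.
  by move=> t; apply: differentiable_continuous; exact/derivable1_diffP.
rewrite /circ /Rintegral (@continuous_FTC2 _ f F 0 1)//=.
- exact: continuous_subspaceT.
- split=> //.
    exact: cvg_at_right_filter (cF 0).
  exact: cvg_at_left_filter (cF 1).
- by move=> t _; rewrite derive1E derive_val.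
Qed.

Lemma circ_cs j : circ (@cs R j) = (j == 0)%:R.
Proof.
have [->|j0] := eqVneq j 0.
  by rewrite -[RHS]circ_cst; apply: eq_circ => t _; rewrite cs0.
pose w : R := 2 * pi * j%:~R.
have w0 : w != 0 by rewrite !mulf_neq0 ?intr_eq0// gt_eqF// pi_gt0.
have dF (t : R) : is_derive t (1 : R) (fun t => w^-1 * sin (w * t)) (cs j t).
  apply: is_derive_eq; rewrite /GRing.scale /= /cs -/w.
  by rewrite !(mulr1, mulr0, add0r, addr0); field.
rewrite (circ_FTC dF); first by rewrite mulr1 mulr0 sin0 sin_2pi_int mulr0 subrr.
move=> t; apply: continuous_comp; last exact: continuous_cos.
by apply: continuousM => //; exact: cvg_cst.
Qed.

Lemma circ_sn j : circ (@sn R j) = 0.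
Proof.
have [->|j0] := eqVneq j 0.
  by rewrite -[RHS](circ_cst 0); apply: eq_circ => t _; rewrite sn0.
pose w : R := 2 * pi * j%:~R.
have w0 : w != 0 by rewrite !mulf_neq0 ?intr_eq0// gt_eqF// pi_gt0.
have dF (t : R) : is_derive t (1 : R) (fun t => - w^-1 * cos (w * t)) (sn j t).
  apply: is_derive_eq; rewrite /GRing.scale /= /sn -/w.
  by rewrite !(mulr1, mulr0, add0r, addr0); field.
rewrite (circ_FTC dF); first by rewrite mulr1 mulr0 cos0 cos_2pi_int subrr.
move=> t; apply: continuous_comp; last exact: continuous_sin.
by apply: continuousM => //; exact: cvg_cst.
Qed.

Definition zt (j : int) (t : R) : C := Complex (cs j t) (sn j t).

Lemma ztD j k t : zt (j + k) t = zt j t * zt k t.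
Proof.
by apply: complexP; rewrite ?cReM ?cImM /= ?csD ?snD //; ring.
Qed.

Lemma zt0 t : zt 0 t = 1.
Proof. by apply: complexP; rewrite /= ?cs0 ?sn0. Qed.

Lemma ztN j t : zt (- j) t = (zt j t)^*.
Proof. by apply: complexP; rewrite /= ?csN ?snN. Qed.

Lemma cabs2_zt j t : cabs2 (zt j t) = 1.
Proof. by rewrite /cabs2 /= cos2Dsin2. Qed.

(** The conditions at [j] and at [-j] together separate the sine and cosine coefficients of the real
    part from those of the imaginary part. *)
Lemma complex_fourier_unique (phi : R -> C) :
  integ (fun t => Re (phi t)) -> integ (fun t => Im (phi t)) ->
  (forall j, cint (fun t => phi t * cexpm j t) = 0) ->
  {ae mu, forall t, D t -> phi t = 0}.
Proof.
move=> ri ii H.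
have ic (f : R -> R) j : integ f -> integ (fun t => f t * cs j t).
  by move=> fi; apply: (@integM _ _ _ 1) => //; [exact: meas_cs|move=> t _; exact: cs_bound].
have is_ (f : R -> R) j : integ f -> integ (fun t => f t * sn j t).
  by move=> fi; apply: (@integM _ _ _ 1) => //; [exact: meas_sn|move=> t _; exact: sn_bound].
have E j : circ (fun t => Re (phi t) * cs j t) + circ (fun t => Im (phi t) * sn j t) = 0 /\
   circ (fun t => Im (phi t) * cs j t) - circ (fun t => Re (phi t) * sn j t) = 0.
  have := H j; rewrite /cint => -[h1 h2]; split.
    rewrite -[RHS]h1 -circD; [|exact: ic|exact: is_].
    by apply: eq_circ => t _; rewrite cReM /= -/(cs j t) -/(sn j t); ring.
  rewrite -[RHS]h2 -circB; [|exact: ic|exact: is_].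
  by apply: eq_circ => t _; rewrite cImM /= -/(cs j t) -/(sn j t); ring.
have EN (j : int) (f : R -> R) : integ f -> circ (fun t => f t * cs (- j) t) = circ (fun t => f t * cs j t) /\
    circ (fun t => f t * sn (- j) t) = - circ (fun t => f t * sn j t).
  move=> fi; split; first by apply: eq_circ => t _; rewrite csN.
  rewrite -circN; last exact: is_.
  by apply: eq_circ => t _; rewrite snN mulrN.
have r0 : {ae mu, forall t, D t -> Re (phi t) = 0}.
  apply: fourier_unique => // j.
    by have := (E j).1; have := (E (- j)).1; rewrite (EN j _ ri).1 (EN j _ ii).2; lra.
  by have := (E j).2; have := (E (- j)).2; rewrite (EN j _ ri).2 (EN j _ ii).1; lra.
have i0 : {ae mu, forall t, D t -> Im (phi t) = 0}.
  apply: fourier_unique => // j.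
    by have := (E j).2; have := (E (- j)).2; rewrite (EN j _ ri).2 (EN j _ ii).1; lra.
  by have := (E j).1; have := (E (- j)).1; rewrite (EN j _ ri).1 (EN j _ ii).2; lra.
apply: aeS (aeI r0 i0) => t [h1 h2] Dt; apply: complexP; [exact: h1|exact: h2].
Qed.

End Exponentials.

(** * Multiplication by bounded matrix functions and by powers of z *)

Section Multiplication.
Variables (R : realType) (n : nat).
Local Notation C := (R[i]).
Local Notation Re := (@complex.Re R).
Local Notation Im := (@complex.Im R).
Local Notation mu := (@lebesgue_measure R).
Local Notation D := (@Tdom R).
Local Notation V := (L2space R n).
Local Open Scope complex_scope.

Lemma cabs2D (x y : C) : cabs2 (x + y) <= 2 * cabs2 x + 2 * cabs2 y.
Proof.
rewrite /cabs2 cReD cImD; have := sqr_ge0 (Re x - Re y).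
by have := sqr_ge0 (Im x - Im y); nra.
Qed.

Lemma cabs2M (x y : C) : cabs2 (x * y) = cabs2 x * cabs2 y.
Proof. by rewrite /cabs2 cReM cImM; ring. Qed.

(** Only the existence of a constant matters, so iterating [cabs2D] is enough. *)
Lemma cabs2_sum_le (I : Type) (s : seq I) (F : I -> C) :
  cabs2 (\sum_(i <- s) F i) <= 2 ^+ size s * \sum_(i <- s) cabs2 (F i).
Proof.
elim: s => [|i s IH].
  by rewrite !big_nil /cabs2 /= expr0n addr0 mulr0.
rewrite !big_cons /=; apply: le_trans (cabs2D _ _) _; rewrite exprS.
have h : 1 <= 2 ^+ size s :> R by rewrite exprn_ege1// ler1n.
have := cabs2_ge0 (F i); move: IH h; set a := cabs2 (F i); set q := 2 ^+ _.
by set S := \sum_(j <- s) _; nra.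
Qed.

Lemma Linf_vnorm2 (F : R -> 'M[C]_n) : Linf F -> exists K : R, 0 <= K /\
  {ae mu, forall t, D t -> forall v, vnorm2 (F t *m v) <= K * vnorm2 v}.
Proof.
move=> [_ [M FM]]; exists (\sum_(i < n) (2 ^+ size (index_enum 'I_n) * `|M|)).
split; first by apply: sumr_ge0 => i _; rewrite mulr_ge0// exprn_ge0.
apply: aeS FM => t h Dt v; rewrite mulr_suml; apply: ler_sum => i _.
rewrite mxE; apply: le_trans (cabs2_sum_le _ _) _; rewrite -mulrA.
apply: ler_wpM2l; first by rewrite exprn_ge0.
rewrite mulr_sumr; apply: ler_sum => j _; rewrite cabs2M.
apply: ler_wpM2r; first exact: cabs2_ge0.
by apply: le_trans (h Dt i j) _; exact: ler_norm.
Qed.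

Lemma L2_mul (F : R -> 'M[C]_n) (f : R -> 'cV[C]_n) : Linf F -> L2 f ->
  L2 (fun t => F t *m f t).
Proof.
move=> FL [mf fi]; have [K [K0 FK]] := Linf_vnorm2 FL; have [mF _] := FL.
have m : mx_measurable (fun t => F t *m f t).
  move=> i j; rewrite ord1; split.
    have -> : (fun t => Re ((F t *m f t) i 0)) = (fun t =>
       \sum_(k < n) (Re (F t i k) * Re (f t k 0) - Im (F t i k) * Im (f t k 0))).
      by apply/funext => t; rewrite mxE cRe_sum; apply: eq_bigr => k _; rewrite cReM.
    apply: measurable_sum => k; have [? ?] := mF i k; have [? ?] := mf k 0.
    by apply: measurable_funB; exact: measurable_funM.
  have -> : (fun t => Im ((F t *m f t) i 0)) = (fun t =>
     \sum_(k < n) (Re (F t i k) * Im (f t k 0) + Im (F t i k) * Re (f t k 0))).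
    by apply/funext => t; rewrite mxE cIm_sum; apply: eq_bigr => k _; rewrite cImM.
  apply: measurable_sum => k; have [? ?] := mF i k; have [? ?] := mf k 0.
  by apply: measurable_funD; exact: measurable_funM.
split=> //; apply: (@ae_le_integ _ _ (fun t => K * vnorm2 (f t))).
- apply: measurable_sum => i; have [m1 m2] := m i 0.
  by apply: measurable_funD; exact: measurable_funX.
- apply: aeS FK => t h Dt; rewrite ger0_norm ?vnorm2_ge0//; exact: h.
- exact: integZ.
Qed.

Definition Mul (F : R -> 'M[C]_n) (FL : Linf F) (f : V) : V :=
  toL2 (L2_mul FL (L2fun_L2 f)).

Lemma L2space_eq (f g : V) : (forall t, f t = g t) -> f = g.
Proof. by move=> fg; apply: val_inj; apply/funext. Qed.

Lemma MulE F (FL : Linf F) f t : Mul FL f t = F t *m f t. Proof. by []. Qed.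

Lemma Mul_is_linear F (FL : Linf F) : linear (Mul FL).
Proof.
move=> c f g; apply: L2space_eq => t.
by rewrite MulE !L2funD !L2funZ !MulE mulmxDr -scalemxAr.
Qed.

HB.instance Definition _ F (FL : Linf F) :=
  GRing.isLinear.Build C V V *:%R (Mul FL) (Mul_is_linear FL).

Lemma adjmxK m p (A : 'M[C]_(m, p)) : adjmx (adjmx A) = A.
Proof. by apply/matrixP => i j; rewrite !mxE conjcK. Qed.

Lemma adjmxM m p q (A : 'M[C]_(m, p)) (B : 'M[C]_(p, q)) :
  adjmx (A *m B) = adjmx B *m adjmx A.
Proof. by rewrite /adjmx map_mxM trmx_mul. Qed.

Lemma hdotE (v w : 'cV[C]_n) : hdot v w = (adjmx w *m v) 0 0.
Proof. by rewrite mxE; apply: eq_bigr => i _; rewrite !mxE mulrC. Qed.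

Lemma hdot_adj (A : 'M[C]_n) v w : hdot (A *m v) w = hdot v (adjmx A *m w).
Proof. by rewrite !hdotE adjmxM adjmxK mulmxA. Qed.

Lemma rdot_adj (A : 'M[C]_n) v w : rdot (A *m v) w = rdot v (adjmx A *m w).
Proof. by rewrite -!Re_hdot hdot_adj. Qed.

Lemma Linf_adj (F : R -> 'M[C]_n) : Linf F -> Linf (adjfun F).
Proof.
move=> [mF [M FM]]; split.
  move=> i j; have [m1 m2] := mF j i; split.
    by move: m1; congr measurable_fun; apply/funext => t; rewrite !mxE cRe_conj.
  have m0 : measurable_fun D (fun _ : R => 0 : R) by exact: measurable_cst.
  have := measurable_funB m0 m2; congr measurable_fun.
  by apply/funext => t /=; rewrite !mxE cIm_conj sub0r.
exists M; apply: aeS FM => t h Dt i j; apply: le_trans (h Dt j i).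
by rewrite !mxE /cabs2 cRe_conj cIm_conj sqrrN.
Qed.

Lemma Mul_adj F (FL : Linf F) f g : ip (Mul FL f) g = ip f (Mul (Linf_adj FL) g).
Proof. by apply: eq_circ => t _; exact: rdot_adj. Qed.

Lemma Mul_unitary_ip F (FL : Linf F) (f : V) :
  {ae mu, forall t, D t -> adjmx (F t) *m F t = 1%:M} ->
  ip (Mul FL f) (Mul FL f) = ip f f.
Proof.
move=> Fu; rewrite !ipxx; apply: ae_eq_circ.
- by apply: integ_meas; have [] := L2fun_L2 (Mul FL f).
- by apply: integ_meas; have [] := L2fun_L2 f.
apply: aeS Fu => t h Dt; rewrite -!rdotxx MulE rdot_adj mulmxA h//.
by rewrite mul1mx.
Qed.

Lemma L2_zmul j (f : R -> 'cV[C]_n) : L2 f -> L2 (fun t => zt j t *: f t).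
Proof.
move=> Lf.
(* Multiplication by z^j is multiplication by a bounded scalar matrix. *)
have FL : Linf (fun t => (zt j t)%:M : 'M[C]_n).
  split.
    move=> i k; have [->|ik] := eqVneq i k.
      split.
        by have := @meas_cs R j; congr measurable_fun; apply/funext => t; rewrite mxE eqxx.
      by have := @meas_sn R j; congr measurable_fun; apply/funext => t; rewrite mxE eqxx.
    by split; have := @measurable_cst _ _ (measurableTypeR R) R D 0; congr measurable_fun;
       apply/funext => t; rewrite mxE (negbTE ik).
  exists 1; apply: aeW => t Dt i k; rewrite mxE; case: (i == k).
    by rewrite mulr1n cabs2_zt.
  by rewrite mulr0n /cabs2 /= expr0n addr0.
have := L2_mul FL Lf; congr L2; apply/funext => t.
by rewrite mul_scalar_mx.
Qed.

Definition zmul (j : int) (f : V) : V := toL2 (L2_zmul j (L2fun_L2 f)).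

Lemma zmulE j f t : zmul j f t = zt j t *: f t. Proof. by []. Qed.

Lemma zmul_is_linear j : linear (zmul j).
Proof.
move=> c f g; apply: L2space_eq => t.
by rewrite zmulE !L2funD !L2funZ !zmulE scalerDr !scalerA mulrC.
Qed.

HB.instance Definition _ j :=
  GRing.isLinear.Build C V V *:%R (zmul j) (zmul_is_linear j).

Lemma zmulD j k f : zmul (j + k) f = zmul j (zmul k f).
Proof. by apply: L2space_eq => t; rewrite !zmulE scalerA ztD. Qed.

Lemma zmul0 f : zmul 0 f = f.
Proof. by apply: L2space_eq => t; rewrite !zmulE zt0 scale1r. Qed.

Lemma zmulK j : cancel (zmul j) (zmul (- j)).
Proof. by move=> f; rewrite -zmulD addNr zmul0. Qed.

Lemma zmulNK j : cancel (zmul (- j)) (zmul j).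
Proof. by move=> f; rewrite -zmulD addrN zmul0. Qed.

Lemma ip_zmul j f g : ip (zmul j f) (zmul j g) = ip f g.
Proof. by apply: eq_circ => t _; apply: rdot_unimod; exact: cabs2_zt. Qed.

Lemma cform_zmul j f g : cform (@ip R n) (zmul j f) (zmul j g) = cform (@ip R n) f g.
Proof. by rewrite /cform -linearZ /= !ip_zmul. Qed.

Lemma Mul_zmul F (FL : Linf F) j f : Mul FL (zmul j f) = zmul j (Mul FL f).
Proof. by apply: L2space_eq => t; rewrite zmulE !MulE zmulE -scalemxAr. Qed.

End Multiplication.

(** * Hardy space projections *)

Section HardyProjections.
Variables (R : realType) (n : nat).
Local Notation C := (R[i]).
Local Notation Re := (@complex.Re R).
Local Notation Im := (@complex.Im R).
Local Notation mu := (@lebesgue_measure R).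
Local Notation D := (@Tdom R).
Local Notation V := (L2space R n).
Local Notation ip := (@ip R n).
Local Open Scope complex_scope.

Let bP : semi_inner ip := @ip_semi_inner R n.

Lemma cintE (g : R -> C) :
  cint g = Complex (circ (fun t => Re (g t))) (circ (fun t => Im (g t))).
Proof. by []. Qed.

Lemma eq_cint (g h : R -> C) : (forall t, D t -> g t = h t) -> cint g = cint h.
Proof.
move=> gh; rewrite !cintE; congr Complex; apply: eq_circ => t Dt.
  by rewrite gh.
by rewrite gh.
Qed.

Lemma L2_eb (j : int) (i : 'I_n) : L2 (fun t => zt j t *: (delta_mx i 0 : 'cV[C]_n)).
Proof.
apply: L2_zmul; apply/L2P => k.
have c (r : R) : sqinteg (fun=> r) by split; [exact: measurable_cst|exact: integ_cst].
by split; exact: c.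
Qed.

Definition eb j i : V := toL2 (L2_eb j i).

Lemma ebE j i t : eb j i t = zt j t *: delta_mx i 0. Proof. by []. Qed.

Lemma zmul_eb k j i : zmul k (eb j i) = eb (k + j) i.
Proof. by apply: L2space_eq => t; rewrite zmulE /= scalerA ztD. Qed.

Definition coef (f : V) j i : C := cform ip f (eb j i).

Lemma coef_cform f j i : coef f j i = cform ip f (eb j i). Proof. by []. Qed.

Lemma coefE f j i : coef f j i = cint (fun t => f t i 0 * cexpm j t).
Proof.
rewrite /coef cform_ip; congr cint; apply/funext => t.
exact: hdot_delta.
Qed.

Lemma fourier_coef (f : V) j : fourier f j = \col_i coef f j i.
Proof. by apply/matrixP => i k; rewrite !mxE ord1 coefE. Qed.

Lemma coefD f g j i : coef (f + g) j i = coef f j i + coef g j i.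
Proof. exact: cformDl. Qed.

Lemma coefZ c f j i : coef (c *: f) j i = c * coef f j i.
Proof. exact: cformZl. Qed.

Lemma coefB f g j i : coef (f - g) j i = coef f j i - coef g j i.
Proof. by rewrite coefD -scaleN1r coefZ mulN1r. Qed.

Lemma coef_zmul k f j i : coef (zmul k f) j i = coef f (j - k) i.
Proof.
rewrite /coef; have -> : eb j i = zmul k (eb (j - k) i) by rewrite zmul_eb addrC subrK.
exact: cform_zmul.
Qed.

Lemma coef_eb j i k l : coef (eb j i) k l = ((j == k) && (i == l))%:R.
Proof.
rewrite coefE.
have [->|il] := eqVneq i l; last first.
  rewrite andbF (eq_cint (h := fun=> 0)) => [|t _]; last first.
    by rewrite !mxE [l == i]eq_sym (negbTE il) mulr0 mul0r.
  by apply: complexP; exact: circ0.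
rewrite (eq_cint (h := zt (j - k))) => [|t _]; last first.
  by rewrite /= !mxE !eqxx mulr1 ztD ztN.
by rewrite andbT cintE circ_cs circ_sn subr_eq0; case: (j == k).
Qed.

Lemma coef_null f j i : ip f f = 0 -> coef f j i = 0.
Proof. by move=> f0; apply/cform_eq0; rewrite !(si_null bP _ f0). Qed.

Lemma null_of_coef f : (forall j i, coef f j i = 0) -> ip f f = 0.
Proof.
move=> H; have fP := (L2P f).1 (L2fun_L2 f).
have one : sqinteg (fun _ : R => 1 : R) by split; [exact: measurable_cst|exact: integ_cst].
have Hi i : {ae mu, forall t, D t -> f t i 0 = 0}.
  have [s1 s2] := fP i; apply: complex_fourier_unique.
  - by apply: eq_integ (sqintegM s1 one) => t _; rewrite mulr1.
  - by apply: eq_integ (sqintegM s2 one) => t _; rewrite mulr1.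
  - by move=> j; rewrite -coefE.
rewrite ipxx_sum big1// => i _; have [[m1 _] [m2 _]] := fP i.
have z : meas (fun _ : R => 0 : R) by exact: measurable_cst.
rewrite (ae_eq_circ _ z); [|exact: measurable_funX|]; last first.
  by apply: aeS (Hi i) => t h Dt; rewrite h//= expr0n.
rewrite (ae_eq_circ _ z); [|exact: measurable_funX|]; last first.
  by apply: aeS (Hi i) => t h Dt; rewrite h//= expr0n.
by rewrite circ0 addr0.
Qed.

Definition Hp (f : V) := forall j : int, j < 0 -> forall i, coef f j i = 0.
Definition Hm (f : V) := forall j : int, 0 <= j -> forall i, coef f j i = 0.

Lemma H2_Hp (f : V) : H2 f <-> Hp f.
Proof.
split=> [[_ H] j j0 i|H]; last first.
  by split=> [|j j0]; [exact: L2fun_L2|apply/matrixP => i k; rewrite fourier_coef !mxE H].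
by have /matrixP/(_ i 0) := H j j0; rewrite fourier_coef !mxE.
Qed.

Lemma H2minus_Hm (f : V) : H2minus f <-> Hm f.
Proof.
split=> [[_ H] j j0 i|H]; last first.
  by split=> [|j j0]; [exact: L2fun_L2|apply/matrixP => i k; rewrite fourier_coef !mxE H].
by have /matrixP/(_ i 0) := H j j0; rewrite fourier_coef !mxE.
Qed.

Lemma HpD f g : Hp f -> Hp g -> Hp (f + g).
Proof. by move=> hf hg j j0 i; rewrite coefD hf// hg// addr0. Qed.
Lemma HmD f g : Hm f -> Hm g -> Hm (f + g).
Proof. by move=> hf hg j j0 i; rewrite coefD hf// hg// addr0. Qed.
Lemma HpZ c f : Hp f -> Hp (c *: f).
Proof. by move=> hf j j0 i; rewrite coefZ hf// mulr0. Qed.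
Lemma HmZ c f : Hm f -> Hm (c *: f).
Proof. by move=> hf j j0 i; rewrite coefZ hf// mulr0. Qed.
Lemma HpB f g : Hp f -> Hp g -> Hp (f - g).
Proof. by move=> hf hg; apply: HpD => //; rewrite -scaleN1r; exact: HpZ. Qed.
Lemma HmB f g : Hm f -> Hm g -> Hm (f - g).
Proof. by move=> hf hg; apply: HmD => //; rewrite -scaleN1r; exact: HmZ. Qed.
Lemma Hm0 : Hm 0.
Proof. by move=> j _ i; rewrite -[0](scale0r 0) coefZ mul0r. Qed.
Lemma Hp0 : Hp 0.
Proof. by move=> j _ i; rewrite -[0](scale0r 0) coefZ mul0r. Qed.

Lemma Hp_zmul k f : 0 <= k -> Hp f -> Hp (zmul k f).
Proof. by move=> k0 hf j j0 i; rewrite coef_zmul hf//; lra. Qed.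

Lemma Hp_eb j i : 0 <= j -> Hp (eb j i).
Proof.
move=> j0 k k0 l; rewrite coef_eb.
by case: eqVneq => // jk; move: k0; rewrite -jk ltNge j0.
Qed.

Lemma Hm_eb j i : j < 0 -> Hm (eb j i).
Proof.
move=> j0 k k0 l; rewrite coef_eb.
by case: eqVneq => // jk; move: k0; rewrite -jk leNgt j0.
Qed.

(** Each coefficient is a bounded functional, so its vanishing passes to limits. *)
Lemma coef_complete (S : int -> Prop) :
  complete_for ip (fun f => forall j, S j -> forall i, coef f j i = 0).
Proof.
move=> u K Su uK; have [x [K' [_ xP]]] := @ip_complete R n u K (fun=> I) uK.
exists x, K'; split=> // j Sj i.
have z s : (forall k, ip (u k) s = 0) -> ip x s = 0.
  move=> us; apply/eqP; rewrite -sqrf_eq0; apply/eqP/le_anti; rewrite sqr_ge0 andbT.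
  apply: (@quarter_squeeze _ (K' * ip s s)) => k.
  have -> : ip x s = ip (x - u k) s by rewrite (siBl bP) us subr0.
  apply: le_trans (cauchy_schwarz bP _ _) _; rewrite mulrAC.
  by apply: ler_wpM2r => //; exact: si_ge0.
have H k : ip (u k) (eb j i) = 0 /\ ip (u k) ('i *: eb j i) = 0.
  by apply/cform_eq0; exact: Su.
by apply/cform_eq0; rewrite (z _ (fun k => (H k).1)) (z _ (fun k => (H k).2)).
Qed.

Lemma Hm_subspace : real_subspace Hm.
Proof. by split=> [|r x y hx hy]; [exact: Hm0|apply: HmD => //; exact: HmZ]. Qed.

Lemma Pm_exists f : exists2 g, Hm g & forall h, Hm h -> ip (f - g) h = 0.
Proof. exact: (projection bP f Hm_subspace (coef_complete (S := fun j => 0 <= j))). Qed.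

(** A choice among candidates that agree almost everywhere, so linearity holds only modulo [sim].
    Defining [Pp] by subtraction keeps the splitting itself exact. *)
Definition Pm f : V := sval (cid2 (Pm_exists f)).
Definition Pp f : V := f - Pm f.

Lemma Pm_Hm f : Hm (Pm f). Proof. by rewrite /Pm; case: cid2. Qed.

Lemma Pp_orth f h : Hm h -> ip (Pp f) h = 0.
Proof. by rewrite /Pp /Pm; case: cid2 => /= g _ gP; exact: gP. Qed.

Lemma Pp_Hp f : Hp (Pp f).
Proof.
move=> j j0 i; apply/cform_eq0; split; apply: Pp_orth; last apply: HmZ; exact: Hm_eb.
Qed.

Lemma PmPp f : Pm f + Pp f = f. Proof. by rewrite addrC subrK. Qed.

Lemma PmE f : Pm f = f - Pp f. Proof. by rewrite /Pp subKr. Qed.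

Lemma HpHm_null f : Hp f -> Hm f -> ip f f = 0.
Proof.
move=> hp hm; apply: null_of_coef => j i.
by case: (ltP j 0) => j0; [exact: hp|exact: hm].
Qed.

(** For [f] in H^2 the vector [Pm f = f - Pp f] lies in both spaces, so it is null. *)
Lemma Hp_Hm_orth f g : Hp f -> Hm g -> ip f g = 0.
Proof.
move=> hf hg; rewrite -[f]PmPp (siDl bP) (Pp_orth _ hg) addr0.
apply: (si_null bP); apply: HpHm_null (Pm_Hm _).
have -> : Pm f = f - Pp f by rewrite /Pp opprB addrC subrK.
by apply: HpB => //; exact: Pp_Hp.
Qed.

(** Equality almost everywhere on the circle. *)
Definition sim (x y : V) := ip (x - y) (x - y) = 0.

Lemma sim_ipl x y z : sim x y -> ip x z = ip y z.
Proof. exact: si_null_congr. Qed.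
Lemma sim_ipr x y z : sim x y -> ip z x = ip z y.
Proof. by move=> h; rewrite !(siC bP z); exact: sim_ipl. Qed.

Lemma Pm_sim f h : Hm h -> Hp (f - h) -> sim (Pm f) h.
Proof.
move=> hm hp; apply: HpHm_null; last by apply: HmB => //; exact: Pm_Hm.
have -> : Pm f - h = (f - h) - Pp f.
  by rewrite /Pp opprB [RHS]addrC addrA subrK.
by apply: HpB => //; exact: Pp_Hp.
Qed.

Lemma Pp_sim f g : Hp g -> Hm (f - g) -> sim (Pp f) g.
Proof.
move=> hp hm; apply: HpHm_null; first by apply: HpB => //; exact: Pp_Hp.
have -> : Pp f - g = (f - g) - Pm f by rewrite /Pp addrAC.
by apply: HmB => //; exact: Pm_Hm.
Qed.

Lemma Pm_lin c f g : sim (Pm (c *: f + g)) (c *: Pm f + Pm g).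
Proof.
apply: Pm_sim; first by apply: HmD; [apply: HmZ|]; exact: Pm_Hm.
rewrite opprD addrACA -scalerBr; apply: HpD; [apply: HpZ|]; exact: Pp_Hp.
Qed.

Lemma Pp_lin c f g : sim (Pp (c *: f + g)) (c *: Pp f + Pp g).
Proof.
apply: Pp_sim; first by apply: HpD; [apply: HpZ|]; exact: Pp_Hp.
rewrite opprD addrACA -scalerBr /Pp !subKr.
by apply: HmD; [apply: HmZ|]; exact: Pm_Hm.
Qed.

Lemma PmD f g : sim (Pm (f + g)) (Pm f + Pm g).
Proof. by have := Pm_lin 1 f g; rewrite !scale1r. Qed.
Lemma PpD f g : sim (Pp (f + g)) (Pp f + Pp g).
Proof. by have := Pp_lin 1 f g; rewrite !scale1r. Qed.

Lemma PmZ c f : sim (Pm (c *: f)) (c *: Pm f).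
Proof.
apply: Pm_sim; first by apply: HmZ; exact: Pm_Hm.
by rewrite -scalerBr; apply: HpZ; exact: Pp_Hp.
Qed.

Lemma PpZ c f : sim (Pp (c *: f)) (c *: Pp f).
Proof.
apply: Pp_sim; first by apply: HpZ; exact: Pp_Hp.
by rewrite -scalerBr /Pp subKr; apply: HmZ; exact: Pm_Hm.
Qed.

Lemma Pm_Hp f : Hp f -> sim (Pm f) 0.
Proof. by move=> hf; apply: Pm_sim; [exact: Hm0|rewrite subr0]. Qed.
Lemma Pp_Hp_id f : Hp f -> sim (Pp f) f.
Proof. by move=> hf; apply: Pp_sim => //; rewrite subrr; exact: Hm0. Qed.
Lemma Pm_Hm_id f : Hm f -> sim (Pm f) f.
Proof. by move=> hf; apply: Pm_sim => //; rewrite subrr; exact: Hp0. Qed.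
Lemma Pp_Hm f : Hm f -> sim (Pp f) 0.
Proof. by move=> hf; apply: Pp_sim; [exact: Hp0|rewrite subr0]. Qed.

Lemma ip_split x y : ip x y = ip (Pm x) (Pm y) + ip (Pp x) (Pp y).
Proof.
rewrite -{1}[x]PmPp -{1}[y]PmPp (si_orthD bP)//; first exact: Pp_orth (Pm_Hm _).
exact: Pp_orth (Pm_Hm _).
Qed.

End HardyProjections.

(** * The form of a Hankel contraction *)

Opaque ip Pm Pp Mul zmul eb coef.

(** [2 |t| <= 2 sqrt (q A B) <= sqrt q (A + B) <= (1 + q) / 2 (A + B)], carried out with squares
    only. *)
Lemma quadratic_lower_bound (R : realType) (A B t q : R) : 0 <= A -> 0 <= B ->
  0 <= q <= 1 -> t ^+ 2 <= q * (A * B) -> (1 - q) / 2 * (A + B) <= A + B + 2 * t.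
Proof.
move=> A0 B0 /andP[q0 q1] h; rewrite leNgt; apply/negP => lt.
pose s := (1 + q) / 2 * (A + B).
have s0 : 0 <= s by rewrite mulr_ge0//; lra.
have ts : s < - (2 * t) by rewrite /s; lra.
have h1 : s ^+ 2 < (2 * t) ^+ 2.
  by rewrite -[X in _ < X]sqrrN ltr_pXn2r// nnegrE; lra.
have h2 : 4 * (A * B) <= (A + B) ^+ 2 by have := sqr_ge0 (A - B); nra.
have h3 : q <= ((1 + q) / 2) ^+ 2 by have := sqr_ge0 (1 - q); nra.
have h4 : q * (4 * (A * B)) <= ((1 + q) / 2) ^+ 2 * (A + B) ^+ 2.
  apply: ler_pM => //; by rewrite !mulr_ge0.
by move: h1; rewrite /s exprMn; lra.
Qed.

Section Form.
Variables (R : realType) (n : nat) (Phi : R -> 'M[R[i]]_n).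
Hypothesis PhiL : Linf Phi.
Local Notation C := (R[i]).
Local Notation V := (L2space R n).
Local Notation ip := (@ip R n).
Local Notation Phim := (Mul PhiL).
Local Notation Phis := (Mul (Linf_adj PhiL)).
Local Open Scope complex_scope.

Let bP : semi_inner ip := @ip_semi_inner R n.

Definition cross (x y : V) : R := ip (Phim (Pp x)) (Pm y).

Lemma cross_siml x x' y : sim (Pp x) x' -> cross x y = ip (Phim x') (Pm y).
Proof. by move=> h; rewrite /cross !Mul_adj; exact: sim_ipl. Qed.

Lemma cross_simr x y y' : sim (Pm y) y' -> cross x y = ip (Phim (Pp x)) y'.
Proof. exact: sim_ipr. Qed.

Lemma crossDl x y z : cross (x + y) z = cross x z + cross y z.
Proof. by rewrite (cross_siml _ (PpD x y)) linearD (siDl bP). Qed.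

Lemma crossDr x y z : cross z (x + y) = cross z x + cross z y.
Proof. by rewrite (cross_simr _ (PmD x y)) (siDr bP). Qed.

Lemma crossZl (r : R) x y : cross (r%:C *: x) y = r * cross x y.
Proof. by rewrite (cross_siml _ (PpZ _ x)) linearZ (siZl bP). Qed.

Lemma crossZr (r : R) x y : cross x (r%:C *: y) = r * cross x y.
Proof. by rewrite (cross_simr _ (PmZ _ y)) (siZr bP). Qed.

Lemma crossJ x y : cross ('i *: x) ('i *: y) = cross x y.
Proof.
rewrite (cross_siml _ (PpZ _ x)) linearZ (sim_ipr _ (PmZ _ y)).
exact: (siJ bP).
Qed.

(* The form of [1 + Gamma + Gamma^*], where [Gamma f = P_- (Phi f)] is the Hankel operator. *)
Definition hform (x y : V) : R := ip x y + cross x y + cross y x.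

Lemma ip_Phim_Hm f h : Hm h -> ip (Phim f) h = ip (Pm (Phim f)) h.
Proof.
by move=> hh; rewrite -{1}[Phim f]PmPp (siDl bP) (Pp_orth _ hh) addr0.
Qed.

Lemma hformxx x : hform x x = ip (Pp x) (Pp x) + ip (Pm x) (Pm x) + 2 * cross x x.
Proof.
rewrite /hform (ip_split x x); move: (cross x x) (ip (Pm x) _) (ip (Pp x) _) => p q r.
by ring.
Qed.

Lemma cross_le (q : R) x :
  ip (Pm (Phim (Pp x))) (Pm (Phim (Pp x))) <= q * ip (Pp x) (Pp x) ->
  cross x x ^+ 2 <= q * (ip (Pp x) (Pp x) * ip (Pm x) (Pm x)).
Proof.
move=> h; rewrite /cross (ip_Phim_Hm _ (Pm_Hm x)).
apply: le_trans (cauchy_schwarz bP _ _) _; rewrite mulrA.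
by apply: ler_wpM2r => //; exact: si_ge0.
Qed.

Opaque cross.

Lemma hform_coercive (q : R) x : 0 <= q <= 1 ->
  ip (Pm (Phim (Pp x))) (Pm (Phim (Pp x))) <= q * ip (Pp x) (Pp x) ->
  (1 - q) / 2 * ip x x <= hform x x.
Proof.
move=> q01 /cross_le h; rewrite (ip_split x x) [X in _ * X]addrC hformxx.
by apply: (@quadratic_lower_bound _ _ _ _ q) => //; exact: si_ge0.
Qed.

Section Contraction.
Hypothesis contr : forall f, Hp f -> ip (Pm (Phim f)) (Pm (Phim f)) <= ip f f.

Lemma hform_semi_inner : semi_inner hform.
Proof.
split.
- by move=> x y z; rewrite /hform (siDl bP) crossDl crossDr [X in X + _]addrACA [LHS]addrACA.
- by move=> x y; rewrite /hform [ip x y](siC bP) [LHS]addrAC.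
- by move=> r x y; rewrite /hform (siZl bP) crossZl crossZr !mulrDr.
- by move=> x y; rewrite /hform (siJ bP) !crossJ.
- move=> x; have := @hform_coercive 1 x; rewrite subrr mul0r mul0r mul1r.
  by apply; [rewrite ler01 lexx|apply: contr; exact: Pp_Hp].
Qed.

Lemma hform_le x : hform x x <= 2 * ip x x.
Proof.
have := @cross_le 1 x; rewrite !mul1r => /(_ (contr (Pp_Hp x))) h.
have A0 := si_ge0 bP (Pp x); have B0 := si_ge0 bP (Pm x).
(* The lower bound with [q = 1], applied to [- cross x x]. *)
have := @quadratic_lower_bound _ _ _ (- cross x x) 1 A0 B0 ltac:(lra) ltac:(by rewrite sqrrN mul1r).
rewrite hformxx (ip_split x x); move: (cross x x) (ip (Pm x) _) (ip (Pp x) _) => p q r.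
by lra.
Qed.

Lemma hform_Hm y h : Hm h -> hform y h = ip (y + Phim (Pp y)) h.
Proof.
move=> hh; rewrite /hform (siDl bP) (cross_simr _ (Pm_Hm_id hh)).
by rewrite (cross_siml _ (Pp_Hm hh)) linear0 (si0l bP) addr0.
Qed.

Lemma hform_Hp x f : Hp f -> hform x f = ip (x + Phis (Pm x)) f.
Proof.
move=> hf; rewrite /hform (siDl bP) (cross_simr _ (Pm_Hp hf)) (si0r bP) addr0.
by rewrite (cross_siml _ (Pp_Hp_id hf)) Mul_adj (siC bP f).
Qed.

Lemma hform_HmHm g h : Hm g -> Hm h -> hform g h = ip g h.
Proof.
move=> hg hh; rewrite hform_Hm// (siDl bP) Mul_adj (sim_ipl _ (Pp_Hm hg)).
by rewrite (si0l bP) addr0.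
Qed.

Lemma hform_HpHp f g : Hp f -> Hp g -> hform f g = ip f g.
Proof.
move=> hf hg; rewrite hform_Hp// (siDl bP) [ip (Phis _) _](siC bP) -Mul_adj.
by rewrite (sim_ipr _ (Pm_Hp hf)) (si0r bP) addr0.
Qed.

Lemma hform_HpHm f h : Hp f -> Hm h -> hform f h = ip (Phim f) h.
Proof.
move=> hf hh; rewrite hform_Hm// (siDl bP) (Hp_Hm_orth hf hh) add0r.
by rewrite !Mul_adj (sim_ipl _ (Pp_Hp_id hf)).
Qed.

(** Without a coefficient of index -1, z P_- x stays in H^2_-, so z commutes with both projections
    on such vectors; with multiplication by [Phi] it always commutes. *)
Lemma hform_zmul x y : (forall i, coef x (-1) i = 0) -> (forall i, coef y (-1) i = 0) ->
  hform (zmul 1 x) (zmul 1 y) = hform x y.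
Proof.
have PpE u : (forall i, coef u (-1) i = 0) ->
    Hp (zmul 1 (Pp u)) /\ Hm (zmul 1 (Pm u)).
  move=> u1; split; first by apply: Hp_zmul => //; exact: Pp_Hp.
  move=> j j0 i; rewrite coef_zmul; have [->|jn] := eqVneq j 0.
    by rewrite PmE sub0r coefB u1 Pp_Hp// subr0.
  by apply: Pm_Hm; move: j j0 jn => [[|k]|k].
have D u : zmul 1 u = zmul 1 (Pm u) + zmul 1 (Pp u) by rewrite -linearD PmPp.
have simp u : (forall i, coef u (-1) i = 0) ->
    sim (Pp (zmul 1 u)) (zmul 1 (Pp u)) /\ sim (Pm (zmul 1 u)) (zmul 1 (Pm u)).
  move=> /PpE[hp hm]; split.
    by apply: Pp_sim => //; rewrite D addrK.
  by apply: Pm_sim => //; rewrite D addrAC subrr add0r.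
have cr u v : (forall i, coef u (-1) i = 0) -> (forall i, coef v (-1) i = 0) ->
    cross (zmul 1 u) (zmul 1 v) = cross u v.
  move=> /simp[up um] /simp[vp vm]; rewrite (cross_siml _ up).
  transitivity (ip (Phim (zmul 1 (Pp u))) (zmul 1 (Pm v))); first exact: sim_ipr.
  by rewrite Mul_zmul; exact: ip_zmul.
by move=> x1 y1; rewrite /hform ip_zmul (cr _ _ x1 y1) (cr _ _ y1 x1).
Qed.

End Contraction.
End Form.

(** * Columns of the interpolant *)

Section Columns.
Variables (R : realType) (n : nat) (Phi : R -> 'M[R[i]]_n).
Hypothesis PhiL : Linf Phi.
Local Notation C := (R[i]).
Local Notation V := (L2space R n).
Local Notation ip := (@ip R n).
Local Notation Phim := (Mul PhiL).
Local Notation eb := (@eb R n).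
Local Notation hform := (hform PhiL).
Local Open Scope complex_scope.
Hypothesis contr : forall f, Hp f -> ip (Pm (Phim f)) (Pm (Phim f)) <= ip f f.
Variables (Kop : V -> V) (q : R).
Hypothesis q01 : 0 <= q < 1.
Hypothesis KL : forall c f g, Hp f -> Hp g -> Kop (c *: f + g) = c *: Kop f + Kop g.
Hypothesis KP : forall f, Hp f ->
  ip (Pm (Phim f) - Kop f) (Pm (Phim f) - Kop f) <= q * ip f f.
Hypothesis Knet : forall e : R, 0 < e -> exists N (g : nat -> V), forall f, Hp f ->
  ip f f <= 1 -> exists2 i, (i < N)%N & ip (Kop f - g i) (Kop f - g i) < e.

Let bP : semi_inner ip := @ip_semi_inner R n.
Let aP : semi_inner hform := hform_semi_inner contr.

(** Its kernel is the range of the restricted shift; the domain of that shift is the kernel of [ct]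
    after [zmul 1]. *)
Definition ct (x : V) : 'rV[C]_n := \row_i coef x 0 i.

Lemma ct_is_linear : linear ct.
Proof. by move=> c x y; apply/rowP => i; rewrite !mxE coefD coefZ. Qed.

HB.instance Definition _ := GRing.isLinear.Build C V 'rV[C]_n *:%R ct ct_is_linear.

Lemma ctP x : ct x = 0 <-> forall i, coef x 0 i = 0.
Proof.
split=> [/rowP H i|H]; first by have := H i; rewrite !mxE.
by apply/rowP => i; rewrite !mxE.
Qed.

Lemma ct_zP x : ct (zmul 1 x) = 0 <-> forall i, coef x (-1) i = 0.
Proof.
have E i : coef (zmul 1 x) 0 i = coef x (-1) i by rewrite coef_zmul sub0r.
split=> [/ctP H i|H]; first by rewrite -E.
by apply/ctP => i; rewrite E.
Qed.

Lemma coef_subspace (S : int -> Prop) :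
  real_subspace (fun f : V => forall j, S j -> forall i, coef f j i = 0).
Proof.
split=> [j _ i|r x y hx hy j Sj i]; last by rewrite coefD coefZ hx// hy// mulr0 addr0.
by rewrite -[0](scale0r 0) coefZ mul0r.
Qed.

Lemma hform_tame : exists N (psi : {linear V -> 'rV[C]_N}),
  [/\ forall x, ip x x = 0 -> psi x = 0,
      forall x, hform x x = 0 -> psi x = 0 -> ip x x = 0 &
      forall H, real_subspace H -> complete_for ip H -> tame ip hform H].
Proof.
apply: (@essential_tame R V ip hform (@Pp R n) (fun f => Pm (Phim f)) Kop (@Hp R n) q) => //.
- by move=> x; exact: hform_le.
- by move=> c f g hf hg; apply: HpD => //; exact: HpZ.
- by move=> x; exact: Pp_Hp.
- by move=> c x y /=; exact: Pp_lin.
- by move=> x; rewrite [X in _ <= X](ip_split x x) lerDr si_ge0.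
- by move=> q' x q01' h; exact: hform_coercive.
Qed.

(** The abstract construction for L^2 and [hform]. Between H^2 and H^2_- that form is multiplication
    by [Phi], whence the negative coefficients. *)
Lemma interpolant_columns : exists u : 'I_n -> V,
  [/\ forall (k : nat) i l, cform ip (zmul k (u i)) (u l) = cform ip (eb k i) (eb 0 l),
      forall (j : int) i l, j < 0 -> coef (u i) j l = coef (Phim (eb 0 i)) j l &
      exists K : R, 0 <= K /\ forall f, Hp f -> exists v g,
        [/\ Hp g, ip g g <= K * ip f f, ip f f = ip v g &
            forall (k : nat) i, coef v k i = cform ip f (zmul k (u i))]].
Proof.
have [N [psi [psi0 apsi tm]]] := hform_tame.
have all_sub : real_subspace (fun _ : V => True) by [].
have all_c := @ip_complete R n.
have tameT := tm _ all_sub all_c.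
have ab := hform_le contr.
have acT := tame_complete bP aP ab all_sub all_c tameT.
(* One statement serves both the domain and the range of the shift, each given by a single vanishing
   coefficient. *)
have ac (S : int -> Prop) : complete_for hform (fun f : V => forall j, S j -> forall i, coef f j i = 0).
  have s := coef_subspace S; have c := @coef_complete R n S.
  exact: (tame_complete bP aP ab s c (tm _ s c)).
have Dc : complete_for hform (fun x => ct (zmul 1 x) = 0).
  have -> : (fun x => ct (zmul 1 x) = 0) = (fun f : V => forall j, j = -1 -> forall i, coef f j i = 0).
    apply/funext => x; apply/propext; split=> [/ct_zP H j ->//|H].
    by apply/ct_zP; exact: H.
  exact: ac.
have Rc : complete_for hform (fun x => ct x = 0).
  have -> : (fun x => ct x = 0) = (fun f : V => forall j, j = 0 -> forall i, coef f j i = 0).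
    apply/funext => x; apply/propext; split=> [/ctP H j ->//|H].
    by apply/ctP; exact: H.
  exact: ac.
have [W [Wi [WK WiK aW Wz]]] : exists W Wi : {linear V -> V},
    [/\ cancel W Wi, cancel Wi W, forall x y, hform (W x) (W y) = hform x y &
        forall x, ct (zmul 1 x) = 0 -> W x = zmul 1 x].
  have bz (x : V) : ip (zmul 1 x) (zmul 1 x) = ip x x by exact: ip_zmul.
  have ct0 x : ip x x = 0 -> ct x = 0 by move=> x0; apply/ctP => i; exact: coef_null.
  have cte i : ct (eb 0 i) = delta_mx 0 i.
    by apply/rowP => l; rewrite !mxE coef_eb !eqxx eq_sym.
  have aiso x y : ct (zmul 1 x) = 0 -> ct (zmul 1 y) = 0 ->
      hform (zmul 1 x) (zmul 1 y) = hform x y.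
    by move=> /ct_zP hx /ct_zP hy; exact: hform_zmul.
  exact: (@isometric_extension R V n N hform ip (zmul 1) (zmul (-1)) ct psi (eb 0)
    aP (zmulK 1) (zmulNK 1) bz ct0 psi0 apsi cte aiso Dc Rc).
have aHm y : exists w, forall h, Hm h -> hform y h = ip w h.
  by exists (y + Phim (Pp y)) => h hh; exact: hform_Hm.
have aHp x : exists v, forall f, Hp f -> hform x f = ip v f.
  by exists (x + Mul (Linf_adj PhiL) (Pm x)) => f hf; exact: hform_Hp.
have [u [u1 u2 u3]] := @scattering R n V ip hform (fun j => zmul j) eb
  (@Pm R n) (@Pp R n) W Wi bP aP all_c acT tameT (@zmulD R n) (@zmul0 R n) (@ip_zmul R n)
  (@zmul_eb R n) (@null_of_coef R n) (@coef_eb R n) (@Pm_Hm R n) (@Pp_Hp R n)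
  (@PmPp R n) (@Hp_Hm_orth R n)
  aHm aHp
  (@hform_HmHm R n Phi PhiL) (@hform_HpHp R n Phi PhiL) WiK aW
  (fun x hx => Wz x ((ct_zP x).2 hx)).
exists u; split=> // j i l j0; rewrite [LHS]u2//.
have h1 : Hp (eb 0 i) by exact: Hp_eb.
have h2 : Hm (eb j l) by exact: Hm_eb.
have h3 : Hm ('i *: eb j l) by exact: HmZ.
by rewrite /cform (hform_HpHm PhiL h1 h2) (hform_HpHm PhiL h1 h3).
Qed.

End Columns.

(** * Hankel norms *)

Section Conversion.
Variables (R : realType) (n : nat).
Local Notation C := (R[i]).
Local Notation V := (L2space R n).
Local Notation ip := (@ip R n).
Local Notation eb := (@eb R n).
Local Notation mu := (@lebesgue_measure R).
Local Notation D := (@Tdom R).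
Local Open Scope complex_scope.
Let bP : semi_inner ip := @ip_semi_inner R n.

Lemma l2norm_le (f : V) (c : R) : 0 <= c -> (l2norm f <= Num.sqrt c) = (ip f f <= c).
Proof. by move=> c0; rewrite l2normE ler_sqrt. Qed.

Lemma l2norm_le1 (f : V) : (l2norm f <= 1) = (ip f f <= 1).
Proof. by rewrite -{1}(@sqrtr1 R) l2norm_le. Qed.

(** Rescaling to the unit sphere. A null [f] can be scaled at will inside the unit ball, so
    [G f > 0] would contradict the bound. *)
Lemma Hp_scale (G : V -> R) (c : R) :
  (forall f, Hp f -> ip f f <= 1 -> G f <= c) ->
  (forall (r : R) f, Hp f -> G (r%:C *: f) = r ^+ 2 * G f) ->
  forall f, Hp f -> G f <= c * ip f f.
Proof.
move=> Gc GZ f hf; have f0 := si_ge0 bP f.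
have [z|fn] := eqVneq (ip f f) 0.
  rewrite z mulr0 leNgt; apply/negP => Gp.
  have c0 : 0 <= c by apply: le_trans (ltW Gp) (Gc _ hf _); rewrite z.
  (* The factor is chosen so that [G] of the multiple is at least [c + 1]. *)
  have := Gc (((c + 1) / G f + 1)%:C *: f) (HpZ _ hf).
  rewrite (siZl bP) (siZr bP) z !mulr0 GZ// => /(_ ler01).
  set r := (c + 1) / G f; have r0 : 0 < r by rewrite divr_gt0//; lra.
  have rG : r * G f = c + 1 by rewrite /r divfK// gt_eqF.
  have : r * G f <= (r + 1) ^+ 2 * G f.
    by apply: ler_wpM2r; [exact: ltW|nra].
  by lra.
have fp : 0 < ip f f by rewrite lt_def fn.
pose r := (Num.sqrt (ip f f))^-1.
have rr : r ^+ 2 * ip f f = 1 by rewrite exprVn sqr_sqrtr// mulVf.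
have := Gc (r%:C *: f) (HpZ _ hf).
rewrite (siZl bP) (siZr bP) mulrA -expr2 rr lexx GZ// => /(_ isT) h.
by rewrite -ler_pdivrMr// mulrC -[(ip f f)^-1]mul1r -rr mulfK.
Qed.

Lemma hankel_Pm (F : R -> 'M[C]_n) (FL : Linf F) (f : V) : hankel F f (Pm (Mul FL f)).
Proof.
split; first by apply/H2minus_Hm; exact: Pm_Hm.
have -> : (fun t => F t *m f t - Pm (Mul FL f) t) = L2fun (Mul FL f - Pm (Mul FL f)).
  by apply/funext => t; rewrite L2funB MulE.
by apply/H2_Hp; have := Pp_Hp (Mul FL f); rewrite PmE subKr.
Qed.

Lemma hankel_sim (F : R -> 'M[C]_n) (FL : Linf F) (f h : V) : hankel F f h -> sim (Pm (Mul FL f)) h.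
Proof.
move=> [/H2minus_Hm hm hp]; apply: Pm_sim => //; apply/H2_Hp.
have <- : (fun t => F t *m f t - h t) = L2fun (Mul FL f - h) by apply/funext => t; rewrite L2funB MulE.
exact: hp.
Qed.

Lemma Pm_MulZ (F : R -> 'M[C]_n) (FL : Linf F) (c : C) f : sim (Pm (Mul FL (c *: f))) (c *: Pm (Mul FL f)).
Proof. by rewrite linearZ; exact: PmZ. Qed.

Lemma sim_ipxx (x y : V) : sim x y -> ip x x = ip y y.
Proof. by move=> h; rewrite (sim_ipl _ h) (sim_ipr _ h). Qed.

Lemma sim_scale (r : R) (x y : V) : sim x (r%:C *: y) -> ip x x = r ^+ 2 * ip y y.
Proof. by move=> /sim_ipxx ->; rewrite (siZl bP) (siZr bP) expr2 -mulrA. Qed.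

Lemma hankel_norm_le (F : R -> 'M[C]_n) (FL : Linf F) (c : R) : 0 <= c ->
  (forall f, Hp f -> ip (Pm (Mul FL f)) (Pm (Mul FL f)) <= c * ip f f) ->
  (hankel_norm F <= (Num.sqrt c)%:E)%E.
Proof.
move=> c0 H; apply: ge_ereal_sup => _ [f [h [fH f1 fh ->]]]; rewrite lee_fin.
have fL : L2 f by case: fH. have hL : L2 h by case: fh => -[].
have -> : (fun t => h t - (0 : R -> 'cV[C]_n) t) = L2fun (toL2 hL).
  by apply/funext => t; rewrite /= subr0.
rewrite l2norm_le// -(sim_ipxx (@hankel_sim F FL (toL2 fL) (toL2 hL) fh)).
have f1' : ip (toL2 fL) (toL2 fL) <= 1 by rewrite -l2norm_le1.
have hf : Hp (toL2 fL) by apply/H2_Hp.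
by apply: le_trans (H _ hf) _; exact: ler_piMr.
Qed.

Lemma hankel_norm_contr (F : R -> 'M[C]_n) (FL : Linf F) : (hankel_norm F <= 1%:E)%E ->
  forall f, Hp f -> ip (Pm (Mul FL f)) (Pm (Mul FL f)) <= ip f f.
Proof.
move=> F1; have := @Hp_scale (fun f => ip (Pm (Mul FL f)) (Pm (Mul FL f))) 1.
move=> H f hf; rewrite -[X in _ <= X]mul1r; apply: H hf => [{}f hf f1|r {}f hf].
  have : ((l2norm (Pm (Mul FL f)))%:E <= 1%:E)%E.
    apply: le_trans F1; apply: ereal_sup_ubound.
    exists f, (Pm (Mul FL f)); split.
    - exact/H2_Hp.
    - by rewrite l2norm_le1.
    - exact: hankel_Pm.
    - by congr (l2norm _)%:E; apply/funext => t; rewrite subr0.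
  by rewrite lee_fin l2norm_le1.
exact: sim_scale (Pm_MulZ FL r%:C f).
Qed.

(** Norms become squared norms, whence [q0 ^+ 2] and nets of radius [Num.sqrt e]; an operator on
    functions becomes one on [L2space]. *)
Lemma hankel_ess_data (F : R -> 'M[C]_n) (FL : Linf F) : (hankel_ess_norm F < 1%:E)%E ->
  exists (Kop : V -> V) (q : R), [/\ 0 <= q < 1,
    forall c f g, Hp f -> Hp g -> Kop (c *: f + g) = c *: Kop f + Kop g,
    forall f, Hp f -> ip (Pm (Mul FL f) - Kop f) (Pm (Mul FL f) - Kop f) <= q * ip f f &
    forall e : R, 0 < e -> exists N (g : nat -> V), forall f, Hp f ->
      ip f f <= 1 -> exists2 i, (i < N)%N & ip (Kop f - g i) (Kop f - g i) < e].
Proof.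
move=> /ereal_inf_lt[_ [K [[K1 [K2 K3]] ->]] K4].
(* Functions outside L^2 are sent to 0; [K] produces none of them on H^2. *)
pose emb (f : R -> 'cV[C]_n) : V := if pselect (L2 f) is left h then toL2 h else 0.
have embE f : L2 f -> L2fun (emb f) = f by rewrite /emb; case: pselect.
pose Kop (f : V) : V := emb (K f).
have KopE f : Hp f -> L2fun (Kop f) = K f.
  by move=> hf; apply: embE; case: (K1 f) => //; exact/H2_Hp.
have KL c f g : Hp f -> Hp g -> Kop (c *: f + g) = c *: Kop f + Kop g.
  move=> hf hg; apply: L2space_eq => t.
  rewrite L2funD L2funZ !KopE//; last by apply: HpD => //; exact: HpZ.
  have -> : L2fun (c *: f + g) = (fun t => c *: f t + g t) by [].
  by rewrite K2//; exact/H2_Hp.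
(* A nonnegative real bound, whatever extended value below 1 the norm takes. *)
have [q0 [q00 q01 qP]] : exists q0 : R, [/\ 0 <= q0, q0 < 1 & (hankel_minus_norm F K <= q0%:E)%E].
  case: (hankel_minus_norm F K) K4 => [r| |] //; rewrite ?lte_fin => r1.
    exists (Num.max r 0); split; [by rewrite le_max lexx orbT| |by rewrite lee_fin le_max lexx].
    by rewrite gt_max r1 ltr01.
  by exists 0; split=> //; rewrite leNye.
exists Kop, (q0 ^+ 2); split=> //.
- by rewrite sqr_ge0 /= expr_lt1.
- apply: (@Hp_scale (fun f => ip (Pm (Mul FL f) - Kop f) (Pm (Mul FL f) - Kop f))).
    move=> f hf f1; rewrite -l2norm_le ?sqr_ge0// sqrtr_sqr ger0_norm// -lee_fin.
    apply: le_trans qP; apply: ereal_sup_ubound; exists f, (Pm (Mul FL f)); split.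
    - exact/H2_Hp.
    - by rewrite l2norm_le1.
    - exact: hankel_Pm.
    - by congr (l2norm _)%:E; apply/funext => t; rewrite L2funB KopE.
  move=> r f hf.
  have KZ : Kop (r%:C *: f) = r%:C *: Kop f.
    have h0 : Hp (0 : V) by exact: Hp0.
    have K0 : Kop 0 = 0 by have := KL (-1) 0 0 h0 h0; rewrite scaler0 addr0 scaleN1r addNr.
    by have := KL r%:C f 0 hf h0; rewrite K0 !addr0.
  have : sim (Pm (Mul FL (r%:C *: f)) - Kop (r%:C *: f)) (r%:C *: (Pm (Mul FL f) - Kop f)).
    by rewrite KZ scalerBr /sim opprB addrA subrK; exact: Pm_MulZ.
  exact: sim_scale.
move=> e e0; have se0 : 0 < Num.sqrt e by rewrite sqrtr_gt0.
have [s [sL sP]] := K3 _ se0.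
exists (size s), (fun i => emb (nth (fun=> 0) s i)) => f hf f1.
have [||g gs gP] := sP f; first exact/H2_Hp.
  by rewrite l2norm_le1.
exists (index g s); first by rewrite index_mem.
have := gP; rewrite nth_index//.
have -> : (fun t => K f t - g t) = L2fun (Kop f - emb g).
  by apply/funext => t; rewrite L2funB KopE// embE//; exact: sL.
by rewrite l2normE ltr_sqrt.
Qed.

End Conversion.

(** * The unitary function built from columns *)

Section Interpolant.
Variables (R : realType) (n : nat).
Local Notation C := (R[i]).
Local Notation V := (L2space R n).
Local Notation ip := (@ip R n).
Local Notation eb := (@eb R n).
Local Notation mu := (@lebesgue_measure R).
Local Notation D := (@Tdom R).
Local Open Scope complex_scope.
Let bP : semi_inner ip := @ip_semi_inner R n.

Lemma ae_all (T : finType) (P : T -> R -> Prop) :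
  (forall i, {ae mu, forall t, P i t}) -> {ae mu, forall t, forall i, P i t}.
Proof.
move=> H; suff : {ae mu, forall t, forall i, i \in enum T -> P i t}.
  by apply: aeS => t h i; apply: h; rewrite mem_enum.
elim: (enum T) => [|i s IH]; first exact: aeW.
apply: aeS (aeI (H i) IH) => t [h1 h2] k; rewrite inE => /predU1P[->//|]; exact: h2.
Qed.

Lemma fourier_Mul (F : R -> 'M[C]_n) (FL : Linf F) (j : int) l i :
  fourier F j l i = coef (Mul FL (eb 0 i)) j l.
Proof.
rewrite mxE coefE; apply: eq_cint => t _.
by rewrite MulE ebE zt0 scale1r -colE mxE.
Qed.

Lemma coef_Mul_eb (F : R -> 'M[C]_n) (FL : Linf F) (j k : int) l i :
  coef (Mul FL (eb k i)) j l = fourier F (j - k) l i.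
Proof. by rewrite -[k in LHS]addr0 -zmul_eb Mul_zmul coef_zmul -fourier_Mul. Qed.

Lemma cint_hdotB (f g f' g' : V) :
  cint (fun t => hdot (f t) (g t) - hdot (f' t) (g' t)) = cform ip f g - cform ip f' g'.
Proof.
rewrite cintE; apply: complexP; rewrite ?cReD ?cImD ?cReN ?cImN /=.
  rewrite -circB; [|exact: integ_rdot..].
  by apply: eq_circ => t _; rewrite cReD cReN !Re_hdot.
rewrite -circB; [|exact: integ_rdot..].
by apply: eq_circ => t _; rewrite cImD cImN !Im_hdot.
Qed.

Lemma hdotZl (c : C) (v w : 'cV[C]_n) : hdot (c *: v) w = c * hdot v w.
Proof. by rewrite mulr_sumr; apply: eq_bigr => i _; rewrite mxE mulrA. Qed.

(** The Fourier coefficients of the pointwise products are pairings with shifts of [f], so equal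
    pairings force equal values almost everywhere. *)
Lemma hdot_fourier_unique (f g f' g' : V) :
  (forall j, cform ip (zmul j f) g = cform ip (zmul j f') g') ->
  {ae mu, forall t, D t -> hdot (f t) (g t) = hdot (f' t) (g' t)}.
Proof.
move=> H.
have : {ae mu, forall t, D t -> hdot (f t) (g t) - hdot (f' t) (g' t) = 0}.
  apply: complex_fourier_unique.
  - have := integB (integ_rdot f g) (integ_rdot f' g'); apply: eq_integ => t _.
    by rewrite cReD cReN !Re_hdot.
  - have := integB (integ_rdot f ('i *: g)) (integ_rdot f' ('i *: g')).
    by apply: eq_integ => t _; rewrite cImD cImN !Im_hdot.
  move=> j; transitivity (cform ip (zmul (- j) f) g - cform ip (zmul (- j) f') g').
    rewrite -cint_hdotB; apply: eq_cint => t _.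
    by rewrite !zmulE !hdotZl -mulrBr mulrC ztN.
  by rewrite H subrr.
by apply: aeS => t h Dt; apply/eqP; rewrite -subr_eq0; apply/eqP; exact: h.
Qed.

Lemma cform_zmulN (k : int) (f g : V) : cform ip (zmul (- k) f) g = (cform ip (zmul k g) f)^*.
Proof. by rewrite -(cform_zmul k) zmulNK (cformC bP). Qed.

Definition colfun (u : 'I_n -> V) (t : R) : 'M[C]_n := \matrix_(r, c) u c t r 0.

Lemma colfun_mul u t i : colfun u t *m (delta_mx i 0 : 'cV[C]_n) = u i t.
Proof. by rewrite -colE; apply/matrixP => r c; rewrite !mxE ord1. Qed.

Section OrthonormalColumns.
Variable u : 'I_n -> V.
Hypothesis uu : forall (k : nat) i l, cform ip (zmul k (u i)) (u l) = cform ip (eb k i) (eb 0 l).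

Lemma colfun_unitary : {ae mu, forall t, D t -> adjmx (colfun u t) *m colfun u t = 1%:M}.
Proof.
have H (il : 'I_n * 'I_n) : {ae mu, forall t, D t ->
    hdot (u il.1 t) (u il.2 t) = hdot (eb 0 il.1 t) (eb 0 il.2 t)}.
  apply: hdot_fourier_unique => -[k|k].
    by rewrite zmul_eb addr0; exact: uu.
  (* Negative powers follow from positive ones by conjugation. *)
  by rewrite NegzE !cform_zmulN zmul_eb addr0; congr (_^*); exact: uu.
apply: aeS (ae_all H) => t h Dt; apply/matrixP => l i.
transitivity (hdot (u i t) (u l t)).
  by rewrite mxE; apply: eq_bigr => r _; rewrite !mxE mulrC.
have /= -> := h (i, l) Dt; rewrite !ebE zt0 !scale1r -[delta_mx l 0]scale1r hdot_delta.
by rewrite rmorph1 mulr1 !mxE andbT.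
Qed.

Lemma colfun_Linf : Linf (colfun u).
Proof.
split=> [r c|].
  have [m _] := L2fun_L2 (u c); have [m1 m2] := m r 0; split.
    by move: m1; congr measurable_fun; apply/funext => t; rewrite mxE.
  by move: m2; congr measurable_fun; apply/funext => t; rewrite mxE.
exists 1; apply: aeS colfun_unitary => t h Dt r c.
(* Columns of an isometry have norm 1, which bounds the entries. *)
have -> : 1 = vnorm2 (u c t) :> R.
  rewrite -rdotxx -(colfun_mul u t) rdot_adj mulmxA h// mul1mx rdotxx.
  rewrite /vnorm2 (bigD1 c) //= big1 => [|i ic]; rewrite mxE ?eqxx /cabs2 /=.
    by rewrite expr1n expr0n !addr0.
  by rewrite (negbTE ic) /= expr0n addr0.
by rewrite mxE; exact: cabs2_le_vnorm2.
Qed.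

Lemma colfun_eb (k : int) i : Mul colfun_Linf (eb k i) = zmul k (u i).
Proof. by apply: L2space_eq => t; rewrite MulE zmulE ebE -scalemxAr colfun_mul. Qed.

End OrthonormalColumns.
End Interpolant.

(** * Hankel operators of unitary functions and of their adjoints *)

Section UnitaryHankel.
Variables (R : realType) (n : nat).
Local Notation C := (R[i]).
Local Notation V := (L2space R n).
Local Notation ip := (@ip R n).
Local Notation eb := (@eb R n).
Local Notation mu := (@lebesgue_measure R).
Local Notation D := (@Tdom R).
Local Open Scope complex_scope.
Let bP : semi_inner ip := @ip_semi_inner R n.

Lemma cform_Mul_adj (F : R -> 'M[C]_n) (FL : Linf F) f g :
  cform ip (Mul (Linf_adj FL) f) g = cform ip f (Mul FL g).
Proof.
have E h : ip (Mul (Linf_adj FL) f) h = ip f (Mul FL h).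
  by rewrite (siC bP) -Mul_adj (siC bP).
by rewrite /cform !E [Mul FL ('i *: g)]linearZ.
Qed.

Lemma adjfun_unitary (U : R -> 'M[C]_n) :
  {ae mu, forall t, D t -> adjmx (U t) *m U t = 1%:M} ->
  {ae mu, forall t, D t -> adjmx (adjfun U t) *m adjfun U t = 1%:M}.
Proof. by apply: aeS => t h Dt; rewrite /adjfun adjmxK; apply: mulmx1C; exact: h. Qed.

Lemma compact_op0 : compact_op (fun (_ : R -> 'cV[C]_n) (_ : R) => 0 : 'cV[C]_n).
Proof.
split=> [f _|]; first by apply/(H2minus_Hm (0 : V)); exact: Hm0.
split=> [a f g _ _|e e0]; first by apply/funext => t; rewrite scaler0 addr0.
exists [:: fun=> 0]; split=> [g|f _ _].
  by rewrite inE => /eqP ->; exact: (L2fun_L2 (0 : V)).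
exists (fun=> 0); first by rewrite inE.
have -> : (fun t : R => 0 - 0 : 'cV[C]_n) = L2fun (0 : V) by apply/funext => t; rewrite subr0.
by rewrite l2normE (si0l bP) sqrtr0.
Qed.

Lemma hankel_ess_norm_le (F : R -> 'M[C]_n) : (hankel_ess_norm F <= hankel_norm F)%E.
Proof.
by apply: ereal_inf_lbound; exists (fun _ _ => 0); split=> //; exact: compact_op0.
Qed.

(** Write [F = |f|^2] and [p = |P_+ U^* f|^2]. Cauchy-Schwarz with [g] gives [F <= K p], and U^* is
    isometric, so [|P_- U^* f|^2 = F - p]. This bounds the norm itself, and the essential norm is no
    larger. *)
Lemma unitary_hankel_ess_norm_lt1 (U : R -> 'M[C]_n) (UL : Linf U) (K : R) : 0 <= K ->
  {ae mu, forall t, D t -> adjmx (U t) *m U t = 1%:M} ->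
  (forall f, Hp f -> exists v g, [/\ Hp g, ip g g <= K * ip f f, ip f f = ip v g &
     forall (k : nat) i, coef v k i = cform ip f (Mul UL (eb k i))]) ->
  (hankel_ess_norm (adjfun U) < 1%:E)%E.
Proof.
move=> K0 Uu H; have AL := Linf_adj UL.
(* [K + 1] rather than [K], which may be 0. *)
pose c : R := 1 - (K + 1)^-1.
have K1 : 0 < K + 1 by lra.
have c1 : c < 1 by rewrite /c ltrBlDr ltrDl invr_gt0.
have c0 : 0 <= c by rewrite /c subr_ge0 invf_le1//; lra.
apply: le_lt_trans (hankel_ess_norm_le _) _.
apply: (@le_lt_trans _ _ (Num.sqrt c)%:E); last by rewrite lte_fin -sqrtr1 ltr_sqrt.
apply: (hankel_norm_le (FL := AL)) => // f hf.
have [v [g [hg gK fv vP]]] := H f hf.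
have Af : ip (Mul AL f) (Mul AL f) = ip f f.
  by apply: Mul_unitary_ip; exact: adjfun_unitary.
(* [v] and U^* f share their nonnegative coefficients, so they differ by an element of H^2_-. *)
have hm : Hm (v - Mul AL f).
  case=> // k _ i; rewrite coefB vP; apply/eqP; rewrite subr_eq0; apply/eqP.
  by rewrite (Prop_irrelevance AL (Linf_adj UL)) -cform_Mul_adj coef_cform.
have fP : ip f f = ip (Pp (Mul AL f)) g.
  have o1 : ip (v - Mul AL f) g = 0 by rewrite (siC bP); exact: Hp_Hm_orth.
  have o2 : ip (Pm (Mul AL f)) g = 0 by rewrite (siC bP); apply: Hp_Hm_orth => //; exact: Pm_Hm.
  have e1 : ip v g = ip (Mul AL f) g by apply/eqP; rewrite -subr_eq0 -(siBl bP) o1.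
  by rewrite fv e1 -{1}[Mul AL f]PmPp (siDl bP) o2 add0r.
have := cauchy_schwarz bP (Pp (Mul AL f)) g; rewrite -fP.
have := ip_split (Mul AL f) (Mul AL f); rewrite Af.
have := si_ge0 bP f; have := si_ge0 bP (Pp (Mul AL f)).
move: gK; move: (ip f f) (ip g g) => F G.
move: (ip (Pp _) _) (ip (Pm _) _) => p m gK p0 F0 Fmp cs.
have FKp : F <= K * p.
  have [z|Fn] := eqVneq F 0; first by rewrite z mulr_ge0.
  have Fp : 0 < F by rewrite lt_def Fn.
  rewrite -(ler_pM2l Fp); apply: le_trans (_ : p * G <= _); first by rewrite -expr2.
  by rewrite mulrA [F * K]mulrC [leRHS]mulrC; apply: ler_wpM2l.
have : (K + 1)^-1 * F <= p by rewrite mulrC ler_pdivrMr//; lra.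
by rewrite /c mulrBl mul1r; lra.
Qed.

(** By duality: coefficient [j] of (Phi - U) f is the pairing of [f] with (Phi - U)^* z^j e_i. For
    [j < 0] the latter lies in H^2_-, as Phi - U has no negative coefficients. *)
Lemma interpolant_Hp (Phi U : R -> 'M[C]_n) (PhiL : Linf Phi) (UL : Linf U) :
  (forall j : int, j < 0 -> fourier U j = fourier Phi j) ->
  forall f, Hp f -> Hp (Mul PhiL f - Mul UL f).
Proof.
move=> UF f hf j j0 i.
have w : Hm (Mul (Linf_adj PhiL) (eb j i) - Mul (Linf_adj UL) (eb j i)).
  move=> k k0 l; rewrite coefB.
  have E F (FL : Linf F) : coef (Mul (Linf_adj FL) (eb j i)) k l = (fourier F (j - k) i l)^*.
    by rewrite coef_cform cform_Mul_adj (cformC bP) -coef_cform -coef_Mul_eb.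
  by rewrite !E UF ?subrr//; lia.
have E h : ip (Mul PhiL f - Mul UL f) h = ip f (Mul (Linf_adj PhiL) h - Mul (Linf_adj UL) h).
  by rewrite (siBl bP) !Mul_adj (siBr bP).
rewrite coef_cform; apply/cform_eq0; rewrite !E; split; first exact: Hp_Hm_orth.
rewrite [Mul _ ('i *: _)]linearZ [X in _ - X]linearZ -scalerBr.
by apply: Hp_Hm_orth => //; exact: HmZ.
Qed.

Lemma unitary_interpolant_hankel_norm (Phi U : R -> 'M[C]_n) : Linf Phi ->
  unitary_interpolant Phi U -> (hankel_norm Phi <= 1%:E)%E.
Proof.
move=> PhiL [UL Uu UF]; rewrite -(@sqrtr1 R); apply: (hankel_norm_le (FL := PhiL)) => // f hf.
rewrite mul1r; have /sim_ipxx -> : sim (Pm (Mul PhiL f)) (Pm (Mul UL f)).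
  apply: Pm_sim; first exact: Pm_Hm.
  have -> : Mul PhiL f - Pm (Mul UL f) = (Mul PhiL f - Mul UL f) + Pp (Mul UL f).
    by rewrite PmE opprB addrA addrAC.
  by apply: HpD; [exact: interpolant_Hp|exact: Pp_Hp].
rewrite -(Mul_unitary_ip UL f Uu) [X in _ <= X]ip_split lerDl; exact: si_ge0.
Qed.

Lemma unitary_interpolant_exists (Phi : R -> 'M[C]_n) : Linf Phi ->
  (hankel_ess_norm Phi < 1%:E)%E -> (hankel_norm Phi <= 1%:E)%E ->
  exists U : R -> 'M[C]_n,
    unitary_interpolant Phi U /\ (hankel_ess_norm (adjfun U) < 1%:E)%E.
Proof.
move=> PhiL ess nrm.
have [Kop [q [q01 KL KP Knet]]] := hankel_ess_data PhiL ess.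
have [u [uu uF [K [K0 uK]]]] :=
  interpolant_columns (hankel_norm_contr PhiL nrm) q01 KL KP Knet.
exists (colfun u); split; first split.
- exact: colfun_Linf.
- exact: colfun_unitary.
- move=> j j0; apply/matrixP => l i.
  rewrite (fourier_Mul (colfun_Linf uu)) (fourier_Mul PhiL) -uF// colfun_eb.
  by rewrite coef_zmul subr0.
apply: (unitary_hankel_ess_norm_lt1 (UL := colfun_Linf uu) K0); first exact: colfun_unitary.
move=> f hf; have [v [g [h1 h2 h3 h4]]] := uK f hf.
exists v, g; split; [exact: h1|exact: h2|exact: h3|move=> k i].
by rewrite (colfun_eb uu k i); exact: h4.
Qed.

End UnitaryHankel.

Theorem theorem3p1 (R : realType) (n : nat) (Phi : R -> 'M[R[i]]_n) :
  Linf Phi -> (hankel_ess_norm Phi < 1%:E)%E ->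
  ((exists U : R -> 'M[R[i]]_n,
      unitary_interpolant Phi U /\ (hankel_ess_norm (adjfun U) < 1%:E)%E)
   <-> (hankel_norm Phi <= 1%:E)%E).
Proof.
move=> PhiL ess; split=> [[U [UP _]]|].
  exact: unitary_interpolant_hankel_norm UP.
exact: unitary_interpolant_exists.
Qed.
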